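(* Given a macroscopic strain $A\in\mathcal M_3^s(\mathbb R)$, there exists a unique vector field $u_A\in LP_0\cap LP(A)$ that satisfies $$\mathcal J(u_A)=\inf_{u\in LP_0\cap LP(A)}\mathcal J(u),\qquad\text{where}\quad \mathcal J(u)=\frac12\int_Y\langle C\,\nabla_s u,\nabla_s u\rangle\,dy\quad\text{for all }u\in LP_0\cap LP(A).$$ Moreover, $u_A$ is the solution of the variational formulation: find $u_A\in LP_0\cap LP(A)$ such that $\int_Y\langle C\,\nabla_s u_A,\nabla_s v\rangle\,dy=0$ for all $v\in H^1_{\#0}$.
   Context: Let $\mathcal G\subset\mathbb R^3$ be the lattice (additive group) generated by three linearly independent vectors $g_1,g_2,g_3$, and let $Y=\{s_1g_1+s_2g_2+s_3g_3: s_1,s_2,s_3\in[0,1]\}$ be the periodicity cell. A function on $\mathbb R^3$ is $\mathcal G$-periodic if it is invariant under translations by vectors of $\mathcal G$. $\mathcal M_3^s(\mathbb R)$ is the space of real symmetric $3\times3$ matrices, $\langle\cdot,\cdot\rangle$ is the inner product of matrices, and $\nabla_s v$ is the symmetric part of the gradient of $v$ (the microscopic strain). $H^1_\#$ is the space of $\mathcal G$-periodic vector fields in $H^1_{\rm loc}(\mathbb R^3,\mathbb R^3)$, with the $H^1(Y,\mathbb R^3)$ norm; $H^1_{\#0}=\{v\in H^1_\#\mid\frac1{|Y|}\int_Y v\,dy=0\}$. For $A\in\mathcal M_3^s(\mathbb R)$, $LP(A)=\{u:\mathbb R^3\to\mathbb R^3 \mid u(y)=Ay+\varphi(y),\ \varphi\in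 H^1_\#\}$; $LP=\bigcup_{A\in\mathcal M_3^s(\mathbb R)}LP(A)$ and $LP_0=\{v\in LP\mid\frac1{|Y|}\int_Y v\,dy=0\}$. The setting is linearized elasticity of a periodic microstructure: the rigidity $C:\mathbb R^3\to\mathbb R^{81}$ is a $\mathcal G$-periodic fourth-order tensor field, acting on matrices, with inverse tensor $D=C^{-1}$ (the compliance tensor).
   Formalization: The rigidity C is additionally assumed to have bounded measurable entries and to be self-adjoint and uniformly coercive on symmetric matrices almost everywhere; for a merely periodic invertible C, such as minus the identity, J is unbounded below and no minimizer exists. *)

(* Defs.v *)
From HB Require Import structures.
From mathcomp Require Import all_boot all_order all_algebra.
From mathcomp Require Import all_classical all_reals all_analysis.
Import Order.TTheory GRing.Theory Num.Theory numFieldNormedType.Exports.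

Set Implicit Arguments.
Unset Strict Implicit.
Unset Printing Implicit Defensive.

Local Open Scope classical_set_scope.
Local Open Scope ring_scope.

(* Points of space are triples, so that the product measure and the product
   norm of the library apply; values of vector fields are column vectors. *)
Notation R3 R := (R * R * R)%type.

Section Space.
Context {R : realType}.

Definition leb3 :
    {measure set (measurableTypeR R * measurableTypeR R * measurableTypeR R)
       -> \bar R} :=
  ((lebesgue_measure \x lebesgue_measure) \x lebesgue_measure)%E.

Definition posvec (y : R3 R) : 'cV[R]_3 := \col_i [:: y.1.1; y.1.2; y.2]`_i.

Definition stdbasis (j : 'I_3) : R3 R :=
  ((j == 0%N :> nat)%:R, (j == 1%N :> nat)%:R, (j == 2%N :> nat)%:R).

Definition lin_indep (g : 'I_3 -> R3 R) : Prop :=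
  row_free (\matrix_i (posvec (g i))^T).

Definition lattice (g : 'I_3 -> R3 R) : set (R3 R) :=
  [set \sum_i g i *~ z i | z in [set: 'I_3 -> int]].

Definition cell (g : 'I_3 -> R3 R) : set (R3 R) :=
  [set \sum_i s i *: g i | s in [set s : 'I_3 -> R | forall i, 0 <= s i <= 1]].

(* Fields are representatives of Lebesgue classes, hence invariance under each
   lattice translation is required almost everywhere. *)
Definition lattice_periodic (g : 'I_3 -> R3 R) (T : Type) (f : R3 R -> T) : Prop :=
  forall h, lattice g h -> {ae leb3, forall y : R3 R, f (y + h) = f y}.

Definition partials (s : seq 'I_3) (f : R3 R -> R) : R3 R -> R :=
  foldr (fun j h => fun x => 'D_(stdbasis j) h x) f s.

Definition smooth (f : R3 R -> R) : Prop :=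
  forall s, continuous (partials s f) /\
    forall j x, derivable (partials s f) x (stdbasis j).

Definition test_function (f : R3 R -> R) : Prop :=
  smooth f /\ compact (closure [set x | f x != 0]).

Definition L2loc (f : R3 R -> R) : Prop :=
  forall K : set (R3 R), compact K -> f \_ K \in Lfun leb3 2%:E.

Definition is_wderiv (j : 'I_3) (f h : R3 R -> R) : Prop :=
  forall p, test_function p ->
    \int[leb3]_x (f x * 'D_(stdbasis j) p x) = - \int[leb3]_x (h x * p x).

(* A chosen representative: the weak derivative is unique almost everywhere. *)
Definition wderiv (j : 'I_3) (f : R3 R -> R) : R3 R -> R :=
  xget (fun=> 0) [set h | L2loc h /\ is_wderiv j f h].

Definition component (u : R3 R -> 'cV[R]_3) (i : 'I_3) : R3 R -> R :=
  fun y => u y i 0.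

Definition H1loc : set (R3 R -> 'cV[R]_3) :=
  [set u | forall i, L2loc (component u i) /\
     forall j, exists h, L2loc h /\ is_wderiv j (component u i) h].

Definition grad (u : R3 R -> 'cV[R]_3) (y : R3 R) : 'M[R]_3 :=
  \matrix_(i, j) wderiv j (component u i) y.

Definition strain (u : R3 R -> 'cV[R]_3) (y : R3 R) : 'M[R]_3 :=
  2^-1 *: (grad u y + (grad u y)^T).

Definition cell_mean (g : 'I_3 -> R3 R) (u : R3 R -> 'cV[R]_3) : 'cV[R]_3 :=
  \col_i ((fine (leb3 (cell g)))^-1 * \int[leb3]_(y in cell g) u y i 0).

Definition H1per (g : 'I_3 -> R3 R) : set (R3 R -> 'cV[R]_3) :=
  [set u | H1loc u /\ lattice_periodic g u].

Definition H1per0 (g : 'I_3 -> R3 R) : set (R3 R -> 'cV[R]_3) :=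
  [set u | H1per g u /\ cell_mean g u = 0].

Definition LPof (g : 'I_3 -> R3 R) (A : 'M[R]_3) : set (R3 R -> 'cV[R]_3) :=
  [set u | exists2 phi, H1per g phi & forall y, u y = A *m posvec y + phi y].

Definition LP (g : 'I_3 -> R3 R) : set (R3 R -> 'cV[R]_3) :=
  \bigcup_(A in [set A : 'M[R]_3 | A^T = A]) LPof g A.

Definition LP0 (g : 'I_3 -> R3 R) : set (R3 R -> 'cV[R]_3) :=
  [set u | LP g u /\ cell_mean g u = 0].

Definition tensor4 : Type := 'I_3 -> 'I_3 -> 'I_3 -> 'I_3 -> R.

Definition tensor_act (T : tensor4) (M : 'M[R]_3) : 'M[R]_3 :=
  \matrix_(i, j) \sum_k \sum_l T i j k l * M k l.

Definition mxdot (M N : 'M[R]_3) : R := \tr (M^T *m N).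

(* Only the action on symmetric matrices is constrained; in particular the
   usual index symmetries C_ijkl = C_jikl = C_klij imply the third clause. *)
Definition rigidity (g : 'I_3 -> R3 R) (C : R3 R -> tensor4) : Prop :=
  [/\ lattice_periodic g C,
      forall i j k l, (fun y => C y i j k l) \in Lfun leb3 +oo%E,
      {ae leb3, forall y : R3 R, forall M N : 'M[R]_3, M^T = M -> N^T = N ->
         mxdot (tensor_act (C y) M) N = mxdot M (tensor_act (C y) N)} &
      exists2 a : R, 0 < a &
        {ae leb3, forall y : R3 R, forall M : 'M[R]_3, M^T = M ->
           a * mxdot M M <= mxdot (tensor_act (C y) M) M}].

Definition energy (g : 'I_3 -> R3 R) (C : R3 R -> tensor4)
    (u : R3 R -> 'cV[R]_3) : R :=
  2^-1 * \int[leb3]_(y in cell g)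
           mxdot (tensor_act (C y) (strain u y)) (strain u y).

End Space.

Arguments tensor4 R : clear implicits.

(* Main.v *)
(* The energy of u = A y + phi is half of B(A + e(phi), A + e(phi)), where e(phi)
   is the strain of phi and B is a bounded symmetric form, coercive on symmetric
   strains. By the parallelogram identity the strains of a minimizing sequence are
   Cauchy in L^2 of the cell; the inequalities of Korn and Poincaré turn this into
   convergence of the fields and of their gradients, and B is lower semicontinuous
   at the limit. Varying u + t v shows that minimizers are weak solutions, and weak
   solutions are unique by coercivity, Korn and Poincaré.

   Both inequalities come from difference quotients rather than from Fourier series
   or density of smooth functions. If w = D_j f weakly, then for a.e. x
   f(x) - f(x - t e_j) is the integral of w(x - s e_j) over 0 <= s <= t, so the
   quotients converge to w in L^2 by continuity of translations. Translations
   preserve the integral of a periodic function over the cell, so difference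
   quotients can be summed by parts; in the limit, the integrals of D_j f D_i h and
   D_i f D_j h over the cell coincide, which gives Korn's inequality with constant 2.
   Averaging |f(x + h) - f(x)|^2 over x and h in the cell gives 2 |f|^2 when f has
   mean zero, which gives Poincaré's inequality. *)

Require Import Defs.
From HB Require Import structures.
From mathcomp Require Import all_boot all_order all_algebra.
From mathcomp Require Import ring lra zify.
From mathcomp Require Import all_classical all_reals all_analysis.
From mathcomp Require Import measurable_realfun ess_sup_inf.
Import Order.TTheory GRing.Theory Num.Theory numFieldNormedType.Exports.
Local Open Scope classical_set_scope.
Local Open Scope ring_scope.

Set Implicit Arguments.
Unset Strict Implicit.
Unset Printing Implicit Defensive.

(** * Square-integrable functions *)

Section SquareIntegrable.
Context d (T : measurableType d) (R : realType) (mu : {measure set T -> \bar R}).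
Variables (D : set T) (mD : measurable D).
Implicit Types f h k : T -> R.

(** Everything is done with representatives and integrals rather than in quotient Hilbert spaces.
    Weak derivatives are chosen functions, so their linearity and periodicity hold only almost
    everywhere, and completeness is proved by hand. Minimizing sequences are taken with error 4^-n
    from the start: the whole sequence then converges, without extraction of subsequences, and the
    limit can be taken pointwise, which preserves periodicity. Integrals over Y are replaced by
    integrals over the half-open cell, whose lattice translates partition space and from which Y
    differs by a null set. The integral of a periodic function over it is invariant under all
    translations, on which summation by parts and the averaging argument rest. The field A y is not
    periodic and in general has nonzero mean on Y. The problem is therefore transferred to the
    periodic part phi, whose mean is prescribed so as to cancel that of A y; differences of two such
    phi are exactly the test fields of the weak formulation. *)

Definition sqint f :=
  measurable_fun D f /\ (\int[mu]_(x in D) (f x ^+ 2)%:E < +oo)%E.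

Definition dot f h := \int[mu]_(x in D) (f x * h x).

Lemma sqint_integrable_sq f : sqint f ->
  mu.-integrable D (fun x => (f x ^+ 2)%:E).
Proof.
move=> [mf foo]; apply/integrableP; split.
  by apply/measurable_EFinP; exact: measurable_funX.
apply: le_lt_trans foo; apply: ge0_le_integral => //=.
- by apply/measurable_EFinP; apply: measurableT_comp => //; exact: measurable_funX.
- by apply/measurable_EFinP; exact: measurable_funX.
- by move=> x _; rewrite lee_fin ger0_norm ?sqr_ge0.
Qed.

Lemma sqint_integrableM f h : sqint f -> sqint h ->
  mu.-integrable D (EFin \o (fun x => f x * h x)).
Proof.
move=> sf sh.
apply: (@le_integrable _ _ _ _ _ mD _ (fun x => (f x ^+ 2)%:E + (h x ^+ 2)%:E)%E).
- by apply/measurable_EFinP; apply: measurable_funM; [case: sf|case: sh].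
- move=> x _ /=; rewrite lee_fin [leRHS]ger0_norm ?addr_ge0 ?sqr_ge0//.
  rewrite normrM -(real_normK (num_real (f x))) -(real_normK (num_real (h x))).
  have := sqr_ge0 (`|f x| - `|h x|).
  have := normr_ge0 (f x); have := normr_ge0 (h x).
  by set a := `|f x|; set b := `|h x|; nra.
- by apply: integrableD => //; exact: sqint_integrable_sq.
Qed.

Lemma sqint0 : sqint (fun=> 0).
Proof.
by split=> //; under eq_integral do rewrite expr0n/=; rewrite integral0.
Qed.

Lemma sqintZ c f : sqint f -> sqint (fun x => c * f x).
Proof.
move=> sf; have [mf _] := sf; split; first exact: measurable_funM.
have /integrableZl := sqint_integrable_sq sf => /(_ mD (c ^+ 2)) /integrable_lty.
rewrite (_ : (fun _ => _) = (fun x => ((c * f x) ^+ 2)%:E)); first exact.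
by apply/funext => x; rewrite -EFinM exprMn.
Qed.

Lemma sqintD f h : sqint f -> sqint h -> sqint (fun x => f x + h x).
Proof.
move=> sf sh; have [mf _] := sf; have [mh _] := sh.
split; first exact: measurable_funD.
apply: (@le_lt_trans _ _ (\int[mu]_(x in D) (2%:E * ((f x ^+ 2)%:E + (h x ^+ 2)%:E)))%E).
  apply: ge0_le_integral => //=.
  - by move=> x _; rewrite lee_fin sqr_ge0.
  - by apply/measurable_EFinP; apply: measurable_funX; exact: measurable_funD.
  - by apply/measurable_EFinP; apply: measurable_funM => //;
      apply: measurable_funD; exact: measurable_funX.
  - move=> x _; rewrite -EFinD -EFinM lee_fin.
    by have := sqr_ge0 (f x - h x); nra.
apply: integrable_lty => //; apply: integrableZl => //.
by apply: integrableD => //; exact: sqint_integrable_sq.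
Qed.

Lemma sqintN f : sqint f -> sqint (fun x => - f x).
Proof. by move=> /(sqintZ (-1)); under eq_fun do rewrite mulN1r. Qed.

Lemma sqintB f h : sqint f -> sqint h -> sqint (fun x => f x - h x).
Proof. by move=> sf /sqintN; exact: sqintD. Qed.

Lemma sqint_sum (I : Type) (r : seq I) (F : I -> T -> R) :
  (forall i, sqint (F i)) -> sqint (fun x => \sum_(i <- r) F i x).
Proof.
move=> sF; elim: r => [|i r IH].
  by under eq_fun do rewrite big_nil; exact: sqint0.
by under eq_fun do rewrite big_cons; exact: sqintD.
Qed.

Lemma ae_eq_sqint f h : measurable_fun D h ->
  {ae mu, forall x, D x -> f x = h x} -> sqint f -> sqint h.
Proof.
move=> mh fh [mf foo]; split=> //; rewrite (le_lt_trans _ foo)//.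
apply: ae_ge0_le_integral => //.
- by move=> x _; rewrite lee_fin sqr_ge0.
- by apply/measurable_EFinP; exact: measurable_funX.
- by move=> x _; rewrite lee_fin sqr_ge0.
- by apply/measurable_EFinP; exact: measurable_funX.
- by apply: filterS fh => x /[apply] ->.
Qed.

Lemma dotC f h : dot f h = dot h f.
Proof. by apply: eq_Rintegral => x _; rewrite mulrC. Qed.

Lemma dotDl f h k : sqint f -> sqint h -> sqint k ->
  dot (fun x => f x + h x) k = dot f k + dot h k.
Proof.
move=> sf sh sk; rewrite -RintegralD//; try exact: sqint_integrableM.
by apply: eq_Rintegral => x _; rewrite mulrDl.
Qed.

Lemma dotZl c f k : sqint f -> sqint k -> dot (fun x => c * f x) k = c * dot f k.
Proof.
move=> sf sk; rewrite -RintegralZl//; last exact: sqint_integrableM.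
by apply: eq_Rintegral => x _; rewrite mulrA.
Qed.

Lemma dotDr f h k : sqint f -> sqint h -> sqint k ->
  dot k (fun x => f x + h x) = dot k f + dot k h.
Proof. by move=> sf sh sk; rewrite !(dotC k) dotDl. Qed.

Lemma dotZr c f k : sqint f -> sqint k -> dot k (fun x => c * f x) = c * dot k f.
Proof. by move=> sf sk; rewrite !(dotC k) dotZl. Qed.

Lemma dotNl f k : sqint f -> sqint k -> dot (fun x => - f x) k = - dot f k.
Proof.
by move=> sf sk; rewrite -mulN1r -dotZl//; apply: eq_Rintegral => x _; rewrite mulN1r.
Qed.

Lemma dotBl f h k : sqint f -> sqint h -> sqint k ->
  dot (fun x => f x - h x) k = dot f k - dot h k.
Proof. by move=> sf sh sk; rewrite dotDl ?dotNl//; exact: sqintN. Qed.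

Lemma dotBr f h k : sqint f -> sqint h -> sqint k ->
  dot k (fun x => f x - h x) = dot k f - dot k h.
Proof. by move=> sf sh sk; rewrite !(dotC k) dotBl. Qed.

Lemma dot_ge0 f : 0 <= dot f f.
Proof. by apply: Rintegral_ge0 => x _; rewrite -expr2 sqr_ge0. Qed.

Lemma dot_sqr f : sqint f ->
  (dot f f)%:E = (\int[mu]_(x in D) (f x ^+ 2)%:E)%E.
Proof.
move=> sf; rewrite /dot /Rintegral fineK.
  by apply: eq_integral => x _; rewrite expr2.
by apply: integrable_fin_num => //; exact: sqint_integrableM.
Qed.

Lemma ae_eq_dot f f' h h' : sqint f -> sqint f' -> sqint h -> sqint h' ->
  {ae mu, forall x, D x -> f x = f' x} -> {ae mu, forall x, D x -> h x = h' x} ->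
  dot f h = dot f' h'.
Proof.
move=> sf sf' sh sh' ff' hh'; congr fine; apply: ae_eq_integral => //.
- by apply/measurable_EFinP; apply: measurable_funM; [case: sf|case: sh].
- by apply/measurable_EFinP; apply: measurable_funM; [case: sf'|case: sh'].
- by move: ff' hh'; apply: filterS2 => x ff' hh' Dx; rewrite ff'// hh'.
Qed.

Lemma dot_eq0 f : sqint f -> dot f f = 0 -> {ae mu, forall x, D x -> f x = 0}.
Proof.
move=> sf f0; have [mf _] := sf.
have mf2 : measurable_fun D (fun x => (f x ^+ 2)%:E).
  by apply/measurable_EFinP; exact: measurable_funX.
have : (\int[mu]_(x in D) `|(f x ^+ 2)%:E| = 0)%E.
  under eq_integral do rewrite gee0_abs ?lee_fin ?sqr_ge0//.
  by rewrite -dot_sqr// f0.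
move=> /(ae_eq_integral_abs _ mD mf2); apply: filterS => x /[apply]/eqP.
by rewrite /cst eqe sqrf_eq0 => /eqP.
Qed.

Lemma dotDD f h : sqint f -> sqint h ->
  dot (fun x => f x + h x) (fun x => f x + h x) = dot f f + 2 * dot f h + dot h h.
Proof.
move=> sf sh; have s := sqintD sf sh.
by rewrite dotDl// !dotDr// (dotC h f); lra.
Qed.

Lemma dotBB f h : sqint f -> sqint h ->
  dot (fun x => f x - h x) (fun x => f x - h x) = dot f f - 2 * dot f h + dot h h.
Proof.
move=> sf sh; have s := sqintB sf sh.
by rewrite dotBl// !dotBr// (dotC h f); lra.
Qed.

Lemma dotDD_le f h : sqint f -> sqint h ->
  dot (fun x => f x + h x) (fun x => f x + h x) <= 2 * (dot f f + dot h h).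
Proof.
move=> sf sh; have := dot_ge0 (fun x => f x - h x).
by rewrite dotBB// dotDD//; lra.
Qed.

Lemma cauchy_schwarz f h : sqint f -> sqint h ->
  dot f h ^+ 2 <= dot f f * dot h h.
Proof.
move=> sf sh; have hh := dot_ge0 h.
have key t : 0 <= dot f f - 2 * t * dot f h + t ^+ 2 * dot h h.
  have := dot_ge0 (fun x => f x - t * h x).
  by have st := sqintZ t sh; rewrite dotBB// dotZr// dotZl// dotZr//; lra.
move: hh; rewrite le_eqVlt => /predU1P[h0|h0]; last first.
  (* This [t] minimizes the quadratic of [key]. *)
  have := key (dot f h / dot h h).
  have : dot f h = dot f h / dot h h * dot h h by field; rewrite gt_eqF.
  move: h0; set t := dot f h / dot h h; set a := dot f f; set b := dot h h.
  set c := dot f h; move=> b0 ->; rewrite (_ : _ + _ = a - t ^+ 2 * b); last by ring.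
  by move=> ?; rewrite exprMn (expr2 b) mulrA ler_pM2r// -subr_ge0.
have [->|fh0] := eqVneq (dot f h) 0; first by rewrite -h0 mulr0 expr0n.
(* With [dot h h = 0] the expression in [key] is affine in [t], and this [t] gives it the value
   -1. *)
have := key ((dot f f + 1) / (2 * dot f h)).
have -> : 2 * ((dot f f + 1) / (2 * dot f h)) * dot f h = dot f f + 1 by field.
by rewrite -h0; lra.
Qed.

(** Cauchy-Schwarz followed by A B <= (A + B)^2 for nonnegative A and B. The free weight [e] makes
    it possible to absorb the cross term in the proof of lower semicontinuity. *)
Lemma dot_small f h (e : R) : sqint f -> sqint h -> 0 < e ->
  `|dot f h| <= e * dot f f + e^-1 * dot h h.
Proof.
move=> sf sh e0; have e'0 : 0 < e^-1 by rewrite invr_gt0.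
have := cauchy_schwarz sf sh; have := dot_ge0 f; have := dot_ge0 h.
set a := dot f f; set b := dot h h; set c := dot f h => b0 a0 cab.
have A0 : 0 <= e * a by rewrite mulr_ge0// ltW.
have B0 : 0 <= e^-1 * b by rewrite mulr_ge0// ltW.
rewrite -ler_sqr ?nnegrE ?addr_ge0// real_normK ?num_real//.
apply: (le_trans cab); have -> : a * b = (e * a) * (e^-1 * b).
  by field; rewrite gt_eqF.
by move: A0 B0; move: (e * a) (e^-1 * b) => A B ? ?; nra.
Qed.

End SquareIntegrable.

(** * Completeness of L^2 along sequences with geometrically small increments *)

Section RieszFischer.
Context d (T : measurableType d) (R : realType) (mu : {measure set T -> \bar R}).
Variables (D : set T) (mD : measurable D).

(** The induction step of Cauchy-Schwarz for finite sums: (2 a b)^2 <= 4 (A v) (u B) <= (A v + u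
    B)^2. *)
Lemma sqrD_le_mul (a b A B u v : R) : 0 <= A -> 0 <= B -> 0 <= u -> 0 <= v ->
  a ^+ 2 <= A * B -> b ^+ 2 <= u * v -> (a + b) ^+ 2 <= (A + u) * (B + v).
Proof.
move=> A0 B0 u0 v0 aAB buv.
suff H : 2 * a * b <= A * v + u * B.
  have -> : (a + b) ^+ 2 = a ^+ 2 + 2 * a * b + b ^+ 2 by ring.
  have -> : (A + u) * (B + v) = A * B + (A * v + u * B) + u * v by ring.
  by rewrite !lerD.
have p0 : 0 <= A * v by rewrite mulr_ge0.
have q0 : 0 <= u * B by rewrite mulr_ge0.
apply: le_trans (ler_norm _) _.
rewrite -ler_sqr ?nnegrE ?addr_ge0// real_normK ?num_real//.
have : a ^+ 2 * b ^+ 2 <= (A * B) * (u * v) by rewrite ler_pM ?sqr_ge0.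
have -> : (A * B) * (u * v) = (A * v) * (u * B) by ring.
have -> : (2 * a * b) ^+ 2 = 4 * (a ^+ 2 * b ^+ 2) by ring.
move: p0 q0; move: (A * v) (u * B) (a ^+ 2 * b ^+ 2) => p q w p0 q0 wpq.
by have := sqr_ge0 (p - q); nra.
Qed.

Variables (f : nat -> T -> R) (c : R).
Hypothesis sf : forall n, sqint mu D (f n).
Let incr n x := f n.+1 x - f n x.
Hypothesis f_cauchy : forall n, dot mu D (incr n) (incr n) <= c * 4^-1 ^+ n.

(* By Cauchy-Schwarz the squared sum of the increments is at most 2 * wsum, whose
   integral is bounded: this avoids Minkowski's inequality. *)
Let wsum n x : R := \sum_(0 <= k < n) 2 ^+ k * incr k x ^+ 2.
Let g x : \bar R := (\sum_(0 <= k <oo) (2 ^+ k * incr k x ^+ 2)%:E)%E.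

Let s_incr n : sqint mu D (incr n). Proof. exact: sqintB. Qed.

Let c_ge0 : 0 <= c.
Proof. by have := f_cauchy 0%N; rewrite expr0 mulr1; apply: le_trans; exact: dot_ge0. Qed.

Lemma geometric_half n : \sum_(0 <= k < n) 2^-1 ^+ k = 2 - 2 * 2^-1 ^+ n :> R.
Proof.
elim: n => [|n IH]; first by rewrite big_nil expr0 mulr1 subrr.
by rewrite big_nat_recr//= IH exprS; lra.
Qed.

Lemma geometric_half_le n : \sum_(0 <= k < n) 2^-1 ^+ k <= 2 :> R.
Proof. by rewrite geometric_half gerBl mulr_ge0// exprn_ge0. Qed.

Let m_incr k : measurable_fun D (fun x => (2 ^+ k * incr k x ^+ 2)%:E).
Proof.
have [m _] := s_incr k; apply/measurable_EFinP; apply: measurable_funM => //.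
exact: measurable_funX.
Qed.

Let incr_ge0 k x : D x -> (0 <= (2 ^+ k * incr k x ^+ 2)%:E)%E.
Proof. by move=> _; rewrite lee_fin mulr_ge0 ?sqr_ge0// exprn_ge0. Qed.

(** The rate 4^-k is chosen for this: after multiplication by the weight 2^k there remains c 2^-k,
    which is summable. *)
Let int_g : (\int[mu]_(x in D) g x <= (2 * c)%:E)%E.
Proof.
rewrite integral_nneseries//.
apply: lime_le; first by apply: is_cvg_nneseries => n _ _; apply: integral_ge0; exact: incr_ge0.
apply: nearW => n.
apply: (@le_trans _ _ (\sum_(0 <= k < n) (c * 2^-1 ^+ k)%:E)%E).
  apply: lee_sum => k _.
  under eq_integral do rewrite EFinM.
  rewrite ge0_integralZl//; last 2 first.
  - by apply/measurable_EFinP; have [m _] := s_incr k; exact: measurable_funX.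
  - by move=> x _; rewrite lee_fin sqr_ge0.
  rewrite -dot_sqr// -EFinM lee_fin.
  apply: (@le_trans _ _ (2 ^+ k * (c * 4^-1 ^+ k))).
    by rewrite ler_wpM2l// exprn_ge0.
  rewrite mulrCA -exprMn (_ : 2 * 4^-1 = 2^-1 :> R)//; lra.
rewrite sumEFin lee_fin -mulr_sumr mulrC ler_wpM2r//.
exact: geometric_half_le.
Qed.

Let m_g : measurable_fun D g.
Proof.
rewrite /g; apply: ge0_emeasurable_sum => //.
by move=> k x Dx _; exact: incr_ge0.
Qed.

Let g_ge0 x : D x -> (0 <= g x)%E.
Proof. by move=> Dx; apply: nneseries_ge0 => k _ _; exact: incr_ge0. Qed.

Let ae_g : {ae mu, forall x, D x -> (g x < +oo)%E}.
Proof.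
have ig : mu.-integrable D g.
  apply/integrableP; split => //.
  under eq_integral => x xD do rewrite gee0_abs ?(g_ge0 (set_mem xD))//.
  by apply: (le_lt_trans int_g); rewrite ltry.
have := integrable_ae mD ig.
by apply: filterS => x /[apply]; rewrite fin_numElt => /andP[].
Qed.

Let wsum_le x n : D x -> (g x < +oo)%E -> wsum n x <= fine (g x).
Proof.
move=> Dx gx; rewrite -lee_fin fineK; last by rewrite ge0_fin_numE// g_ge0.
rewrite /wsum -sumEFin; apply: nneseries_lim_ge => *.
exact: incr_ge0.
Qed.

Let wsum_ge0 n x : 0 <= wsum n x.
Proof. by apply: sumr_ge0 => k _; rewrite mulr_ge0 ?sqr_ge0// exprn_ge0. Qed.

Let wsum_nd x n p : 0 <= wsum (n + p) x - wsum n x.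
Proof.
elim: p => [|p IH]; first by rewrite addn0 subrr.
rewrite addnS (_ : wsum (n + p).+1 x = wsum (n + p) x + 2 ^+ (n + p) * incr (n + p)%N x ^+ 2).
  by rewrite addrAC addr_ge0// mulr_ge0 ?sqr_ge0// exprn_ge0.
by rewrite /wsum big_nat_recr.
Qed.

(** Cauchy-Schwarz on the increments, written as products of 2^(-k/2) and 2^(k/2) times the
    increment; the first factor of the bound is the sum of 2^-k over n <= k < n + p. *)
Let incr_wsum x n p :
  (f (n + p)%N x - f n x) ^+ 2 <=
  (2 * (2^-1 ^+ n - 2^-1 ^+ (n + p))) * (wsum (n + p) x - wsum n x).
Proof.
elim: p => [|p IH]; first by rewrite addn0 !subrr mulr0 expr0n.
have -> : f (n + p.+1)%N x - f n x = (f (n + p)%N x - f n x) + incr (n + p)%N x.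
  by rewrite addnS /incr; lra.
have -> : 2 * (2^-1 ^+ n - 2^-1 ^+ (n + p.+1)) =
    2 * (2^-1 ^+ n - 2^-1 ^+ (n + p)) + 2^-1 ^+ (n + p) :> R.
  by rewrite addnS exprS; lra.
have -> : wsum (n + p.+1) x - wsum n x =
    (wsum (n + p) x - wsum n x) + 2 ^+ (n + p) * incr (n + p)%N x ^+ 2.
  by rewrite addnS /wsum big_nat_recr//=; lra.
apply: sqrD_le_mul => //.
- rewrite mulr_ge0// subr_ge0 exprD ler_piMr ?exprn_ge0//.
  by rewrite exprn_ile1//; lra.
- by rewrite mulr_ge0 ?sqr_ge0// exprn_ge0.
- by rewrite mulrA -exprMn mulVf// expr1n mul1r.
Qed.

Let incr_bound x n p : D x -> (g x < +oo)%E ->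
  (f (n + p)%N x - f n x) ^+ 2 <= 2 * 2^-1 ^+ n * fine (g x).
Proof.
move=> Dx gx; apply: (le_trans (incr_wsum x n p)).
have w := wsum_le (n + p) Dx gx; have w0 := wsum_ge0 n x.
have ww := wsum_nd x n p.
have e0 : 0 <= 2^-1 ^+ (n + p) :> R by rewrite exprn_ge0.
apply: ler_pM => //; last lra.
- rewrite mulr_ge0// subr_ge0 exprD ler_piMr ?exprn_ge0//.
  by rewrite exprn_ile1//; lra.
- by rewrite ler_pM2l// gerBl.
Qed.

Let f_series x n : f n x = f 0%N x + [series incr k x]_k n.
Proof.
elim: n => [|n IH]; first by rewrite /series/= big_nil addr0.
by move: IH; rewrite /series/= big_nat_recr//= => IH; rewrite addrA -IH /incr; lra.
Qed.

Lemma riesz_fischer_ae : {ae mu, forall x, D x -> cvgn (fun n => f n x)}.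
Proof.
apply: filterS ae_g => x gx Dx; have {}gx := gx Dx.
suff : cvgn [series incr k x]_k.
  move=> cv; under eq_fun do rewrite f_series.
  by apply: is_cvgD => //; exact: is_cvg_cst.
apply: normed_cvg; apply: nondecreasing_is_cvgn.
  by apply: nondecreasing_series => k _ _; exact: normr_ge0.
(* From 2 |z| <= 2^-k + 2^k z^2 for each increment z; the two sums are at most 2 and [g x]. *)
exists ((2 + fine (g x)) / 2) => _ [n _ <-].
rewrite /series/=; apply: (@le_trans _ _ ((\sum_(0 <= k < n) 2^-1 ^+ k + wsum n x) / 2)).
  rewrite /wsum -big_split/= mulr_suml; apply: ler_sum => k _.
  have i0 : 0 < 2 ^+ k :> R by rewrite exprn_gt0.
  rewrite exprVn; move: (2 ^+ k) i0 => u u0.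
  rewrite -(real_normK (num_real (incr k x))); set z := `|_|.
  have := sqr_ge0 (u * z - 1); have v0 : 0 < u^-1 by rewrite invr_gt0.
  rewrite -(@pmulr_rge0 _ u^-1)// sqrrB expr1n mulr1 exprMn.
  have -> : u^-1 * (u ^+ 2 * z ^+ 2 - u * z *+ 2 + 1) = u * z ^+ 2 - 2 * z + u^-1.
    by field; rewrite gt_eqF.
  lra.
rewrite ler_wpM2r// lerD//; first exact: geometric_half_le.
exact: wsum_le.
Qed.

Section limit.
Variable l : T -> R.
Hypothesis ml : measurable_fun D l.
Hypothesis fl : {ae mu, forall x, D x -> f n x @[n --> \oo] --> l x}.

Let lim_bound n : {ae mu, forall x, D x ->
  (((f n x - l x) ^+ 2)%:E <= (2 * 2^-1 ^+ n)%:E * g x)%E}.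
Proof.
move: ae_g fl; apply: filterS2 => x gx fx Dx; have {}gx := gx Dx; have {}fx := fx Dx.
rewrite -[g x]fineK ?ge0_fin_numE ?g_ge0// -EFinM lee_fin.
have cv : (f n x - f (n + p)%N x) ^+ 2 @[p --> \oo] --> (f n x - l x) ^+ 2.
  have fx' : f (n + p)%N x @[p --> \oo] --> l x.
    by apply: cvg_comp fx; exact: cvg_addnl.
  rewrite expr2; under eq_fun do rewrite expr2.
  by apply: cvgM; apply: cvgB => //; exact: cvg_cst.
apply: (@closed_cvg _ _ _ _ _ (fun y => y <= 2 * 2^-1 ^+ n * fine (g x))) cv.
  exact: closed_le.
by apply: nearW => p; rewrite -sqrrN opprB incr_bound.
Qed.

Let lim_int n :
  (\int[mu]_(x in D) ((f n x - l x) ^+ 2)%:E <= (4 * c * 2^-1 ^+ n)%:E)%E.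
Proof.
apply: (@le_trans _ _ (\int[mu]_(x in D) ((2 * 2^-1 ^+ n)%:E * g x))%E).
  apply: ae_ge0_le_integral => //.
  - by move=> x _; rewrite lee_fin sqr_ge0.
  - apply/measurable_EFinP; apply: measurable_funX; apply: measurable_funB => //.
    by case: (sf n).
  - by move=> x Dx; rewrite mule_ge0 ?g_ge0// lee_fin mulr_ge0// exprn_ge0.
  - exact: measurable_funeM.
rewrite ge0_integralZl//.
apply: (@le_trans _ _ ((2 * 2^-1 ^+ n)%:E * (2 * c)%:E)%E).
  by rewrite lee_wpmul2l// lee_fin mulr_ge0// exprn_ge0.
by rewrite -EFinM lee_fin le_eqVlt; apply/orP; left; apply/eqP; ring.
Qed.

Let s_diff n : sqint mu D (fun x => f n x - l x).
Proof.
split; last by rewrite (le_lt_trans (lim_int n))// ltry.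
by apply: measurable_funB => //; case: (sf n).
Qed.

Lemma riesz_fischer_sqint : sqint mu D l.
Proof.
have := sqintB mD (sf 0) (s_diff 0).
by under eq_fun do rewrite opprB addrC subrK.
Qed.

Lemma riesz_fischer_dot n :
  dot mu D (fun x => f n x - l x) (fun x => f n x - l x) <= 4 * c * 2^-1 ^+ n.
Proof. by rewrite -lee_fin dot_sqr//. Qed.

End limit.
End RieszFischer.

(** * Translations of space *)

Section MeasurePreserving.
Context d (T : measurableType d) (R : realType) (mu : {measure set T -> \bar R}).
Variables (phi : T -> T) (mphi : measurable_fun setT phi).
Hypothesis mu_phi : forall A, measurable A -> mu (phi @^-1` A) = mu A.

Lemma ge0_integral_preserving D (f : T -> \bar R) : measurable D ->
  measurable_fun D f -> (forall x, D x -> 0 <= f x)%E ->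
  (\int[mu]_(x in phi @^-1` D) f (phi x) = \int[mu]_(x in D) f x)%E.
Proof.
move=> mD mf f0; rewrite -(@ge0_integral_pushforward _ _ _ _ _ phi)//.
  by apply: eq_measure_integral => A mA _; rewrite -[RHS]mu_phi.
by move=> x /[!inE]; exact: f0.
Qed.

Lemma integral_preserving D (f : T -> \bar R) : measurable D ->
  measurable_fun D f ->
  (\int[mu]_(x in phi @^-1` D) f (phi x) = \int[mu]_(x in D) f x)%E.
Proof.
move=> mD mf; rewrite [LHS]integralE [RHS]integralE.
congr (_ - _)%E.
- have <- := @ge0_integral_preserving D f^\+%E mD (measurable_funepos mf)
    (fun x _ => funepos_ge0 f x).
  by apply: eq_integral => x _; rewrite !funeposE.
- have <- := @ge0_integral_preserving D f^\-%E mD (measurable_funeneg mf)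
    (fun x _ => funeneg_ge0 f x).
  by apply: eq_integral => x _; rewrite !funenegE.
Qed.

Lemma ae_preserving (P : T -> Prop) :
  {ae mu, forall x, P x} -> {ae mu, forall x, P (phi x)}.
Proof.
move=> [N [mN N0 PN]]; exists (phi @^-1` N); split.
- by rewrite -[X in measurable X]setTI; exact: mphi.
- by rewrite mu_phi.
- by move=> x /= Px; exact: PN.
Qed.
End MeasurePreserving.

Section Translation.
Context {R : realType}.

Lemma measurable_addr (c : R) :
  measurable_fun setT ((fun x : R => x + c) : measurableTypeR R -> measurableTypeR R).
Proof. exact: measurable_funD. Qed.

(** The image of Lebesgue measure under a translation agrees with it on half-open intervals, and
    uniqueness concludes. *)
Lemma lebesgue_measure_addr (c : R) (A : set (measurableTypeR R)) :
  measurable A -> lebesgue_measure ((fun x : R => x + c) @^-1` A) = lebesgue_measure A.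
Proof.
move=> mA; symmetry.
pose phi : measurableTypeR R -> measurableTypeR R := fun x : R => x + c.
pose mphi := isMeasurableFun.Build _ _ _ _ _ (measurable_addr c).
pose mphi_pack : {mfun _ >-> _} := HB.pack phi mphi.
change (lebesgue_measure A = pushforward lebesgue_measure mphi_pack A).
apply: lebesgue_measure_unique => //.
move=> _ [[a b] _ <-] /=; rewrite /pushforward.
have -> : mphi_pack @^-1` `]a, b]%classic = `]a - c, b - c]%classic.
  by apply/seteqP; split => x /=; rewrite !in_itv/= /phi ltrBlDr lerBrDr.
by rewrite !lebesgue_measure_itv/= !lte_fin ltrD2r -!EFinB opprB addrA subrK.
Qed.

Lemma sigma_finite_product d1 d2 (T1 : measurableType d1) (T2 : measurableType d2)
    (m1 : {measure set T1 -> \bar R}) (m2 : {sigma_finite_measure set T2 -> \bar R}) :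
  sigma_finite setT m1 -> sigma_finite setT (m1 \x m2)%E.
Proof.
move=> /sigma_finiteP[F [TF ndF Foo]].
have /sigma_finiteP[G [TG ndG Goo]] := sigma_finiteT m2.
exists (fun n => F n `*` G n) => [|n].
  apply/esym; rewrite -subTset => -[x y] _; have [n _ Fx] : (\bigcup_n F n) x by rewrite -TF.
  have [k _ Gy] : (\bigcup_n G n) y by rewrite -TG.
  exists (maxn n k) => //; split=> /=.
  - by move: Fx; apply/subsetPset/ndF/leq_maxl.
  - by move: Gy; apply/subsetPset/ndG/leq_maxr.
have [mF Fn] := Foo n; have [mG Gn] := Goo n; split; first exact: measurableX.
by rewrite product_measure1E// lte_mul_pinfty// ge0_fin_numE.
Qed.

(** Named so that a sigma-finite structure can be attached to it and [leb3] treated as a product of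
    two sigma-finite measures. *)
Definition leb2 : set (measurableTypeR R * measurableTypeR R) -> \bar R :=
  (lebesgue_measure \x lebesgue_measure)%E.

HB.instance Definition _ := Measure.on leb2.

Lemma sigma_finite_leb2 : sigma_finite setT leb2.
Proof. by apply: sigma_finite_product; exact: sigma_finiteT. Qed.

HB.instance Definition _ := Measure_isSigmaFinite.Build _ _ _ leb2 sigma_finite_leb2.

Section prod.
Context d1 d2 (T1 : measurableType d1) (T2 : measurableType d2).
Variables (m1 : {sigma_finite_measure set T1 -> \bar R}).
Variables (m2 : {sigma_finite_measure set T2 -> \bar R}).
Variables (f1 : T1 -> T1) (mf1 : measurable_fun setT f1).
Variables (f2 : T2 -> T2) (mf2 : measurable_fun setT f2).
Hypothesis m1f1 : forall A, measurable A -> m1 (f1 @^-1` A) = m1 A.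
Hypothesis m2f2 : forall A, measurable A -> m2 (f2 @^-1` A) = m2 A.

Let f12 (x : T1 * T2) := (f1 x.1, f2 x.2).

Lemma measurable_prod_map : measurable_fun setT f12.
Proof.
by apply: measurable_fun_pair => /=; exact: measurableT_comp.
Qed.

(** On rectangles the invariance is that of the factors; uniqueness of the product measure extends
    it. *)
Lemma product_measure_preserving (A : set (T1 * T2)) : measurable A ->
  (m1 \x m2)%E (f12 @^-1` A) = (m1 \x m2)%E A.
Proof.
move=> mA; symmetry.
pose mphi := isMeasurableFun.Build _ _ _ _ _ measurable_prod_map.
pose phi : {mfun _ >-> _} := HB.pack f12 mphi.
change ((m1 \x m2)%E A = pushforward (m1 \x m2)%E phi A).
apply: product_measure_unique => //.
move=> B C mB mC.
transitivity ((m1 \x m2)%E ((f1 @^-1` B) `*` (f2 @^-1` C))) => //.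
have mB1 : measurable (f1 @^-1` B) by rewrite -[X in measurable X]setTI; exact: mf1.
have mC2 : measurable (f2 @^-1` C) by rewrite -[X in measurable X]setTI; exact: mf2.
by rewrite product_measure1E//; congr (_ * _)%E; [exact: m1f1|exact: m2f2].
Qed.
End prod.
End Translation.

(* [R3 R] with its product sigma-algebra. *)
Notation E R := (measurableTypeR R * measurableTypeR R * measurableTypeR R)%type.

Section Space3.
Context {R : realType}.
Implicit Types (h x : R3 R) (A : set (E R)).

Lemma measurable_translate h : measurable_fun setT ((fun x : R3 R => x + h) : E R -> E R).
Proof.
apply: (@measurable_prod_map _ _ _ _
  (fun x : R * R => x + h.1) _
  (fun x : R => x + h.2)); last exact: measurable_addr.
by apply: (@measurable_prod_map _ _ _ _
  (fun x : R => x + h.1.1) _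
  (fun x : R => x + h.1.2)); exact: measurable_addr.
Qed.

Lemma leb3_translate h A : measurable A -> leb3 ((fun x : R3 R => x + h) @^-1` A) = leb3 A.
Proof.
have m1 := measurable_addr h.1.1; have m2 := measurable_addr h.1.2.
have m3 := measurable_addr h.2.
move=> mA.
have H2 B (mB : measurable B) := @product_measure_preserving _ _ _ _ _
  lebesgue_measure lebesgue_measure _ m1 _ m2
  (lebesgue_measure_addr h.1.1) (lebesgue_measure_addr h.1.2) B mB.
exact: (@product_measure_preserving _ _ _ _ _ leb2 lebesgue_measure _
  (measurable_prod_map m1 m2) _ m3 H2 (lebesgue_measure_addr h.2) A mA).
Qed.

Lemma sigma_finite_leb3 : sigma_finite setT (@leb3 R).
Proof. by apply: sigma_finite_product; exact: sigma_finite_leb2. Qed.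

(* The library's sigma-finite instance for products does not apply to [leb3],
   which is introduced as a bare measure. *)
Definition leb3_sf : set (E R) -> \bar R := leb3.

HB.instance Definition _ := Measure.copy leb3_sf leb3.
HB.instance Definition _ := Measure_isSigmaFinite.Build _ _ _ leb3_sf sigma_finite_leb3.

End Space3.

(** * Borel sets and cubes in space *)

Section Borel.
Context {R : realType}.
Implicit Types (x y : R3 R) (K A : set (R3 R)).

Lemma measurable_x1 : measurable_fun (setT : set (E R)) (fun x : E R => x.1.1 : R).
Proof. exact: (measurableT_comp measurable_fst measurable_fst). Qed.
Lemma measurable_x2 : measurable_fun (setT : set (E R)) (fun x : E R => x.1.2 : R).
Proof. exact: (measurableT_comp measurable_snd measurable_fst). Qed.
Lemma measurable_x3 : measurable_fun (setT : set (E R)) (fun x : E R => x.2 : R).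
Proof. exact: measurable_snd. Qed.

Lemma ball3E x (e : R) y : ball x e y <->
  [/\ `|x.1.1 - y.1.1| < e, `|x.1.2 - y.1.2| < e & `|x.2 - y.2| < e].
Proof.
rewrite /ball/= /prod_ball/= /ball/= /prod_ball/=.
by split=> [[[? ?] ?]|[? ? ?]].
Qed.

Lemma rat_near (z e : R) : 0 < e -> exists q : rat, `|ratr q - z| < e.
Proof.
move=> e0; have /rat_in_itvoo[q] : z - e < z + e by lra.
by rewrite in_itv/= => /andP[q1 q2]; exists q; rewrite ltr_norml; apply/andP; split; lra.
Qed.

Lemma measurable_abs_lt (f : E R -> R) (c e : R) : measurable_fun (setT : set (E R)) f ->
  measurable [set x : E R | `|f x - c| < e].
Proof.
move=> mf; have : measurable_fun (setT : set (E R)) (fun x => `|f x - c|).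
  by apply: measurableT_comp => //; apply: measurable_funB.
move=> /(_ measurableT `]-oo, e[%classic (measurable_itv _)); rewrite setTI.
by congr measurable; apply/seteqP; split => x /=; rewrite in_itv.
Qed.

(** Space carries the product sigma-algebra, so an open set has to be exhibited as a countable union
    of boxes: balls of the product norm with rational centres and radii 1/(n+1). *)
Lemma open_measurable3 (A : set (R3 R)) : open A -> measurable (A : set (E R)).
Proof.
rewrite openE => oA.
pose c (q : rat * rat * rat) : R3 R := (ratr q.1.1, ratr q.1.2, ratr q.2).
pose B q n : set (E R) := ball (c q) n.+1%:R^-1.
have mB q n : measurable (B q n).
  have -> : B q n = [set x : E R | `|x.1.1 - (c q).1.1| < n.+1%:R^-1] `&`
     ([set x : E R | `|x.1.2 - (c q).1.2| < n.+1%:R^-1] `&`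
      [set x : E R | `|x.2 - (c q).2| < n.+1%:R^-1]).
    apply/seteqP; split => x /=.
      by move=> /ball3E[]; rewrite !(distrC _ (c q).2) !(distrC _ (c q).1.1) !(distrC _ (c q).1.2).
    move=> [H1 [H2 H3]]; apply/ball3E.
    by rewrite !(distrC (c q).2) !(distrC (c q).1.1) !(distrC (c q).1.2).
  apply: measurableI; first exact: (measurable_abs_lt _ _ measurable_x1).
  apply: measurableI; first exact: (measurable_abs_lt _ _ measurable_x2).
  exact: (measurable_abs_lt _ _ measurable_x3).
have -> : A = \bigcup_q1 \bigcup_q2 \bigcup_q3
    \bigcup_(n in [set n | B (q1, q2, q3) n `<=` A]) B (q1, q2, q3) n.
  apply/seteqP; split; last by move=> x [q1 _ [q2 _ [q3 _ [n /= + Bx]]]]; apply.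
  move=> x /oA; rewrite /interior/= => /nbhs_ballP[e /= e0 xA].
  (* The rational centre lies within one radius of [x] and the points of its ball within another,
     hence the factor 2. *)
  have [n ne] : exists n, 2 * n.+1%:R^-1 < e.
    have /ltr_add_invr[n] : 0 < e / 2 by rewrite divr_gt0.
    by rewrite add0r => ne; exists n; rewrite mulrC -ltr_pdivlMr.
  have n0 : 0 < n.+1%:R^-1 :> R by [].
  have [q1 q1x] := rat_near x.1.1 n0; have [q2 q2x] := rat_near x.1.2 n0.
  have [q3 q3x] := rat_near x.2 n0.
  exists q1 => //; exists q2 => //; exists q3 => //; exists n; last exact/ball3E.
  move=> y /= By; apply: xA; apply: (@le_ball _ _ _ (n.+1%:R^-1 + n.+1%:R^-1)).
    by rewrite -mulr2n -[_ *+ 2]mulr_natl; exact: ltW.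
  by apply: ball_triangle By; apply: ball_sym; apply/ball3E.
apply: bigcupT_measurable_rat => q1; apply: bigcupT_measurable_rat => q2.
apply: bigcupT_measurable_rat => q3; exact: bigcup_measurable.
Qed.

Lemma closed_measurable3 (A : set (R3 R)) : closed A -> measurable (A : set (E R)).
Proof. by move=> /closed_openC/open_measurable3/measurableC; rewrite setCK. Qed.

Lemma hausdorff3 : hausdorff_space (R3 R).
Proof. exact: norm_hausdorff. Qed.

Lemma compact_measurable3 K : compact K -> measurable (K : set (E R)).
Proof. by move=> /(compact_closed hausdorff3); exact: closed_measurable3. Qed.

Lemma continuous_measurable3 (f : R3 R -> R) : continuous f ->
  measurable_fun (setT : set (E R)) (f : E R -> R).
Proof.
move=> cf; apply: (measurability _ (RGenOpens.measurableE R)).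
move=> _ [_ [a [b ->] <-]]; rewrite setTI; apply: open_measurable3.
by move/continuousP: cf; apply; exact: interval_open.
Qed.

(** Closed balls of the product norm. They are compact and every compact set lies in one of them, so
    local integrability is tested on cubes alone. *)
Definition cube (r : R) : set (E R) :=
  (`[- r, r]%classic `*` `[- r, r]%classic) `*` `[- r, r]%classic.

Lemma cubeE r x : cube r x <-> [/\ `|x.1.1| <= r, `|x.1.2| <= r & `|x.2| <= r].
Proof.
rewrite /cube /= !in_itv/= -!ler_norml.
by split=> [[[? ?] ?]|[? ? ?]].
Qed.

Lemma measurable_cube r : measurable (cube r).
Proof. by apply: measurableX => //; exact: measurableX. Qed.

Lemma leb3_box (A B C : set (measurableTypeR R)) :
  measurable A -> measurable B -> measurable C ->
  leb3 ((A `*` B) `*` C) =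
  (lebesgue_measure A * lebesgue_measure B * lebesgue_measure C)%E.
Proof.
move=> mA mB mC.
apply: etrans (@product_measure1E _ _ _ _ R leb2 lebesgue_measure _ _ (measurableX mA mB) mC) _.
by congr (_ * _)%E; exact: (@product_measure1E _ _ _ _ R lebesgue_measure lebesgue_measure).
Qed.

Lemma leb3_cube_lty r : (leb3 (cube r) < +oo)%E.
Proof.
rewrite leb3_box// !lebesgue_measure_itv/=.
by case: ifPn => _; rewrite -?EFinB -?EFinM ?mul0e ltry.
Qed.

Lemma compact_cube r : compact (cube r).
Proof. by do 2 (apply: compact_setX; last exact: segment_compact); exact: segment_compact. Qed.

Lemma compact_sub_cube K : compact K -> exists r, K `<=` cube r.
Proof.
move=> /compact_bounded [M [_ /(_ (M + 1))]]; rewrite ltrDl ltr01 => /(_ isT) KM.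
exists (M + 1) => x /KM/=; rewrite !prod_normE/= !ge_max => /andP[/andP[? ?] ?].
exact/cubeE.
Qed.

Lemma sub_cube r s : r <= s -> cube r `<=` cube s.
Proof. by move=> rs x /cubeE[? ? ?]; apply/cubeE; split; apply: le_trans rs. Qed.

Lemma cubeD r s x y : cube r x -> cube s y -> cube (r + s) (x + y).
Proof.
move=> /cubeE[? ? ?] /cubeE[? ? ?]; apply/cubeE; split;
  by apply: (le_trans (ler_normD _ _)); rewrite lerD.
Qed.

Lemma cubeN r x : cube r (- x) <-> cube r x.
Proof. by rewrite !cubeE /= !normrN. Qed.

Lemma cube_bigcup : \bigcup_n cube n%:R = setT.
Proof.
apply/seteqP; split=> // x _.
pose M := `|x.1.1| + `|x.1.2| + `|x.2|.
exists (Num.trunc M).+1 => //; apply/cubeE.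
have := truncnS_gt M; rewrite /M.
have := normr_ge0 x.1.1; have := normr_ge0 x.1.2; have := normr_ge0 x.2.
by split; lra.
Qed.

End Borel.

(** * Local square integrability *)

Section L2loc.
Context {R : realType}.

Lemma Lfun2P d (T : measurableType d) (mu : {measure set T -> \bar R}) (f : T -> R) :
  f \in Lfun mu 2%:E <-> sqint mu setT f.
Proof.
split=> [fL|[mf foo]].
  split; first by have /[!inE]/andP[/[!inE]] := fL.
  by have /integrable_lty := Lfun2_integrable_sqr fL; exact.
rewrite inE; apply/andP; rewrite !inE; split=> //=.
rewrite /finite_norm unlock /Lnorm; apply: poweR_lty.
by under eq_integral do rewrite /= powR_mulrn// real_normK ?num_real//.
Qed.

Lemma L2locP (f : R3 R -> R) : L2loc f <->
  measurable_fun (setT : set (E R)) (f : E R -> R) /\ forall r, sqint leb3 (cube r) f.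
Proof.
split=> [fL|[mf sf] K cK].
  have mK r : measurable_fun (cube r) (f : E R -> R).
    have /Lfun2P[] := fL _ (@compact_cube R r).
    by move=> /(measurable_restrictT _ (measurable_cube r)).
  split.
    rewrite -cube_bigcup; apply/measurable_fun_bigcup => // n.
    exact: measurable_cube.
  move=> r; split=> //; have /Lfun2P[_] := fL _ (@compact_cube R r).
  rewrite [X in _ -> (X < _)%E]integral_mkcond; congr (_ < _)%E.
  apply: eq_integral => x _; rewrite /patch; case: ifP => //.
  by rewrite expr0n.
have [r Kr] := compact_sub_cube cK; have mKK := compact_measurable3 cK.
apply/Lfun2P; split.
  by apply/(measurable_restrictT _ mKK); exact: measurable_funTS.
have [_] := sf r; apply: le_lt_trans.
rewrite [X in (_ <= X)%E]integral_mkcond; apply: ge0_le_integral => //.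
- by move=> x _; rewrite lee_fin sqr_ge0.
- apply/measurable_EFinP; apply: measurable_funX.
  by apply/(measurable_restrictT _ mKK); exact: measurable_funTS.
- apply/(measurable_restrictT _ (measurable_cube r)); apply/measurable_EFinP.
  by apply: measurable_funX; exact: measurable_funTS.
- move=> x _; rewrite /patch; case: ifPn => [/set_mem/Kr/mem_set ->//|_].
  by rewrite expr0n/=; case: ifP => // _; rewrite lee_fin sqr_ge0.
Qed.

End L2loc.

(** * Continuity of translations *)

Section TranslationContinuity.
Context {R : realType}.
Implicit Types (x y h : R3 R) (f g : R3 R -> R) (A B : set (R3 R)).

Notation mf3 f := (measurable_fun (setT : set (E R)) (f : E R -> R)).

Definition L1cube r f : \bar R := (\int[leb3]_(x in cube r) `|f x|%:E)%E.

Definition translation_continuous f := forall r e, 0 < e ->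
  exists2 d, 0 < d & forall h, cube d h ->
    (L1cube r (fun x => f (x + h) - f x)%R <= e%:E)%E.

Lemma measurable_comp_translate f h : mf3 f -> mf3 (fun x => f (x + h)).
Proof. by move=> mf; apply: (measurableT_comp mf); exact: measurable_translate. Qed.

Lemma measurable_abs_cube r f : mf3 f ->
  measurable_fun (cube r) (fun x => `|f x|%:E).
Proof.
move=> mf; apply/measurable_EFinP; apply: measurableT_comp => //.
exact: measurable_funTS.
Qed.

Lemma L1cube_ge0 r f : (0 <= L1cube r f)%E.
Proof. by apply: integral_ge0 => x _; rewrite lee_fin. Qed.

Lemma L1cubeD r f g : mf3 f -> mf3 g ->
  (L1cube r (fun x => f x + g x)%R <= L1cube r f + L1cube r g)%E.
Proof.
move=> mf mg; rewrite /L1cube -ge0_integralD//.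
- apply: ge0_le_integral => //.
  + exact: measurable_cube.
  + by apply: measurable_abs_cube; exact: measurable_funD.
  + by apply: emeasurable_funD; exact: measurable_abs_cube.
  + by move=> x _; rewrite -EFinD lee_fin ler_normD.
- exact: measurable_cube.
- exact: measurable_abs_cube.
- exact: measurable_abs_cube.
Qed.

Lemma L1cubeZ r c f : mf3 f -> L1cube r (fun x => c * f x)%R = (`|c|%:E * L1cube r f)%E.
Proof.
move=> mf; rewrite /L1cube -ge0_integralZl//.
- by apply: eq_integral => x _; rewrite normrM EFinM.
- exact: measurable_cube.
- exact: measurable_abs_cube.
Qed.

Lemma L1cube_sub r s f : r <= s -> mf3 f -> (L1cube r f <= L1cube s f)%E.
Proof.
move=> rs mf; apply: ge0_subset_integral => //; first exact: measurable_cube.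
- exact: measurable_cube.
- exact: measurable_abs_cube.
- exact: sub_cube.
Qed.

Lemma integral_translate h D (f : R3 R -> \bar R) : measurable (D : set (E R)) ->
  measurable_fun (D : set (E R)) f ->
  (\int[leb3]_(x in (fun x : R3 R => (x + h)%R) @^-1` D) f (x + h)%R = \int[leb3]_(x in D) f x)%E.
Proof.
move=> mD mf.
apply: (@integral_preserving _ _ _ leb3 _ (measurable_translate h)) => //.
by move=> A mA; exact: leb3_translate.
Qed.

Lemma measurable_preimage_translate h A : measurable (A : set (E R)) ->
  measurable ((fun x : R3 R => x + h) @^-1` A : set (E R)).
Proof. by move=> mA; rewrite -[X in measurable X]setTI; exact: measurable_translate. Qed.

Lemma L1cube_translate r s h f : mf3 f -> cube s h ->
  (L1cube r (fun x => f (x + h)%R) <= L1cube (r + s) f)%E.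
Proof.
move=> mf sh; have mc := @measurable_cube R r.
pose D : set (E R) := (fun x : R3 R => x - h) @^-1` cube r.
have mD : measurable D by exact: measurable_preimage_translate.
have -> : L1cube r (fun x => f (x + h)) = (\int[leb3]_(x in D) `|f x|%:E)%E.
  rewrite -(integral_translate h (f := fun x => `|f x|%:E)) //.
    rewrite /L1cube; congr (integral _ _ _); apply/seteqP; split => x; rewrite /D/= addrK//.
  apply/measurable_EFinP; apply: measurableT_comp => //; exact: measurable_funTS.
apply: ge0_subset_integral => //; first exact: measurable_cube.
  exact: measurable_abs_cube.
by move=> x /cubeD /(_ sh); rewrite subrK.
Qed.

(** Three terms of size e/3. The approximation is made on a cube larger by 1 because shifts of size
    at most 1 move the original cube into that one. *)
Lemma translation_continuous_approx f : mf3 f ->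
  (forall r e, 0 < e -> exists g, [/\ mf3 g, translation_continuous g &
    (L1cube r (fun x => f x - g x)%R <= e%:E)%E]) ->
  translation_continuous f.
Proof.
move=> mf fg r e e0; have e3 : 0 < e / 3 by rewrite divr_gt0.
have [g [mg tg fge]] := fg (r + 1) _ e3.
have [d d0 dP] := tg r _ e3.
exists (Num.min d 1); first by rewrite lt_min d0/=.
move=> h hd; have hd' : cube d h by move: hd; apply: sub_cube; rewrite ge_min lexx.
have h1 : cube 1 h by move: hd; apply: sub_cube; rewrite ge_min lexx orbT.
have mfg : mf3 (fun x => f x - g x) by exact: measurable_funB.
have mgh := measurable_comp_translate h mg.
apply: (@le_trans _ _ (L1cube r (fun x => f (x + h)%R - g (x + h)%R)%R +
  (L1cube r (fun x => g (x + h) - g x)%R + L1cube r (fun x => g x - f x)%R))%E).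
  apply: le_trans (leeD2l _ (L1cubeD _ _ _)); last 2 first.
  - exact: measurable_funB.
  - exact: measurable_funB.
  apply: le_trans (L1cubeD _ _ _); last 2 first.
  - exact: (measurable_comp_translate h mfg).
  - by apply: measurable_funD; exact: measurable_funB.
  rewrite le_eqVlt; apply/orP; left; apply/eqP.
  by apply: eq_integral => x _; do 2 f_equal; lra.
have -> : e = e / 3 + (e / 3 + e / 3) by lra.
rewrite 2!EFinD; apply: leeD; last apply: leeD.
- exact: le_trans (L1cube_translate r mfg h1) fge.
- exact: dP.
- have r1 : r <= r + 1 by rewrite lerDl.
  apply: le_trans fge; apply: le_trans (L1cube_sub r1 mfg).
  rewrite le_eqVlt; apply/orP; left; apply/eqP.
  by apply: eq_integral => x _; rewrite distrC.
Qed.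

Lemma translation_continuousD f g : mf3 f -> mf3 g ->
  translation_continuous f -> translation_continuous g ->
  translation_continuous (fun x => f x + g x).
Proof.
move=> mf mg tf tg r e e0; have e2 : 0 < e / 2 by rewrite divr_gt0.
have [d d0 dP] := tf r _ e2; have [d' d'0 d'P] := tg r _ e2.
exists (Num.min d d'); first by rewrite lt_min d0.
move=> h hd; have mfh := measurable_comp_translate h mf; have mgh := measurable_comp_translate h mg.
rewrite (splitr e) EFinD.
apply: le_trans (leeD (dP h _) (d'P h _)); last 2 first.
- by move: hd; apply: sub_cube; rewrite ge_min lexx.
- by move: hd; apply: sub_cube; rewrite ge_min lexx orbT.
apply: le_trans (L1cubeD _ _ _); last 2 first.
- exact: measurable_funB.
- exact: measurable_funB.
rewrite le_eqVlt; apply/orP; left; apply/eqP.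
by apply: eq_integral => x _; do 2 f_equal; lra.
Qed.

Lemma translation_continuousZ c f : mf3 f -> translation_continuous f ->
  translation_continuous (fun x => c * f x).
Proof.
move=> mf tf r e e0; have ec : 0 < e / (`|c| + 1) by rewrite divr_gt0// ltr_wpDl.
have [d d0 dP] := tf r _ ec; exists d => // h /dP hP.
under [X in L1cube _ X]eq_fun do rewrite -mulrBr.
rewrite L1cubeZ; last first.
  by apply: measurable_funB => //; exact: measurable_comp_translate.
apply: le_trans (lee_wpmul2l _ hP) _; first by rewrite lee_fin.
rewrite -EFinM lee_fin mulrCA ler_piMr//; first exact: ltW.
by rewrite ler_pdivrMr ?mul1r ?lerDl// ltr_wpDl.
Qed.

Lemma translation_continuous_sum (I : Type) (s : seq I) (F : I -> R3 R -> R) :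
  (forall i, mf3 (F i)) -> (forall i, translation_continuous (F i)) ->
  translation_continuous (fun x => \sum_(i <- s) F i x).
Proof.
move=> mF tF; elim: s => [|i s IH].
  under eq_fun do rewrite big_nil; move=> r e e0; exists 1 => // h _.
  rewrite /L1cube; under eq_integral do rewrite subrr normr0.
  by rewrite integral0 lee_fin ltW.
under eq_fun do rewrite big_cons.
by apply: translation_continuousD => //; exact: measurable_sum.
Qed.

End TranslationContinuity.

(** * Continuity of translations for indicator functions *)

Section TranslationContinuity.
Context {R : realType}.
Implicit Types (x y h : R3 R) (f g : R3 R -> R) (A B : set (R3 R)).

Notation mf3 f := (measurable_fun (setT : set (E R)) (f : E R -> R)).

Lemma decreasing_small (D : (set (E R))^nat) (e : R) : 0 < e ->
  (leb3 (D 0%N) < +oo)%E -> (forall n, measurable (D n)) ->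
  (forall n, D n.+1 `<=` D n) -> \bigcap_n D n = set0 ->
  exists n, (leb3 (D n) <= e%:E)%E.
Proof.
move=> e0 D0 mD Dd Dn0.
have Dd' : {homo D : n m / (n <= m)%N >-> (m <= n)%O}.
  apply: homo_leq => [X//|X Y Z XY YZ|n]; first exact: (le_trans YZ).
  by apply/subsetPset; exact: Dd.
have := nonincreasing_cvg_mu D0 mD (bigcapT_measurable mD) Dd'.
rewrite Dn0 measure0 => cv.
have : \forall n \near \oo, (leb3 (D n) < e%:E)%E.
  apply: (cv [set y | (y < e%:E)%E]); apply: open_nbhs_nbhs; split=> /=.
    exact: open_ereal_lt_ereal.
  by rewrite lte_fin.
by move=> [n _ /(_ n (leqnn _))] /= h; exists n; exact: ltW.
Qed.

Lemma L1cube_indic r A : measurable (A : set (E R)) ->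
  L1cube r (\1_A : R3 R -> R) = leb3 (A `&` cube r).
Proof.
move=> mA; rewrite /L1cube -integral_indic//; last exact: measurable_cube.
by apply: eq_integral => x _; rewrite ger0_norm.
Qed.

(** The indicator of [A] can change under a small shift only near points of [A] close to the
    complement. In a bounded region these points form sets that decrease to the empty set, so their
    measure tends to 0. *)
Lemma translation_continuous_open A : open A -> translation_continuous (\1_A : R3 R -> R).
Proof.
move=> oA r e e0; have mA := open_measurable3 oA.
(* The points of [A] at depth at least 1/(n+1); the union of these sets is [A] because [A] is
   open. *)
pose U n : set (R3 R) := [set x | ball x n.+1%:R^-1 `<=` A].
have mU n : measurable (U n : set (E R)).
  rewrite -[U n]setCK; apply: measurableC; apply: open_measurable3.
  have -> : ~` U n = \bigcup_(y in ~` A) ball y n.+1%:R^-1.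
    apply/seteqP; split => x /=.
      by move=> /existsNP[y /not_implyP[xy Ay]]; exists y => //; exact: ball_sym.
    by move=> [y Ay yx] Un; apply: Ay; apply: Un; exact: ball_sym.
  by apply: bigcup_open => y _; apply: ball_open; rewrite invr_gt0.
pose D n : set (E R) := (A `\` U n) `&` cube (r + 1).
have mD n : measurable (D n).
  by apply: measurableI; [exact: measurableD|exact: measurable_cube].
have e2 : 0 < e / 2 by rewrite divr_gt0.
have [n Dn] : exists n, (leb3 (D n) <= (e / 2)%:E)%E.
  apply: decreasing_small => //.
  - apply: (@le_lt_trans _ _ (leb3 (cube (r + 1)))); last exact: leb3_cube_lty.
    by apply: le_measure; rewrite ?inE//; [exact: measurable_cube|exact: subIsetr].
  - move=> n x [[Ax nUx] cx]; split=> //; split=> // Unx; apply: nUx.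
    by move=> y yx; apply: Unx; apply: le_ball yx; rewrite lef_pV2 ?posrE// ler_nat.
  - rewrite -subset0 => x Dx; have [[Ax _] _] := Dx 0%N I.
    have : nbhs x A by exact: open_nbhs_nbhs.
    move=> /nbhs_ballP[d /= d0 xA].
    have /ltr_add_invr[n] : 0 < d by [].
    rewrite add0r => nd; have [[_ +] _] := Dx n I; apply => y xy.
    by apply: xA; apply: le_ball xy; exact: ltW.
(* The radius 1/(n+2) places the closed cube of shifts inside the open ball of radius 1/(n+1); the
   bound 1 keeps shifted points in the cube of radius [r + 1]. *)
exists (Num.min 1 (n.+2%:R^-1)); first by rewrite lt_min ltr01 invr_gt0 ltr0n.
move=> h hd.
have h1 : cube 1 h by move: hd; apply: sub_cube; rewrite ge_min lexx.
have hn x : ball x n.+1%:R^-1 (x + h).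
  have nn : n.+2%:R^-1 < n.+1%:R^-1 :> R by rewrite ltf_pV2 ?posrE// ltr_nat.
  have : cube n.+2%:R^-1 h by move: hd; apply: sub_cube; rewrite ge_min lexx orbT.
  move=> /cubeE[a b c]; apply/ball3E; rewrite /= !opprD !addrA !subrr !add0r !normrN.
  by split; exact: le_lt_trans nn.
have mI : mf3 (\1_(D n) : R3 R -> R) by exact: measurable_indic.
have r1 : r <= r + 1 by rewrite lerDl.
have cr x : cube r x -> cube (r + 1) x by exact: sub_cube.
apply: (@le_trans _ _ (L1cube r (fun x => \1_(D n) (x + h)%R) + L1cube r (\1_(D n) : R3 R -> R))%E).
  apply: le_trans (leeD2l _ _).
  2: exact: lexx.
  rewrite /L1cube -ge0_integralD//; first last.
  - exact: measurable_abs_cube.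
  - by apply: measurable_abs_cube; exact: measurable_comp_translate.
  - exact: measurable_cube.
  apply: ge0_le_integral => //.
  - exact: measurable_cube.
  - apply: measurable_abs_cube; apply: measurable_funB => //.
    by apply: measurable_comp_translate; exact: measurable_indic.
  - apply: emeasurable_funD; apply: measurable_abs_cube => //.
    by apply: measurable_comp_translate; exact: measurable_indic.
  move=> x cx; rewrite -EFinD lee_fin !indicE.
  have [/set_mem Axh|nAxh] := boolP (x + h \in A); have [/set_mem Ax|nAx] := boolP (x \in A);
    rewrite ?subrr ?normr0 ?addr_ge0 ?subr0 ?sub0r ?normrN ?normr1//.
  - suff -> : x + h \in D n by rewrite normr1 lerDl.
    apply/mem_set; split; last exact: cubeD.
    split=> // Un; move: nAx; rewrite notin_setE; apply; apply: Un.
    exact: ball_sym.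
  - suff -> : x \in D n by rewrite normr1 lerDr.
    apply/mem_set; split; last exact: cr.
    split=> // Un; move: nAxh; rewrite notin_setE; apply; exact: Un.
have DD s : (L1cube s (\1_(D n) : R3 R -> R) <= (e / 2)%:E)%E.
  rewrite (L1cube_indic s (mD n)).
  suff le : (leb3 (D n `&` cube s) <= leb3 (D n))%E by exact: (le_trans le Dn).
  apply: le_measure; rewrite ?inE//.
  by apply: measurableI => //; exact: measurable_cube.
rewrite (splitr e) EFinD; apply: leeD => //.
exact: le_trans (L1cube_translate r mI h1) _.
Qed.

(* The sets satisfying [tc] form a sigma-algebra containing the open sets. *)
Let tc A := measurable (A : set (E R)) /\ translation_continuous (\1_A : R3 R -> R).

Let tcC A : tc A -> tc (~` A).
Proof.
move=> [mA tA]; split; first exact: measurableC.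
move=> r e e0; have [d d0 dP] := tA r e e0; exists d => // h /dP.
congr (_ <= _)%E; apply: eq_integral => x _; congr (_%:E).
rewrite !indicE !in_setC -normrN opprB.
by case: (_ \in A); case: (_ \in A); rewrite /= ?subrr ?subr0 ?sub0r.
Qed.

Let tc0 : tc set0.
Proof. by split=> //; apply: translation_continuous_open; exact: open0. Qed.

Let tcU A B : tc A -> tc B -> tc (A `|` B).
Proof.
move=> [mA tA] [mB tB]; split; first exact: measurableU.
move=> r e e0; have e2 : 0 < e / 2 by rewrite divr_gt0.
have [d d0 dP] := tA r _ e2; have [d' d'0 d'P] := tB r _ e2.
have mIA : mf3 (\1_A : R3 R -> R) by exact: measurable_indic.
have mIB : mf3 (\1_B : R3 R -> R) by exact: measurable_indic.
have mIAB : mf3 (\1_(A `|` B) : R3 R -> R).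
  by apply: measurable_indic; exact: measurableU.
exists (Num.min d d'); first by rewrite lt_min d0.
move=> h hd.
have mAh := measurable_comp_translate h mIA; have mBh := measurable_comp_translate h mIB.
have mABh := measurable_comp_translate h mIAB.
rewrite (splitr e) EFinD.
apply: le_trans (leeD (dP h _) (d'P h _)); last 2 first.
- by move: hd; apply: sub_cube; rewrite ge_min lexx.
- by move: hd; apply: sub_cube; rewrite ge_min lexx orbT.
have m1 : mf3 (fun x => \1_A (x + h) - \1_A x) by exact: measurable_funB.
have m2 : mf3 (fun x => \1_B (x + h) - \1_B x) by exact: measurable_funB.
rewrite /L1cube -ge0_integralD//; first last.
- exact: measurable_abs_cube.
- exact: measurable_abs_cube.
- exact: measurable_cube.
apply: ge0_le_integral => //.
- exact: measurable_cube.
- by apply: measurable_abs_cube; exact: measurable_funB.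
- by apply: emeasurable_funD; exact: measurable_abs_cube.
move=> x _; rewrite -EFinD lee_fin !indicE !in_setU.
case: (_ \in A); case: (_ \in B); case: (_ \in A); case: (_ \in B);
  rewrite /= ?subrr ?subr0 ?sub0r ?normrN ?normr0 ?normr1 ?addr0 ?add0r//;
  by rewrite ?addr_ge0 ?lerDl.
Qed.

(** A countable union is approximated in L^1 of each cube by its finite subunions, the cube having
    finite measure. *)
Let tc_bigcup (F : (set (R3 R))^nat) : (forall n, tc (F n)) -> tc (\bigcup_n F n).
Proof.
move=> tF; have mF n : measurable (F n : set (E R)) by case: (tF n).
have mUF : measurable (\bigcup_n F n : set (E R)) by exact: bigcup_measurable.
split=> //; apply: translation_continuous_approx; first exact: measurable_indic.
move=> r e e0.
pose G n := \big[setU/set0]_(i < n) F i.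
have tG n : tc (G n).
  by rewrite /G; elim: n => [|n IH]; rewrite ?big_ord0// big_ord_recr/=; exact: tcU.
have GU n x : G n x -> (\bigcup_n F n) x.
  by rewrite /G -bigcup_mkord => -[i _ Fi]; exists i.
pose D n : set (E R) := ((\bigcup_n F n) `\` G n) `&` cube r.
have mD n : measurable (D n).
  apply: measurableI; last exact: measurable_cube.
  by apply: measurableD => //; case: (tG n).
have [n Dn] : exists n, (leb3 (D n) <= e%:E)%E.
  apply: decreasing_small => //.
  - apply: (@le_lt_trans _ _ (leb3 (cube r))); last exact: leb3_cube_lty.
    by apply: le_measure; rewrite ?inE//; [exact: measurable_cube|exact: subIsetr].
  - move=> n x [[Fx nG] cx]; split=> //; split=> // Gx; apply: nG.
    by rewrite /G big_ord_recr/=; left.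
  - rewrite -subset0 => x Dx; have [[[k _ Fk] _] _] := Dx 0%N I.
    by have [[_ +] _] := Dx k.+1 I; apply; rewrite /G big_ord_recr/=; right.
exists (\1_(G n)); have [mG tGn] := tG n; split; [exact: measurable_indic|exact: tGn|].
apply: le_trans Dn.
have <- : L1cube r (\1_((\bigcup_n F n) `\` G n) : R3 R -> R) = leb3 (D n).
  by apply: L1cube_indic; exact: measurableD.
rewrite /L1cube le_eqVlt; apply/orP; left; apply/eqP; apply: eq_integral => x _.
congr (`|_|%:E); rewrite !indicE in_setD.
have [Gx|nGx] := boolP (x \in G n).
  by rewrite (mem_set (GU _ _ (set_mem Gx))) subrr.
by rewrite andbT subr0.
Qed.

Lemma tc_preimage (p : R3 R -> R) : continuous p ->
  forall X : set R, measurable X -> tc (p @^-1` X).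
Proof.
move=> cp; suff : @measurable _ R `<=` [set X | tc (p @^-1` X)] by apply.
rewrite [measurable]RGenOpens.measurableE; apply: smallest_sub.
  split.
  - by rewrite /= preimage_set0.
  - by move=> X pX; rewrite /= setTD preimage_setC; exact: tcC.
  - by move=> F pF; rewrite /= preimage_bigcup; exact: tc_bigcup.
move=> _ [a [b ->]] /=.
have o : open (p @^-1` `]a, b[%classic).
  by move/continuousP: cp; apply; exact: interval_open.
by split; [exact: open_measurable3|exact: translation_continuous_open].
Qed.

(** The product sigma-algebra is generated by preimages under the coordinates. These satisfy [tc] by
    [tc_preimage], and [tc] is stable under complements and countable unions. *)
Lemma translation_continuous_indic A : measurable (A : set (E R)) ->
  translation_continuous (\1_A : R3 R -> R).
Proof.
move=> mA; suff : tc A by case.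
have sa (T : Type) (p : R3 R -> T) : sigma_algebra setT [set X | tc (p @^-1` X)].
  split.
  - by rewrite /= preimage_set0.
  - by move=> X pX; rewrite /= setTD preimage_setC; exact: tcC.
  - by move=> F pF; rewrite /= preimage_bigcup; exact: tc_bigcup.
have tc12 : @measurable _ (measurableTypeR R * measurableTypeR R)%type `<=`
    [set X | tc ((@fst (R * R) R) @^-1` X)].
  apply: smallest_sub; first exact: (sa _ (@fst (R * R) R)).
  rewrite subUset; split => _ [X mX <-] /=; rewrite setTI.
  - apply: (@tc_preimage (fun x => x.1.1)) => // x.
    by apply: (cvg_comp _ _ cvg_fst); exact: cvg_fst.
  - apply: (@tc_preimage (fun x => x.1.2)) => // x.
    by apply: (cvg_comp _ _ cvg_fst); exact: cvg_snd.
suff : @measurable _ (E R) `<=` [set X | tc X] by apply.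
apply: smallest_sub; first exact: (sa _ id).
rewrite subUset; split => _ [X mX <-] /=; rewrite setTI.
- exact: tc12.
- by apply: (@tc_preimage snd) => // x; exact: cvg_snd.
Qed.

End TranslationContinuity.

Import HBSimple.

(** * Continuity of translations in L^1 and L^2 *)

Section TranslationContinuityL1.
Context {R : realType}.
Implicit Types (x y h : R3 R) (f g : R3 R -> R) (A B : set (R3 R)).

Notation mf3 f := (measurable_fun (setT : set (E R)) (f : E R -> R)).

(** Simple functions are finite combinations of indicators and are dense in L^1 of every cube. *)
Lemma translation_continuous_L1 f : mf3 f -> (forall r, L1cube r f < +oo)%E ->
  translation_continuous f.
Proof.
move=> mf L1f; apply: translation_continuous_approx => // r e e0.
have intf : leb3.-integrable (cube r) (EFin \o f).
  apply/integrableP; split; last exact: L1f.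
  by apply/measurable_EFinP; exact: measurable_funTS.
have [g [intg _ cv]] := approximation_sfun_integrable (measurable_cube r) intf.
have : \forall n \near \oo, (\int[leb3]_(z in cube r) `|(f z)%:E - (g n z)%:E| < e%:E)%E.
  apply: (cv [set y | (y < e%:E)%E]); apply: open_nbhs_nbhs; split=> /=.
    exact: open_ereal_lt_ereal.
  by rewrite lte_fin.
move=> [n _ /(_ n (leqnn _))] /= gn; exists (g n); split; last exact: ltW.
- exact: measurable_funP.
- rewrite (_ : (g n : R3 R -> R) = fun x => \sum_(y <- finmap.enum_fset (fset_set (range (g n))))
    y * \1_(g n @^-1` [set y]) x); last first.
    by apply/funext => x; rewrite {1}fimfunE fsbig_finite.
  apply: translation_continuous_sum => y.
    by apply: measurable_funM => //; exact: measurable_indic.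
  apply: translation_continuousZ; first exact: measurable_indic.
  exact: translation_continuous_indic.
Qed.

(* Reduces continuity of translations of f in L^2 to that of f |f| in L^1. *)
Lemma sqrB_le_normM (a b : R) : (a - b) ^+ 2 <= 2 * `|a * `|a| - b * `|b| |.
Proof.
wlog: a b / `|b| <= `|a|.
  move=> H; have [/H//|/ltW/H] := leP `|b| `|a|.
  by rewrite -sqrrN opprB distrC.
wlog a0 : a b / 0 <= a.
  move=> H ba; have [/H|a0] := leP 0 a; first exact.
  have /H : 0 <= - a by rewrite oppr_ge0 ltW.
  move=> /(_ (- b)); rewrite !normrN => /(_ ba).
  have -> : (- a - - b) ^+ 2 = (a - b) ^+ 2 by ring.
  have -> : - a * `|a| - - b * `|b| = - (a * `|a| - b * `|b|) by ring.
  by rewrite normrN.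
rewrite (ger0_norm a0) => ba; have [b0|b0] := leP 0 b.
  move: ba; rewrite (ger0_norm b0) => ba.
  by rewrite ger0_norm; nra.
move: ba; rewrite (ltr0_norm b0) => ba.
by rewrite ger0_norm; nra.
Qed.

Lemma translation_continuous_L2 f : mf3 f -> (forall r, sqint leb3 (cube r) f) ->
  forall r e, 0 < e -> exists2 d, 0 < d & forall h, cube d h ->
    (\int[leb3]_(x in cube r) ((f (x + h) - f x) ^+ 2)%:E <= e%:E)%E.
Proof.
move=> mf sf r e e0; have e2 : 0 < e / 2 by rewrite divr_gt0.
pose q x := f x * `|f x|.
have mq : mf3 q by apply: measurable_funM => //; exact: measurableT_comp.
have tq : translation_continuous q.
  apply: translation_continuous_L1 => // s.
  rewrite /L1cube; under eq_integral do rewrite normrM normr_id -expr2 real_normK ?num_real//.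
  by have [] := sf s.
have [d d0 dP] := tq r _ e2; exists d => // h hd.
have mqh := measurable_comp_translate h mq; have mfh := measurable_comp_translate h mf.
apply: (@le_trans _ _ (2%:E * L1cube r (fun x => q (x + h) - q x)%R)%E); last first.
  apply: le_trans (lee_wpmul2l _ (dP h hd)) _; first by rewrite lee_fin.
  by rewrite -EFinM lee_fin mulrC divfK.
rewrite /L1cube -ge0_integralZl//.
- apply: ge0_le_integral => //.
  + exact: measurable_cube.
  + by move=> x _; rewrite lee_fin sqr_ge0.
  + apply/measurable_EFinP; apply: measurable_funX; apply: measurable_funTS.
    exact: measurable_funB.
  + by apply: measurable_funeM; apply: measurable_abs_cube; exact: measurable_funB.
  + by move=> x _; rewrite -EFinM lee_fin; exact: sqrB_le_normM.
- exact: measurable_cube.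
- by apply: measurable_abs_cube; exact: measurable_funB.
Qed.
End TranslationContinuityL1.

(** * Test functions and the fundamental lemma *)

Section Bump.
Context {R : realType}.
Implicit Types (f : R -> R) (P : {poly R}).

(** The witness is the whole sequence of derivatives, so that any iterated partial derivative of a
    product of three such functions is read off by counting directions. *)
Definition smooth1 f := exists2 F : nat -> R -> R, F 0%N = f &
  forall n x, is_derive x (1 : R) (F n) (F n.+1 x).

(** Serves outside the open interval (0, 1), endpoints included, where the bump is quadratically
    flat and no formula has to be differentiated. *)
Lemma quadratic_is_derive f (M x : R) :
  (forall y, `|f y - f x| <= M * (y - x) ^+ 2) -> is_derive x (1 : R) f 0.
Proof.
move=> fM; pose q h := h^-1 *: (f (h *: (1 : R) + x) - f x).
have cv : q h @[h --> 0^'] --> 0.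
  apply/cvgrPdist_le => e e0; near=> h.
  have h0 : h != 0 by near: h; exact: nbhs_dnbhs_neq.
  have he : `|h| < e / (`|M| + 1).
    near: h; apply: dnbhs0_lt; rewrite divr_gt0// ltr_wpDl//.
  rewrite sub0r normrN /q normrZ normfV ler_pdivrMl ?normr_gt0//.
  apply: (le_trans (fM _)).
  rewrite addrK [h *: 1]mulr1 -(real_normK (num_real h)) expr2 mulrCA ler_wpM2l//.
  apply: (@le_trans _ _ ((`|M| + 1) * `|h|)).
    by rewrite ler_wpM2r// (le_trans (ler_norm _))// lerDl.
  by rewrite mulrC -ler_pdivlMr ?ltr_wpDl//; exact: ltW.
apply: DeriveDef; last exact: cvg_lim cv.
by apply/cvg_ex; exists 0.
Unshelve. all: by end_near. Qed.

(** For P = 1 and k = 0 this is the classical bump exp(-1/(x(1-x))) on (0, 1). The polynomial and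
    the power are there because the family is closed under differentiation, which yields all
    derivatives at once. *)
Definition bump P (k : nat) (x : R) : R :=
  if (0 < x) && (x < 1) then P.[x] * (x * (1 - x)) ^- k * expR (- (x * (1 - x))^-1) else 0.

(** The numerator of the derivative of P W^-k exp(-1/W) over the denominator W^(k+2). *)
Definition dbump P (k : nat) : {poly R} :=
  let W := 'X * (1 - 'X) in let W' := 1 - 'X *+ 2 in
  P^`() * W ^+ 2 - P * W * W' *+ k + P * W'.

Lemma horner_bounded P : exists2 M : R, 0 <= M & forall x, 0 <= x <= 1 -> `|P.[x]| <= M.
Proof.
elim/poly_ind: P => [|P c [M M0 PM]]; first by exists 0 => // x _; rewrite horner0 normr0.
exists (M + `|c|) => [|x x01]; first by rewrite addr_ge0.
rewrite !hornerE (le_trans (ler_normD _ _))// lerD// normrM.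
have /andP[x0 x1] := x01; rewrite (ger0_norm x0).
by apply: le_trans (PM _ x01); rewrite ler_piMr.
Qed.

(** The exponential of 1/w dominates its Taylor term of degree m + 1. *)
Lemma expR_inv_le (w : R) m : 0 < w -> w ^- m.+1 * expR (- w^-1) <= m.+1`!%:R.
Proof.
move=> w0; have i0 : 0 <= w^-1 by rewrite invr_ge0 ltW.
have := expR_ge1Dxn m i0; rewrite expRN ler_pdivrMr ?expR_gt0// => h.
have f0 : 0 < m.+1`!%:R :> R by rewrite ltr0n fact_gt0.
rewrite -exprVn -ler_pdivrMl// mulrC; apply: le_trans h.
by rewrite lerDr.
Qed.

(** For [x] outside (0, 1) and [y] inside, w = y(1-y) is at most |y - x|, and w^-k exp(-1/w) <=
    (k+2)! w^2 since the exponential beats two more powers of w. *)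
Lemma bump_flat P k : exists2 M : R, 0 <= M & forall x y, ~~ ((0 < x) && (x < 1)) ->
  `|bump P k y| <= M * (y - x) ^+ 2.
Proof.
have [M M0 PM] := horner_bounded P.
exists (M * k.+2`!%:R) => [|x y x01]; first by rewrite mulr_ge0.
rewrite /bump; case: ifPn => [/andP[y0 y1]|_]; last first.
  by rewrite normr0; apply: mulr_ge0; [exact: mulr_ge0|exact: sqr_ge0].
set w := y * (1 - y); have w0 : 0 < w by rewrite mulr_gt0// subr_gt0.
have wx : w ^+ 2 <= (y - x) ^+ 2.
  have [x0|x0] := leP x 0.
    rewrite ler_pXn2r ?nnegrE ?ltW//; last lra.
    by rewrite /w; nra.
  have x1 : 1 <= x by move: x01; rewrite x0/= -leNgt.
  rewrite -(sqrrN (y - x)) opprB ler_pXn2r ?nnegrE ?ltW//; last lra.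
  by rewrite /w; nra.
rewrite -!mulrA normrM ler_pM// ?PM ?(ltW y0) ?(ltW y1)//.
apply: (@le_trans _ _ (k.+2`!%:R * w ^+ 2)); last by rewrite ler_wpM2l.
rewrite ger0_norm ?mulr_ge0 ?expR_ge0 ?invr_ge0 ?exprn_ge0 ?(ltW w0)//.
rewrite -ler_pdivrMr ?exprn_gt0//.
apply: le_trans (expR_inv_le k.+1 w0).
rewrite le_eqVlt; apply/orP; left; apply/eqP.
by rewrite mulrAC -invfM -exprD addn2.
Qed.

Lemma is_derive_bump P k x : is_derive x (1 : R) (bump P k) (bump (dbump P k) k.+2 x).
Proof.
have [x01|x01] := boolP ((0 < x) && (x < 1)); last first.
  rewrite {2}/bump (negbTE x01).
  have [M M0 bM] := bump_flat P k.
  apply: (@quadratic_is_derive _ M) => y.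
  by rewrite {2}/bump (negbTE x01) subr0; exact: bM.
have /andP[x0 x1] := x01.
have w0 : x * (1 - x) != 0 by rewrite gt_eqF// mulr_gt0// subr_gt0.
pose W : {poly R} := 'X * (1 - 'X).
have WE y : W.[y] = y * (1 - y) by rewrite /W !hornerE.
apply: (@near_eq_is_derive _ _ _
  ((horner P * (fun y => (W.[y])^-1) ^+ k) * (fun y => expR (- (W.[y])^-1)))).
  near=> y; rewrite /bump.
  have -> : (0 < y) && (y < 1).
    apply/andP; split; near: y; [exact: lt_nbhsr|exact: lt_nbhsl].
  by rewrite !fctE !WE exprVn.
have Wx : W.[x] != 0 by rewrite WE.
have dW : is_derive x (1 : R) (horner W) (1 - x *+ 2).
  apply: is_derive_eq (is_derive_poly W x) _.
  by rewrite /W !poly.derivE !hornerE; ring.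
have dV : is_derive x (1 : R) (fun y => (W.[y])^-1) (- W.[x] ^- 2 * (1 - x *+ 2)).
  exact: is_deriveV.
have dN : is_derive x (1 : R) (fun y => - (W.[y])^-1) (W.[x] ^- 2 * (1 - x *+ 2)).
  apply: is_derive_eq (is_deriveN dV) _.
  by rewrite mulNr opprK.
have dE : is_derive x (1 : R) (fun y => expR (- (W.[y])^-1))
    (W.[x] ^- 2 * (1 - x *+ 2) * expR (- (W.[x])^-1)).
  apply: is_derive_eq (@is_derive1_comp _ expR (fun y => - (W.[y])^-1) _ _ _ _ dN) _.
  by rewrite mulrC.
apply: is_derive_eq.
rewrite /bump x01 !fctE -!WE.
rewrite /dbump -/W !hornerE/= -!WE ?hornerMn ?hornerE/= /GRing.scale/=.
move: (expR _) => e.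
have x'0 : x != 0 by rewrite gt_eqF.
have x1'0 : 1 - x != 0 by rewrite gt_eqF// subr_gt0.
case: k => [|k]; first by rewrite !mulr0n; field; rewrite x'0 x1'0.
rewrite /= -!(exprVn (x * (1 - x)) k.+3) !(exprS _^-1) -[(_ * _) *+ k.+1]mulr_natr.
move: (_^-1 ^+ k) (k.+1%:R) => v c.
by field; rewrite x'0 x1'0.
Unshelve. all: by end_near. Qed.
End Bump.

Section Smooth1.
Context {R : realType}.
Implicit Types (f g : R -> R).

Lemma smooth1_bump P k : smooth1 (bump P k : R -> R).
Proof.
pose it (n : nat) := iter n (fun q : {poly R} * nat => (dbump q.1 q.2, q.2.+2)) (P, k).
exists (fun n => bump (it n).1 (it n).2) => // n x.
exact: is_derive_bump.
Qed.

Lemma smooth1_affine f a b : smooth1 f -> smooth1 (fun x => f (a * x + b)).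
Proof.
move=> [F F0 dF]; exists (fun n x => a ^+ n * F n (a * x + b)).
  by apply/funext => x; rewrite expr0 mul1r F0.
move=> n x.
have dl : is_derive x (1 : R) (fun x => a * x + b) a.
  have d1 : is_derive x (1 : R) ((a : R) *: (id : R -> R) + cst b) (a *: 1 + 0).
    exact: is_deriveD.
  by move: d1; rewrite addr0 [a *: 1]mulr1.
have d2 := @is_derive1_comp R (F n) (fun x => a * x + b) _ _ _ (dF n (a * x + b)) dl.
have d3 := is_deriveZ (a ^+ n) d2.
by apply: is_derive_eq d3 _; rewrite exprSr /GRing.scale/=; ring.
Qed.

Lemma is_derive_continuous f (f' : R -> R) :
  (forall x, is_derive x (1 : R) f (f' x)) -> continuous f.
Proof.
move=> df x; apply/differentiable_continuous/derivable1_diffP.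
by have [] := df x.
Qed.

Lemma smooth1_continuous f : smooth1 f -> continuous f.
Proof. by move=> [F <- dF]; exact: is_derive_continuous (dF 0%N). Qed.

End Smooth1.

(** * Test functions as products of functions of one variable *)

Section Tensor.
Context {R : realType}.
Implicit Types (x v : R3 R) (p : R3 R -> R).

Lemma is_derive_line p v x (t d : R) :
  is_derive t (1 : R) (fun s => p (s *: v + x)) d <-> is_derive (t *: v + x) v p d.
Proof.
have E : (fun h : R => h^-1 *: (p ((h *: (1 : R) + t) *: v + x) - p (t *: v + x))) =
         (fun h : R => h^-1 *: (p (h *: v + (t *: v + x)) - p (t *: v + x))).
  by apply/funext => h; rewrite [h *: 1]mulr1 scalerDl addrA.
by split=> -[d1 d2]; split; move: d1 d2; rewrite /derivable /derive /= ?E// -E.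
Qed.

Definition tensor (f1 f2 f3 : R -> R) x := f1 x.1.1 * f2 x.1.2 * f3 x.2.

Lemma is_derive_tensor (f1 f2 f3 g1 g2 g3 : R -> R) v x :
  is_derive x.1.1 (1 : R) f1 (g1 x.1.1) -> is_derive x.1.2 (1 : R) f2 (g2 x.1.2) ->
  is_derive x.2 (1 : R) f3 (g3 x.2) ->
  is_derive x v (tensor f1 f2 f3)
    (v.1.1 * tensor g1 f2 f3 x + v.1.2 * tensor f1 g2 f3 x + v.2 * tensor f1 f2 g3 x).
Proof.
move=> d1 d2 d3; have := is_derive_line (tensor f1 f2 f3) v x 0.
rewrite scale0r add0r => <-.
have D (f : R -> R) (c y d : R) : is_derive y (1 : R) f d ->
    is_derive (0 : R) (1 : R) (fun t => f (t * c + y)) (d * c).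
  move=> df; apply: is_derive1_comp; first by rewrite mul0r add0r.
  have dl : is_derive (0 : R) (1 : R) ((c : R) *: (id : R -> R) + cst y) (c *: 1 + 0).
    exact: is_deriveD.
  move: dl; rewrite addr0 [_ *: 1]mulr1; congr is_derive.
  by apply/funext => t; rewrite !fctE /= /GRing.scale/= mulrC.
have D1 := D _ v.1.1 _ _ d1; have D2 := D _ v.1.2 _ _ d2; have D3 := D _ v.2 _ _ d3.
have := is_deriveM (is_deriveM D1 D2) D3.
move=> DD; apply: is_derive_eq DD _.
by rewrite /tensor !fctE !mul0r !add0r /GRing.scale/=; ring.
Qed.

Lemma continuous_tensor (f1 f2 f3 : R -> R) : continuous f1 -> continuous f2 ->
  continuous f3 -> continuous (tensor f1 f2 f3).
Proof.
move=> c1 c2 c3 x; apply: cvgM; first apply: cvgM.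
- apply: continuous_comp; last exact: c1.
  by apply: (cvg_comp _ _ cvg_fst); exact: cvg_fst.
- apply: continuous_comp; last exact: c2.
  by apply: (cvg_comp _ _ cvg_fst); exact: cvg_snd.
- apply: continuous_comp; last exact: c3.
  exact: cvg_snd.
Qed.

Section partials.
Variables F1 F2 F3 : nat -> R -> R.
Hypothesis dF1 : forall n (y : R), is_derive y (1 : R) (F1 n) (F1 n.+1 y).
Hypothesis dF2 : forall n (y : R), is_derive y (1 : R) (F2 n) (F2 n.+1 y).
Hypothesis dF3 : forall n (y : R), is_derive y (1 : R) (F3 n) (F3 n.+1 y).

Let T n1 n2 n3 := tensor (F1 n1) (F2 n2) (F3 n3).

Lemma is_derive_tensor_basis n1 n2 n3 (j : 'I_3) x :
  is_derive x (stdbasis j) (T n1 n2 n3)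
    (T ((j == 0%N :> nat) + n1) ((j == 1%N :> nat) + n2) ((j == 2%N :> nat) + n3) x).
Proof.
apply: is_derive_eq (is_derive_tensor _ (dF1 n1 _) (dF2 n2 _) (dF3 n3 _)) _.
by rewrite /stdbasis /=; case: j => -[|[|[|//]]] //= _;
  rewrite !mul0r !mul1r ?addr0 ?add0r.
Qed.

Lemma partials_tensor (s : seq 'I_3) :
  partials s (T 0 0 0) =
  T (count (fun j : 'I_3 => j == 0%N :> nat) s) (count (fun j : 'I_3 => j == 1%N :> nat) s)
    (count (fun j : 'I_3 => j == 2%N :> nat) s).
Proof.
elim: s => [//|j s IH] /=; rewrite -/(partials s (T 0 0 0)) IH.
by apply/funext => x; apply: (@derive_val _ _ _ _ _ _ _ (is_derive_tensor_basis _ _ _ j x)).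
Qed.

Lemma smooth_tensor : smooth (T 0 0 0).
Proof.
move=> s; rewrite partials_tensor; split.
  by apply: continuous_tensor; apply: is_derive_continuous.
by move=> j x; apply: (@ex_derive _ _ _ _ _ _ _ (is_derive_tensor_basis _ _ _ j x)).
Qed.
End partials.

Lemma test_function_tensor (f1 f2 f3 : R -> R) (M : R) :
  smooth1 f1 -> smooth1 f2 -> smooth1 f3 ->
  (forall t, M < `|t| -> [/\ f1 t = 0, f2 t = 0 & f3 t = 0]) ->
  test_function (tensor f1 f2 f3).
Proof.
move=> [F1 <- d1] [F2 <- d2] [F3 <- d3] supp; split; first exact: smooth_tensor.
apply: (@subclosed_compact (R3 R) _ (cube M)); first exact: closed_closure.
  exact: compact_cube.
rewrite [X in _ `<=` X](closure_id _).1; last first.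
  by apply: compact_closed; [exact: hausdorff3|exact: compact_cube].
apply: closureS => x /= x0; apply/cubeE.
by split; rewrite leNgt; apply: contra x0 => /supp[z1 z2 z3];
  rewrite /tensor ?z1 ?z2 ?z3 ?mul0r ?mulr0 ?mul0r.
Qed.
End Tensor.

(** * Locally integrable functions and mollifiers *)

Section LocallyIntegrable.
Context {R : realType}.
Implicit Types (x y h a : R3 R) (f g p : R3 R -> R).

Notation mf3 f := (measurable_fun (setT : set (E R)) (f : E R -> R)).

Lemma ae3S (P Q : R3 R -> Prop) : (forall x, P x -> Q x) ->
  {ae leb3, forall x : R3 R, P x} -> {ae leb3, forall x : R3 R, Q x}.
Proof. by move=> PQ [N [mN N0 PN]]; exists N; split=> // x nQ; apply: PN => /= /PQ. Qed.

Lemma ae3S2 (P Q S : R3 R -> Prop) : (forall x, P x -> Q x -> S x) ->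
  {ae leb3, forall x : R3 R, P x} -> {ae leb3, forall x : R3 R, Q x} ->
  {ae leb3, forall x : R3 R, S x}.
Proof.
move=> PQS aP aQ; suff : {ae leb3, forall x : R3 R, P x /\ Q x}.
  by apply: ae3S => x [/PQS].
exact: (@filterI _ _ (ae_filter_ringOfSetsType (@leb3 R))).
Qed.

Lemma ae3_foralln (P : nat -> R3 R -> Prop) :
  (forall n, {ae leb3, forall x : R3 R, P n x}) ->
  {ae leb3, forall x : R3 R, forall n, P n x}.
Proof. exact: ae_foralln. Qed.

Definition loc1 f := mf3 f /\ forall r, (L1cube r f < +oo)%E.

(** What test functions and their derivatives have in common and what makes their products with
    locally integrable functions integrable. *)
Definition bounded_support p := mf3 p /\ exists r M,
  (forall x, `|p x| <= M) /\ (forall x, ~ cube r x -> p x = 0).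

Lemma loc1D f g : loc1 f -> loc1 g -> loc1 (fun x => f x + g x).
Proof.
move=> [mf lf] [mg lg]; split; first exact: measurable_funD.
by move=> r; apply: le_lt_trans (L1cubeD r mf mg) _; rewrite lte_add_pinfty.
Qed.

Lemma loc1Z c f : loc1 f -> loc1 (fun x => c * f x).
Proof.
move=> [mf lf]; split; first exact: measurable_funM.
by move=> r; rewrite (L1cubeZ r c mf); apply: lte_mul_pinfty; rewrite ?lee_fin.
Qed.

Lemma loc1B f g : loc1 f -> loc1 g -> loc1 (fun x => f x - g x).
Proof.
move=> lf /(loc1Z (-1)) lg; have := loc1D lf lg.
by under eq_fun do rewrite mulN1r.
Qed.

Lemma cube_normr h : cube `|h| h.
Proof. by apply/cubeE; rewrite !prod_normE/= !le_max !lexx ?orbT. Qed.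

Lemma loc1_translate f h : loc1 f -> loc1 (fun x => f (x + h)).
Proof.
move=> [mf lf]; split; first exact: measurable_comp_translate.
by move=> r; apply: le_lt_trans (L1cube_translate r mf (cube_normr h)) _.
Qed.

Lemma sqint_loc1 f : mf3 f -> (forall r, sqint leb3 (cube r) f) -> loc1 f.
Proof.
move=> mf sf; split=> // r.
have s1 : sqint leb3 (cube r) (fun=> 1).
  split=> //; under eq_integral do rewrite expr1n.
  by rewrite integral_cst ?mul1e; [exact: leb3_cube_lty|exact: measurable_cube].
have /integrableP[_] := sqint_integrableM (measurable_cube r) (sf r) s1.
by under eq_integral do rewrite /= mulr1.
Qed.

Lemma integrable_loc1_bounded_support f p : loc1 f -> bounded_support p ->
  leb3.-integrable setT (EFin \o (fun x => f x * p x)).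
Proof.
move=> [mf lf] [mp [r [M [pM pr]]]].
have mc := @measurable_cube R r.
have intf : leb3.-integrable (cube r) (fun x => (M * f x)%:E).
  under eq_fun do rewrite EFinM; apply: integrableZl => //.
  apply/integrableP; split; last exact: lf.
  by apply/measurable_EFinP; exact: measurable_funTS.
have /(integrable_mkcond _ mc) := intf; apply: le_integrable => //.
  by apply/measurable_EFinP; exact: measurable_funM.
move=> x _; rewrite /patch/=; case: ifPn => [/set_mem cx|/negP cx].
  by rewrite lee_fin !normrM mulrC ler_wpM2r// (le_trans (pM x))// ler_norm.
rewrite pr => [|/mem_set//]; rewrite mulr0 normr0; exact: abse_ge0.
Qed.

Lemma bounded_support_translate p h : bounded_support p ->
  bounded_support (fun x => p (x + h)).
Proof.
move=> [mp [r [M [pM pr]]]]; split; first exact: measurable_comp_translate.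
exists (r + `|h|), M; split=> [x|x cx]; first exact: pM.
apply: pr => cxh; apply: cx; rewrite -(addrK h x); apply: cubeD => //.
by apply/cubeN; exact: cube_normr.
Qed.

Lemma Rintegral_translate h f : mf3 f ->
  \int[leb3]_x f (x + h) = \int[leb3]_x f x.
Proof.
move=> mf; congr fine.
have := @integral_translate R h setT (EFin \o f) measurableT.
by rewrite preimage_setT; apply; exact/measurable_EFinP.
Qed.

Lemma L1cube_eq0 f : mf3 f -> (forall n : nat, L1cube n%:R f = 0%E) ->
  {ae leb3, forall x : R3 R, f x = 0}.
Proof.
move=> mf f0.
have fn n : {ae leb3, forall x : R3 R, cube n%:R x -> f x = 0}.
  have mfn : measurable_fun (cube n%:R : set (E R)) (EFin \o (f : E R -> R)).
    by apply/measurable_EFinP; exact: measurable_funTS.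
  have := (ae_eq_integral_abs leb3 (measurable_cube n%:R) mfn).1 (f0 n).
  by apply: ae3S => x /[apply] -[].
have fA : {ae leb3, forall x : R3 R, forall n, cube n%:R x -> f x = 0}.
  exact: ae3_foralln.
apply: ae3S fA => x H; have : (\bigcup_n cube n%:R) x by rewrite cube_bigcup.
by move=> [n _ /H].
Qed.

(** The affine map carries (-e, e) onto (0, 1). *)
Definition bump1 (e t : R) : R := bump 1 0 ((2 * e)^-1 * t + 2^-1).

(** Left without normalization: its integral is positive and cancels from the estimate in which it
    occurs. *)
Definition mollifier (e : R) : R3 R -> R := tensor (bump1 e) (bump1 e) (bump1 e).

Lemma bump1_ge0 e t : 0 <= bump1 e t.
Proof.
by rewrite /bump1 /bump; case: ifP => // _; rewrite hornerC expr0 invr1 !mul1r expR_ge0.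
Qed.

Lemma bump1_le1 e t : bump1 e t <= 1.
Proof.
rewrite /bump1 /bump; case: ifPn => // /andP[s0 s1].
rewrite hornerC expr0 invr1 !mul1r expR_le1 oppr_le0 invr_ge0 mulr_ge0 ?(ltW s0)//.
by rewrite subr_ge0 (ltW s1).
Qed.

Lemma bump1_arg (e t : R) : 0 < e ->
  (0 < (2 * e)^-1 * t + 2^-1) && ((2 * e)^-1 * t + 2^-1 < 1) = (`|t| < e).
Proof.
move=> e0; have i0 : 0 < (2 * e)^-1 by rewrite invr_gt0 mulr_gt0.
have -> : 2^-1 = (2 * e)^-1 * e by field; rewrite gt_eqF.
rewrite -mulrDr pmulr_rgt0// -ltr_pdivlMl// invrK mulr1 ltr_norml.
by apply/idP/idP => /andP[? ?]; apply/andP; split; lra.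
Qed.

Lemma bump1_gt0 e t : 0 < e -> `|t| < e -> 0 < bump1 e t.
Proof.
move=> e0 te; rewrite /bump1 /bump bump1_arg// te.
by rewrite hornerC expr0 invr1 !mul1r expR_gt0.
Qed.

Lemma bump1_supp e t : 0 < e -> e <= `|t| -> bump1 e t = 0.
Proof. by move=> e0 te; rewrite /bump1 /bump bump1_arg// ltNge te. Qed.

Lemma smooth1_bump1 e : smooth1 (bump1 e).
Proof. exact/smooth1_affine/smooth1_bump. Qed.

Lemma mollifier_ge0 e x : 0 <= mollifier e x.
Proof. by rewrite /mollifier /tensor !mulr_ge0// bump1_ge0. Qed.

Lemma mollifier_supp e x : 0 < e -> ~ cube e x -> mollifier e x = 0.
Proof.
move=> e0 cx; apply/eqP/negPn/negP => x0; apply: cx; apply/cubeE.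
by split; rewrite leNgt; apply: contra x0 => /ltW/(bump1_supp e0) b0;
  rewrite /mollifier /tensor b0 ?mul0r ?mulr0 ?mul0r.
Qed.

Lemma bounded_support_mollifier e : 0 < e -> bounded_support (mollifier e).
Proof.
move=> e0; split.
  apply: continuous_measurable3; apply: continuous_tensor;
  exact/smooth1_continuous/smooth1_bump1.
exists e, 1; split=> x; last exact: mollifier_supp.
rewrite ger0_norm ?mollifier_ge0// /mollifier /tensor.
have b01 t := bump1_ge0 e t; have b1 t := bump1_le1 e t.
by rewrite mulr_ile1 ?mulr_ge0 ?mulr_ile1.
Qed.

Lemma loc1_cst (c : R) : loc1 (fun=> c).
Proof.
split=> // r; rewrite /L1cube integral_cst; last exact: measurable_cube.
by apply: lte_mul_pinfty; rewrite ?lee_fin//; exact: leb3_cube_lty.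
Qed.

Lemma mollifier_integrable e : 0 < e ->
  leb3.-integrable setT (EFin \o (mollifier e : R3 R -> R)).
Proof.
move=> /bounded_support_mollifier/(integrable_loc1_bounded_support (loc1_cst 1)).
by apply: eq_integrable => // x _ /=; rewrite mul1r.
Qed.

(** A zero integral would force the mollifier to vanish almost everywhere, but it is positive on the
    cube of radius e/2, which has positive volume. *)
Lemma mollifier_int_gt0 e : 0 < e -> (0 < \int[leb3]_x (mollifier e x)%:E)%E.
Proof.
move=> e0; rewrite lt0e integral_ge0 ?andbT => [|x _]; last by rewrite lee_fin mollifier_ge0.
apply/negP => /eqP i0.
have mm : measurable_fun (setT : set (E R)) (EFin \o mollifier e).
  by have /integrableP[] := mollifier_integrable e0.
have : (\int[leb3]_x `|(mollifier e x)%:E| = 0)%E.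
  by rewrite -i0; apply: eq_integral => x _; rewrite gee0_abs// lee_fin mollifier_ge0.
move=> /(ae_eq_integral_abs leb3 measurableT mm)[N [mN N0 subN]].
have : (leb3 (cube (e / 2)) <= leb3 N)%E.
  apply: le_measure; rewrite ?inE//; first exact: measurable_cube.
  move=> x cx; apply: subN => /= /(_ I)[] /eqP; rewrite gt_eqF//.
  have lt2 : e / 2 < e by lra.
  have /cubeE[c1 c2 c3] := cx.
  by rewrite /mollifier /tensor !mulr_gt0//; apply: bump1_gt0 => //; apply: le_lt_trans lt2.
rewrite N0 leNgt => /negP; apply.
have e2 : - (e / 2) < e / 2 by lra.
rewrite leb3_box// !lebesgue_measure_itv/= lte_fin e2 -!EFinB -!EFinM lte_fin.
by rewrite !mulr_gt0//; lra.
Qed.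

Lemma measurable_add3 :
  measurable_fun setT ((fun z : R3 R * R3 R => z.1 + z.2) : E R * E R -> E R).
Proof.
have m1 (i : E R -> R) : mf3 i ->
    measurable_fun setT (fun z : E R * E R => i z.1 + i z.2).
  move=> mi; apply: measurable_funD; apply: (measurableT_comp mi).
    exact: measurable_fst.
  exact: measurable_snd.
apply: measurable_fun_pair; last exact: (m1 _ measurable_x3).
by apply: measurable_fun_pair; [exact: (m1 _ measurable_x1)|exact: (m1 _ measurable_x2)].
Qed.

Lemma leb3_fubini_tonelli (F : R3 R * R3 R -> \bar R) :
  measurable_fun (setT : set (E R * E R)) F -> (forall z, 0 <= F z)%E ->
  (\int[leb3]_x \int[leb3]_y F (x, y) = \int[leb3]_y \int[leb3]_x F (x, y))%E.
Proof. by move=> mF F0; exact: (@fubini_tonelli _ _ _ _ R leb3_sf leb3_sf). Qed.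

Lemma measurable_leb3_integral2 (F : R3 R * R3 R -> \bar R) :
  measurable_fun (setT : set (E R * E R)) F -> (forall z, 0 <= F z)%E ->
  measurable_fun (setT : set (E R)) (fun x : R3 R => \int[leb3]_y F (x, y))%E.
Proof. by move=> mF F0; exact: (@measurable_fun_fubini_tonelli_F _ _ _ _ R leb3_sf F). Qed.

Lemma measurable_leb3_integral1 (F : R3 R * R3 R -> \bar R) :
  measurable_fun (setT : set (E R * E R)) F -> (forall z, 0 <= F z)%E ->
  measurable_fun (setT : set (E R)) (fun y : R3 R => \int[leb3]_x F (x, y))%E.
Proof. by move=> mF F0; exact: (@measurable_fun_fubini_tonelli_G _ _ _ _ R leb3_sf F). Qed.

Section mollifier_test.
Variables (f : R3 R -> R) (lf : loc1 f).
Hypothesis f0 : forall a e, 0 < e -> \int[leb3]_x (f x * mollifier e (x - a)) = 0.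

Let osc e x : \bar R := (\int[leb3]_y (`|f (x + y) - f x| * mollifier e y)%:E)%E.

(** The integral of f(x + y) against the mollifier vanishes, so f(x) times the mass of the mollifier
    is, up to sign, the integral of f(x + y) - f(x) against it. *)
Lemma mollifier_pointwise e x : 0 < e ->
  ((\int[leb3]_y (mollifier e y)%:E) * `|f x|%:E <= osc e x)%E.
Proof.
move=> e0; have bm := bounded_support_mollifier e0.
have lfx : loc1 (fun y => f (x + y)).
  by under eq_fun do rewrite addrC; exact: loc1_translate.
have H0 : \int[leb3]_y (f (x + y) * mollifier e y) = 0.
  have m : mf3 (fun y => f y * mollifier e (y - x)).
    apply: measurable_funM; first by case: lf.
    by apply: measurable_comp_translate; case: bm.
  have := Rintegral_translate x m; rewrite (f0 x e0) => <-.
  by apply: eq_Rintegral => y _; rewrite addrK addrC.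
have i1 := integrable_loc1_bounded_support lfx bm.
have i2 := integrable_loc1_bounded_support (loc1_cst (f x)) bm.
have i3 := integrable_loc1_bounded_support (loc1B lfx (loc1_cst (f x))) bm.
have E1 : \int[leb3]_y ((f (x + y) - f x) * mollifier e y) =
    - (f x * \int[leb3]_y mollifier e y).
  under eq_Rintegral do rewrite mulrBl.
  rewrite RintegralB// H0 sub0r RintegralZl//; exact: mollifier_integrable.
have fin : (\int[leb3]_y (mollifier e y)%:E \is a fin_num)%E.
  by apply: integrable_fin_num => //; exact: mollifier_integrable.
rewrite -(fineK fin) -EFinM.
have -> : fine (\int[leb3]_y (mollifier e y)%:E) * `|f x| =
    `| \int[leb3]_y ((f (x + y) - f x) * mollifier e y) |.
  have I0 : 0 <= \int[leb3]_y mollifier e y.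
    by apply: Rintegral_ge0 => y _; exact: mollifier_ge0.
  by rewrite E1 normrN normrM (ger0_norm I0) mulrC.
rewrite EFin_normr_Rintegral//.
apply: le_trans (le_abse_integral _ _ _) _ => //.
  by case/integrableP: i3.
rewrite le_eqVlt; apply/orP; left; apply/eqP; apply: eq_integral => y _.
by rewrite /= normrM (ger0_norm (mollifier_ge0 _ _)).
Qed.

(** Exchanging the integrals turns the left-hand side into an average, over shifts [y] in the
    support of the mollifier, of the L^1 translation differences bounded by [d]. *)
Lemma mollifier_osc_int (r : R) (d e : R) : 0 < e ->
  (forall h, cube e h -> (L1cube r (fun x => f (x + h) - f x)%R <= d%:E)%E) ->
  (\int[leb3]_(x in cube r) osc e x <= d%:E * \int[leb3]_y (mollifier e y)%:E)%E.
Proof.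
move=> e0 hd; have [mf _] := lf; have [mm _] := bounded_support_mollifier e0.
have mc := @measurable_cube R r.
pose F (z : R3 R * R3 R) : \bar R :=
  (\1_(cube r) z.1 * (`|f (z.1 + z.2) - f z.1| * mollifier e z.2))%:E.
have mF : measurable_fun (setT : set (E R * E R)) F.
  apply/measurable_EFinP; apply: measurable_funM.
    have m1 : mf3 (\1_(cube r) : R3 R -> R) by exact: measurable_indic.
    exact: (measurableT_comp m1 measurable_fst).
  apply: measurable_funM; last exact: (measurableT_comp mm measurable_snd).
  apply: measurableT_comp => //; apply: measurable_funB.
    exact: (measurableT_comp mf measurable_add3).
  exact: (measurableT_comp mf measurable_fst).
have F0 z : (0 <= F z)%E.
  rewrite lee_fin; apply: mulr_ge0 => //; apply: mulr_ge0 => //.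
  exact: mollifier_ge0.
have -> : (\int[leb3]_(x in cube r) osc e x = \int[leb3]_x \int[leb3]_y F (x, y))%E.
  rewrite integral_mkcond; apply: eq_integral => x _; rewrite /patch.
  case: ifPn => cx.
    by apply: eq_integral => y _; rewrite /F/= indicE cx mul1r.
  by rewrite integral0_eq// => y _; rewrite /F/= indicE (negbTE cx) mul0r.
rewrite leb3_fubini_tonelli//.
have mmE : measurable_fun (setT : set (E R)) (fun y : R3 R => (mollifier e y)%:E).
  exact/measurable_EFinP.
have d0 : (0 <= d%:E)%E.
  apply: le_trans (hd 0 _); first exact: L1cube_ge0.
  by apply/cubeE; rewrite /= normr0 ltW.
rewrite -ge0_integralZl//; last by move=> y _; rewrite lee_fin mollifier_ge0.
apply: ge0_le_integral => //.
- by move=> y _; exact: integral_ge0.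
- exact: measurable_leb3_integral1.
- exact: measurable_funeM.
move=> y _; have [cy|cy] := pselect (cube e y); last first.
  rewrite (mollifier_supp e0 cy) mule0 integral0_eq// => x _.
  by rewrite /F/= (mollifier_supp e0 cy) !mulr0.
apply: le_trans (lee_wpmul2r _ (hd y cy)); last by rewrite lee_fin mollifier_ge0.
rewrite /L1cube -ge0_integralZr//; last 2 first.
- by apply: measurable_abs_cube; apply: measurable_funB => //; exact: measurable_comp_translate.
- by rewrite lee_fin mollifier_ge0.
rewrite [leRHS]integral_mkcond le_eqVlt; apply/orP; left; apply/eqP.
apply: eq_integral => x _; rewrite /patch /F/= indicE.
by case: ifPn => cx; rewrite ?mul1r ?mul0r.
Qed.

(** Continuity of translations in L^1 supplies, for each [d], a scale at which the two preceding
    estimates bound the L^1 norm on the cube by [d], once the mass of the mollifier is cancelled. *)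
Lemma fundamental_lemma : {ae leb3, forall x : R3 R, f x = 0}.
Proof.
have [mf Lf] := lf; apply: L1cube_eq0 => // n.
apply/eqP; rewrite eq_le L1cube_ge0 andbT.
apply/lee_addgt0Pr => d d0; rewrite add0e.
have [e e0 hd] := translation_continuous_L1 mf Lf n%:R d0.
have m0 := mollifier_int_gt0 e0.
have fin : (\int[leb3]_y (mollifier e y)%:E \is a fin_num)%E.
  by apply: integrable_fin_num => //; exact: mollifier_integrable.
have := mollifier_osc_int e0 hd.
have mc := @measurable_cube R n%:R.
have le : (\int[leb3]_(x in cube n%:R) ((\int[leb3]_y (mollifier e y)%:E) * `|f x|%:E)
    <= \int[leb3]_(x in cube n%:R) osc e x)%E.
  apply: ge0_le_integral => //.
  - by move=> x _; rewrite mule_ge0 ?lee_fin// ltW.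
  - by apply: emeasurable_funM => //; exact: measurable_abs_cube.
  - apply: measurable_funTS; rewrite /osc.
    have [mm _] := bounded_support_mollifier e0.
    apply: (@measurable_leb3_integral2
      (fun z : R3 R * R3 R => (`|f (z.1 + z.2) - f z.1| * mollifier e z.2)%:E)).
    + apply/measurable_EFinP; apply: measurable_funM; last exact: (measurableT_comp mm measurable_snd).
      apply: measurableT_comp => //; apply: measurable_funB.
        exact: (measurableT_comp mf measurable_add3).
      exact: (measurableT_comp mf measurable_fst).
    + by move=> z; rewrite lee_fin mulr_ge0// mollifier_ge0.
  - by move=> x _; exact: mollifier_pointwise.
move=> /(le_trans le); rewrite ge0_integralZl//; last 2 first.
- exact: measurable_abs_cube.
- exact: ltW.
by rewrite -/(L1cube n%:R f) muleC lee_pmul2r.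
Qed.
End mollifier_test.
End LocallyIntegrable.

(** * Weak derivatives *)

Section TestFunctions.
Context {R : realType}.
Implicit Types (x y v a : R3 R) (f g h p : R3 R -> R) (j : 'I_3).

Notation mf3 f := (measurable_fun (setT : set (E R)) (f : E R -> R)).

Lemma continuous_bounded_support p r : continuous p ->
  (forall x, ~ cube r x -> p x = 0) -> bounded_support p.
Proof.
move=> cp pr; split; first exact: continuous_measurable3.
have : compact (p @` (cube r : set (R3 R))).
  by apply: continuous_compact; [exact: continuous_subspaceT|exact: compact_cube].
move=> /compact_bounded[M [_ /(_ (M + 1))]]; rewrite ltrDl ltr01 => /(_ isT) pM.
exists r, (`|M| + 1); split=> // x.
have [cx|/pr->] := pselect (cube r x); last by rewrite normr0 addr_ge0.
apply: (@le_trans _ _ (M + 1)); last by rewrite lerD2r ler_norm.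
by apply: pM; exists x.
Qed.

Lemma test_function_supp p : test_function p -> exists r,
  forall x, ~ cube r x -> p x = 0 /\ forall j, 'D_(stdbasis j) p x = 0.
Proof.
move=> [_ /compact_sub_cube[r Kr]]; exists r => x cx.
have xK : (~` closure [set x | p x != 0]) x by move=> /Kr.
have : nbhs x (~` closure [set x | p x != 0]).
  by apply: open_nbhs_nbhs; split=> //; apply: closed_openC; exact: closed_closure.
move=> nx; have nx0 : \forall y \near x, p y = 0.
  apply: filterS nx => y yK; apply/eqP/negPn/negP => py; apply: yK.
  exact: subset_closure.
split; first by have := nbhs_singleton nx0.
move=> j; have e0 : stdbasis j != 0 :> R3 R.
  apply/eqP => /(congr1 (fun z : R3 R => (z.1.1, z.1.2, z.2))) [].
  by case: j => -[|[|[|//]]] jlt /=; move=> /eqP; rewrite ?oner_eq0// => _ /eqP;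
    rewrite ?oner_eq0// => _ /eqP; rewrite ?oner_eq0.
rewrite (@near_eq_derive _ _ _ p (cst 0))//; exact: derive_cst.
Qed.

Lemma test_function_bounded p : test_function p -> bounded_support p.
Proof.
move=> tp; have [r pr] := test_function_supp tp.
by apply: (@continuous_bounded_support _ r) => [|x /pr[]//]; have [/(_ [::])[]] := tp.
Qed.

Lemma test_function_derive_continuous p j : test_function p ->
  continuous (fun x => 'D_(stdbasis j) p x).
Proof. by move=> [/(_ [:: j])[]]. Qed.

Lemma test_function_derivable p j x : test_function p -> derivable p x (stdbasis j).
Proof. by move=> [/(_ [::])[_ ]]. Qed.

Lemma test_function_derive_bounded p j : test_function p ->
  bounded_support (fun x => 'D_(stdbasis j) p x).
Proof.
move=> tp; have [r pr] := test_function_supp tp.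
apply: (@continuous_bounded_support _ r) => [|x /pr[]//].
exact: test_function_derive_continuous.
Qed.

Let quotient_translate (p : R3 R -> R) v u x :
  (fun t : R => t^-1 *: (p (t *: u + x + v) - p (x + v))) =
  (fun t : R => t^-1 *: (p (t *: u + (x + v)) - p (x + v))).
Proof. by apply/funext => t; rewrite addrA. Qed.

Lemma derive_translate (p : R3 R -> R) v u x :
  'D_u (fun y => p (y + v)) x = 'D_u p (x + v).
Proof.
by rewrite /derive /= quotient_translate.
Qed.

Lemma partials_translate s p v :
  partials s (fun x => p (x + v)) = fun x => partials s p (x + v).
Proof.
elim: s => [//|j s IH] /=; rewrite -/(partials s _) IH.
by apply/funext => x; rewrite derive_translate.
Qed.

Lemma continuous_translate p v : continuous p -> continuous (fun x => p (x + v)).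
Proof.
move=> cp x; apply: continuous_comp; last exact: cp.
by apply: cvgD => //; exact: cvg_cst.
Qed.

Lemma test_function_translate p v : test_function p -> test_function (fun x => p (x + v)).
Proof.
move=> tp; have [r pr] := test_function_supp tp; have [sp _] := tp; split.
  move=> s; rewrite partials_translate; have [c d] := sp s; split.
    exact: continuous_translate.
  by move=> j x; have := d j (x + v); rewrite /derivable /= quotient_translate.
apply: (@subclosed_compact (R3 R) _ (cube (r + `|v|))); first exact: closed_closure.
  exact: compact_cube.
rewrite [X in _ `<=` X](closure_id _).1; last first.
  by apply: compact_closed; [exact: hausdorff3|exact: compact_cube].
apply: closureS => x /= px; have [cx|cx] := pselect (cube r (x + v)).
  by rewrite -(addrK v x); apply: cubeD => //; apply/cubeN; exact: cube_normr.
by move: px; rewrite (pr _ cx).1 eqxx.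
Qed.

Lemma test_function_mollifier e a : 0 < e -> test_function (fun x => mollifier e (x - a)).
Proof.
move=> e0; apply: (@test_function_translate _ (- a)).
by apply: (@test_function_tensor _ _ _ _ e) => [|||t /ltW te];
  [exact: smooth1_bump1..|rewrite !bump1_supp].
Qed.

Lemma is_wderiv_unique j f h h' : loc1 h -> loc1 h' ->
  is_wderiv j f h -> is_wderiv j f h' -> {ae leb3, forall x : R3 R, h x = h' x}.
Proof.
move=> lh lh' wh wh'.
have : {ae leb3, forall x : R3 R, h x - h' x = 0}.
  apply: fundamental_lemma; first exact: loc1B.
  move=> a e e0; have tm := test_function_mollifier a e0.
  have bm := test_function_bounded tm.
  under eq_Rintegral do rewrite mulrBl.
  rewrite RintegralB//; try exact: integrable_loc1_bounded_support.
  by apply/eqP; rewrite subr_eq0 -eqr_opp -wh// -wh'.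
by apply: ae3S => x /eqP; rewrite subr_eq0 => /eqP.
Qed.

Lemma is_wderivD j f g h k : loc1 f -> loc1 g -> loc1 h -> loc1 k ->
  is_wderiv j f h -> is_wderiv j g k -> is_wderiv j (fun x => f x + g x) (fun x => h x + k x).
Proof.
move=> lf lg lh lk wf wg p tp.
have bp := test_function_bounded tp; have bd := test_function_derive_bounded j tp.
under eq_Rintegral do rewrite mulrDl.
rewrite RintegralD//; try exact: integrable_loc1_bounded_support.
under [in RHS]eq_Rintegral do rewrite mulrDl.
rewrite RintegralD//; try exact: integrable_loc1_bounded_support.
by rewrite wf// wg// opprD.
Qed.

Lemma is_wderivZ j c f h : loc1 f -> loc1 h ->
  is_wderiv j f h -> is_wderiv j (fun x => c * f x) (fun x => c * h x).
Proof.
move=> lf lh wf p tp.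
have bp := test_function_bounded tp; have bd := test_function_derive_bounded j tp.
under eq_Rintegral do rewrite -mulrA.
rewrite RintegralZl//; last exact: integrable_loc1_bounded_support.
under [in RHS]eq_Rintegral do rewrite -mulrA.
rewrite RintegralZl//; last exact: integrable_loc1_bounded_support.
by rewrite wf// mulrN.
Qed.

Lemma is_wderivB j f g h k : loc1 f -> loc1 g -> loc1 h -> loc1 k ->
  is_wderiv j f h -> is_wderiv j g k -> is_wderiv j (fun x => f x - g x) (fun x => h x - k x).
Proof.
move=> lf lg lh lk wf wg.
have := is_wderivD lf (loc1Z (-1) lg) lh (loc1Z (-1) lk) wf (is_wderivZ (-1) lg lk wg).
have E (u u' : R3 R -> R) : (fun x => u x + -1 * u' x) = (fun x => u x - u' x).
  by apply/funext => x; rewrite mulN1r.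
by rewrite !E.
Qed.

Lemma Rintegral_ae_eq f g : mf3 f -> mf3 g ->
  {ae leb3, forall x : R3 R, f x = g x} -> \int[leb3]_x f x = \int[leb3]_x g x.
Proof.
move=> mf mg fg; congr fine; apply: ae_eq_integral => //.
- exact/measurable_EFinP.
- exact/measurable_EFinP.
- by apply: ae3S fg => x ->.
Qed.

Lemma is_wderiv_ae j f f' h h' : mf3 f -> mf3 f' -> mf3 h -> mf3 h' ->
  {ae leb3, forall x : R3 R, f x = f' x} -> {ae leb3, forall x : R3 R, h x = h' x} ->
  is_wderiv j f h -> is_wderiv j f' h'.
Proof.
move=> mf mf' mh mh' ff' hh' wf p tp.
have [mp _] := test_function_bounded tp.
have [md _] := test_function_derive_bounded j tp.
rewrite -(@Rintegral_ae_eq (fun x => f x * 'D_(stdbasis j) p x)); first last.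
- by apply: ae3S ff' => x ->.
- exact: measurable_funM.
- exact: measurable_funM.
rewrite wf//; congr (- _); apply: Rintegral_ae_eq.
- exact: measurable_funM.
- exact: measurable_funM.
- by apply: ae3S hh' => x ->.
Qed.

Lemma is_wderiv_translate j f h v : mf3 f -> mf3 h ->
  is_wderiv j f h -> is_wderiv j (fun x => f (x + v)) (fun x => h (x + v)).
Proof.
move=> mf mh wf p tp; have tp' := test_function_translate (- v) tp.
have [mp _] := test_function_bounded tp'.
have [md _] := test_function_derive_bounded j tp'.
have E1 := Rintegral_translate v (measurable_funM mf md).
have E2 := Rintegral_translate v (measurable_funM mh mp).
transitivity (\int[leb3]_x (f (x + v) * 'D_(stdbasis j) (fun x0 => p (x0 - v)) (x + v))).
  by apply: eq_Rintegral => x _; rewrite derive_translate addrK.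
rewrite E1 (wf _ tp'); congr (- _); apply: etrans (esym E2) _.
by apply: eq_Rintegral => x _ /=; rewrite addrK.
Qed.

End TestFunctions.

(** * Integrals against translated test functions *)

Section DerivativeOfConvolution.
Context {R : realType}.
Implicit Types (x y v a : R3 R) (f g h p : R3 R -> R) (j : 'I_3).

Notation mf3 f := (measurable_fun (setT : set (E R)) (f : E R -> R)).
Notation e_ j := (stdbasis j : R3 R).

Lemma cube_stdbasis j (s : R) : cube `|s| (s *: e_ j).
Proof.
apply/cubeE; rewrite /stdbasis /=.
by case: j => -[|[|[|//]]] /= _; rewrite ?scaler0 ?normr0;
  split; rewrite // [_ *: 1]mulr1.
Qed.

Lemma is_derive_line_test p j x (s : R) : test_function p ->
  is_derive s (1 : R) (fun t => p (x + t *: e_ j)) ('D_(e_ j) p (x + s *: e_ j)).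
Proof.
move=> tp; have d : is_derive (s *: e_ j + x) (e_ j) p ('D_(e_ j) p (s *: e_ j + x)).
  by apply: DeriveDef => //; exact: test_function_derivable.
have /is_derive_line := d; rewrite addrC; congr is_derive.
by apply/funext => t; rewrite addrC.
Qed.

(** Differentiation under the integral sign. For [s] within 1 of [a] the shifted supports stay in
    one cube, where |f| times a bound of the derivative of [p] dominates. *)
Lemma cvg_derivative_convolution f p j (a : R) : loc1 f -> test_function p ->
  is_derive a (1 : R) (fun s => \int[leb3]_x (f x * p (x + s *: e_ j)))
    (\int[leb3]_x (f x * 'D_(e_ j) p (x + a *: e_ j))).
Proof.
move=> lf tp; have bp := test_function_bounded tp.
have bd := test_function_derive_bounded j tp.
pose k (s : R) x := f x * p (x + s *: e_ j).
have dk s x : is_derive s (1 : R) (k ^~ x) (f x * 'D_(e_ j) p (x + s *: e_ j)).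
  exact: is_deriveZ (is_derive_line_test j x s tp).
have [md [r [M [dM dr]]]] := bd.
pose c : R3 R -> R := fun x => M * \1_(cube (r + (`|a| + 1))) x.
have M0 : 0 <= M by apply: le_trans (dM 0).
have bc : bounded_support c.
  split; first by apply: measurable_funM => //; apply: measurable_indic; exact: measurable_cube.
  exists (r + (`|a| + 1)), M; split => x.
    by rewrite /c normrM ger0_norm// ler_piMr// indicE; case: (_ \in _); rewrite ?normr1 ?normr0.
  by move=> cx; rewrite /c indicE memNset// mulr0.
pose G x := `|f x| * c x.
have lfn : loc1 (fun x => `|f x|).
  have [mf Lf] := lf; split; first exact: measurableT_comp.
  by move=> s; have := Lf s; rewrite /L1cube; under [X in _ -> (X < _)%E]eq_integral do rewrite normr_id.
have := @cvg_differentiation_under_integral R _ (E R) leb3 k setT measurableT a (a - 1) (a + 1).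
have Ia : `]a - 1, a + 1[%classic a by rewrite /= in_itv/=; apply/andP; split; lra.
move=> /(_ Ia) H; have {}H := H _ _ G _ _ _.
have cv : (h : R)^-1 *: (\int[leb3]_x k (h + a) x - \int[leb3]_x k a x) @[h --> 0^']
    --> \int[leb3]_x partial1of2 k a x.
  apply: H.
  - move=> s _; apply: integrable_loc1_bounded_support => //.
    exact: bounded_support_translate.
  - by move=> s x _ _; case: (dk s x).
  - by move=> x; rewrite /G mulr_ge0// /c mulr_ge0.
  - exact: integrable_loc1_bounded_support.
  - move=> s x /=; rewrite in_itv/= => /andP[s1 s2] _.
    rewrite partial1of2E; have [_ ->] := dk s x.
    rewrite normrM /G /c ler_wpM2l// indicE.
    have [cx|cx] := pselect (cube (r + (`|a| + 1)) x); first by rewrite mem_set// mulr1.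
    rewrite memNset// mulr0 dr ?normr0// => cxs; apply: cx.
    rewrite -(addrK (s *: e_ j) x); apply: cubeD => //; apply/cubeN.
    apply: sub_cube (cube_stdbasis j s).
    rewrite (_ : s = a + (s - a)) ?(le_trans (ler_normD _ _))//; last lra.
    by rewrite lerD2l ler_norml; apply/andP; split; lra.
have E0 : \int[leb3]_x partial1of2 k a x = \int[leb3]_x (f x * 'D_(e_ j) p (x + a *: e_ j)).
  by apply: eq_Rintegral => x _; rewrite partial1of2E; have [_ ->] := dk a x.
rewrite E0 in cv; apply: DeriveDef; last first.
  by rewrite /derive /=; under eq_fun do rewrite [_ *: 1]mulr1; exact: cvg_lim cv.
apply/cvg_ex; eexists; rewrite /=; under eq_fun do rewrite [_ *: 1]mulr1; exact: cv.
Qed.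

(** By translation invariance the integral of c p(x + s e_j) does not depend on [s], so its
    derivative at 0 vanishes. *)
Lemma is_wderiv_cst j (c : R) : is_wderiv j (fun=> c) (fun=> 0).
Proof.
move=> p tp; have bp := test_function_bounded tp.
have [_ /esym] := cvg_derivative_convolution j 0 (loc1_cst c) tp.
have -> : (fun s : R => \int[leb3]_x (c * p (x + s *: e_ j))) =
          cst (\int[leb3]_x (c * p x)).
  apply/funext => s; apply: (@Rintegral_translate R (s *: e_ j) (fun x => c * p x)).
  by apply: measurable_funM => //; case: bp.
rewrite derive_cst scale0r => H.
under [in RHS]eq_Rintegral do rewrite mul0r.
rewrite Rintegral_cst// mul0r oppr0 -[RHS]H.
by apply: eq_Rintegral => x _; rewrite addr0.
Qed.

Definition coord3 (i : 'I_3) x : R := posvec x i 0.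

Lemma coord3_line i j x (s : R) : coord3 i (x + s *: e_ j) = coord3 i x + s * (i == j)%:R.
Proof.
rewrite /coord3 /posvec !mxE -(inj_eq val_inj).
by case: i => -[|[|[|//]]] ilt; case: j => -[|[|[|//]]] jlt.
Qed.

Lemma continuous_coord3 i : continuous (coord3 i).
Proof.
have -> : coord3 i = fun x => [:: x.1.1; x.1.2; x.2]`_i.
  by apply/funext => x; rewrite /coord3 /posvec mxE.
move=> x; case: i => -[|[|[|//]]] ilt /=.
- by apply: (cvg_comp _ _ cvg_fst); exact: cvg_fst.
- by apply: (cvg_comp _ _ cvg_fst); exact: cvg_snd.
- exact: cvg_snd.
Qed.

Lemma coord3_bounded i r x : cube r x -> `|coord3 i x| <= r.
Proof.
by move=> /cubeE[? ? ?]; rewrite /coord3 /posvec mxE; case: i => -[|[|[|//]]].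
Qed.

Lemma continuous_loc1 f : continuous f -> loc1 f.
Proof.
move=> cf; split=> [|r]; first exact: continuous_measurable3.
have : compact (f @` (cube r : set (R3 R))).
  by apply: continuous_compact; [exact: continuous_subspaceT|exact: compact_cube].
move=> /compact_bounded[M [_ /(_ (M + 1))]]; rewrite ltrDl ltr01 => /(_ isT) fM.
have [_ /(_ r)] := loc1_cst (`|M| + 1); apply: le_lt_trans.
apply: ge0_le_integral => //.
- exact: measurable_cube.
- by apply: measurable_abs_cube; exact: continuous_measurable3.
- move=> x cx; rewrite lee_fin (ger0_norm (addr_ge0 _ _))//.
  apply: (@le_trans _ _ (M + 1)); last by rewrite lerD2r ler_norm.
  by apply: fM; exists x.
Qed.

(** Moving the shift from [p] to the coordinate shows that the integral of x_i p(x + s e_j) is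
    affine in [s]; its slope is compared with the derivative under the integral at 0. *)
Lemma is_wderiv_coord i j : is_wderiv j (coord3 i) (fun=> (i == j)%:R).
Proof.
move=> p tp; have bp := test_function_bounded tp; have [mp _] := bp.
have lc := continuous_loc1 (@continuous_coord3 i).
have [_] := cvg_derivative_convolution j 0 lc tp.
set I := \int[leb3]_x p x; set d := (i == j)%:R.
have -> : (fun s : R => \int[leb3]_x (coord3 i x * p (x + s *: e_ j))) =
          (fun s : R => \int[leb3]_x (coord3 i x * p x) - s * (d * I)).
  apply/funext => s.
  have m1 : mf3 (fun x => coord3 i (x - s *: e_ j) * p x).
    apply: measurable_funM => //.
    apply: (@measurable_comp_translate R (coord3 i) (- (s *: e_ j))).
    apply: continuous_measurable3; exact: continuous_coord3.
  transitivity (\int[leb3]_x (coord3 i (x - s *: e_ j) * p x)).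
    apply: etrans (Rintegral_translate (s *: e_ j) m1).
    by apply: eq_Rintegral => x _; rewrite addrK.
  transitivity (\int[leb3]_x (coord3 i x * p x - (s * d) * p x)).
    by apply: eq_Rintegral => x _; rewrite -scaleNr coord3_line -/d; ring.
  rewrite RintegralB//; last 2 first.
  - exact: integrable_loc1_bounded_support.
  - exact: (integrable_loc1_bounded_support (loc1_cst _)).
  rewrite RintegralZl ?mulrA//.
  have := integrable_loc1_bounded_support (loc1_cst 1) bp.
  by apply: eq_integrable => // x _ /=; rewrite mul1r.
have -> : 'D_1 (fun s : R => \int[leb3]_x (coord3 i x * p x) - s * (d * I)) 0 = - (d * I).
  have dd : is_derive (0 : R) (1 : R)
      (cst (\int[leb3]_x (coord3 i x * p x)) - (d * I) *: (id : R -> R)) (0 - (d * I) *: 1).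
    exact: is_deriveB.
  have -> : (fun s : R => \int[leb3]_x (coord3 i x * p x) - s * (d * I)) =
      cst (\int[leb3]_x (coord3 i x * p x)) - (d * I) *: (id : R -> R).
    by apply/funext => s; rewrite !fctE /GRing.scale/= mulrC.
  by have [_ ->] := dd; rewrite sub0r [(d * I)%:A]mulr1.
under [in X in _ = X -> _]eq_Rintegral do rewrite scale0r addr0.
move=> <-; rewrite RintegralZl//.
have := integrable_loc1_bounded_support (loc1_cst 1) bp.
by apply: eq_integrable => // x _ /=; rewrite mul1r.
Qed.

End DerivativeOfConvolution.

(** * Integrals along coordinate segments *)

Section LineIntegrals.
Context {R : realType}.
Implicit Types (x y a : R3 R) (f w p : R3 R -> R) (j : 'I_3) (t s r : R).

Notation mf3 f := (measurable_fun (setT : set (E R)) (f : E R -> R)).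
Notation e_ j := (stdbasis j : R3 R).
Notation mu1 := (@lebesgue_measure R).
Notation E1 := (E R * measurableTypeR R)%type.

Lemma measurable_line j :
  measurable_fun setT ((fun z : R3 R * R => z.1 - z.2 *: e_ j) : E1 -> E R).
Proof.
have m1 (i : E R -> R) c : mf3 i ->
    measurable_fun setT (fun z : E1 => i z.1 - (z.2 : R) * c).
  move=> mi; apply: measurable_funB; first exact: (measurableT_comp mi measurable_fst).
  by apply: measurable_funM => //; exact: measurable_snd.
apply: measurable_fun_pair; last exact: (m1 _ _ measurable_x3).
by apply: measurable_fun_pair; [exact: (m1 _ _ measurable_x1)|exact: (m1 _ _ measurable_x2)].
Qed.

Section tonelli.
Variables (k : R3 R * R -> R) (D : set (R3 R)) (t : R).
Hypothesis mk : measurable_fun (setT : set E1) (k : E1 -> R).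
Hypothesis k0 : forall z, 0 <= k z.
Hypothesis mD : measurable (D : set (E R)).

Let K (z : R3 R * R) : \bar R := (k z * \1_D z.1 * \1_(`[0, t]%classic : set R) z.2)%:E.

Let mK : measurable_fun (setT : set E1) K.
Proof.
apply/measurable_EFinP; apply: measurable_funM; first apply: measurable_funM => //.
- have m1 : mf3 (\1_D : R3 R -> R) by exact: measurable_indic.
  exact: (measurableT_comp m1 measurable_fst).
- have m1 : measurable_fun (setT : set (measurableTypeR R))
    (\1_(`[0, t]%classic : set R) : measurableTypeR R -> R).
    exact: measurable_indic.
  exact: (measurableT_comp m1 measurable_snd).
Qed.

Let K0 z : (0 <= K z)%E.
Proof. by rewrite lee_fin !mulr_ge0. Qed.

Lemma tonelli_line :
  (\int[leb3]_(x in D) \int[mu1]_(s in `[0%R, t]) (k (x, s))%:E =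
   \int[mu1]_(s in `[0%R, t]) \int[leb3]_(x in D) (k (x, s))%:E)%E.
Proof.
have H := @fubini_tonelli _ _ _ _ R leb3_sf mu1 K mK K0.
transitivity (\int[leb3]_x \int[mu1]_s K (x, s))%E.
  rewrite integral_mkcond; apply: eq_integral => x _; rewrite /patch.
  case: ifPn => xD; last first.
    by rewrite integral0_eq// => s _; rewrite /K/= indicE (negbTE xD) mulr0 mul0r.
  rewrite integral_mkcond; apply: eq_integral => s _; rewrite /patch /K/= !indicE xD mulr1.
  by case: ifPn => _; rewrite ?mulr1 ?mulr0.
transitivity (\int[mu1]_s \int[leb3]_x K (x, s))%E; first exact: H.
rewrite [RHS]integral_mkcond; apply: eq_integral => s _; rewrite /patch.
case: ifPn => st; last first.
  by rewrite integral0_eq// => x _; rewrite /K/= !indicE (negbTE st) mulr0.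
rewrite [RHS]integral_mkcond; apply: eq_integral => x _; rewrite /patch /K/= !indicE st mulr1.
by case: ifPn => _; rewrite ?mulr1 ?mulr0.
Qed.

Lemma measurable_tonelli_line :
  measurable_fun (D : set (E R)) (fun x => \int[mu1]_(s in `[0%R, t]) (k (x, s))%:E)%E.
Proof.
have : measurable_fun (setT : set (E R)) (fun x : R3 R => \int[mu1]_s K (x, s))%E.
  exact: (@measurable_fun_fubini_tonelli_F _ _ _ _ R mu1 K).
move=> /(measurable_funTS (D := D : set (E R))).
apply: eq_measurable_fun => x xD.
rewrite [RHS]integral_mkcond; apply: eq_integral => s _; rewrite /patch /K/= !indicE xD mulr1.
by case: ifPn => _; rewrite ?mulr1 ?mulr0.
Qed.

Lemma measurable_tonelli_slice :
  measurable_fun (setT : set (measurableTypeR R))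
    (fun s : R => \int[leb3]_(x in D) (k (x, s) * \1_(`[0%R, t]%classic : set R) s)%:E)%E.
Proof.
have : measurable_fun (setT : set (measurableTypeR R)) (fun s : R => \int[leb3]_x K (x, s))%E.
  exact: (@measurable_fun_fubini_tonelli_G _ _ _ _ R leb3_sf K).
congr measurable_fun; apply/funext => s.
rewrite [RHS]integral_mkcond; apply: eq_integral => x _; rewrite /patch /K/= !indicE.
by case: ifPn => _; rewrite ?mulr1 ?mulr0 ?mul0r.
Qed.
End tonelli.

Lemma itv0t_measure t : 0 <= t -> mu1 `[0, t]%classic = t%:E.
Proof.
rewrite le_eqVlt => /predU1P[<-|t0]; first by rewrite set_itv1 lebesgue_measure_set1.
by rewrite lebesgue_measure_itv/= lte_fin t0 -EFinB subr0.
Qed.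

(** Cauchy-Schwarz against the constant 1. It is stated in the extended reals because on exceptional
    lines the right-hand side may be infinite. *)
Lemma jensen_itv (v : R -> R) t : 0 <= t ->
  measurable_fun (setT : set (measurableTypeR R)) v ->
  (((\int[mu1]_(s in `[0, t]) v s) ^+ 2)%:E <=
    t%:E * \int[mu1]_(s in `[0%R, t]) (v s ^+ 2)%:E)%E.
Proof.
move=> t0 mv.
have mI : measurable (`[0, t]%classic : set (measurableTypeR R)) by exact: measurable_itv.
have i0 : (0 <= \int[mu1]_(s in `[0%R, t]) (v s ^+ 2)%:E)%E.
  by apply: integral_ge0 => s _; rewrite lee_fin sqr_ge0.
move: t0; rewrite le_eqVlt => /predU1P[<-|t0].
  by rewrite set_itv1 Rintegral_set1 expr0n mul0e.
have [voo|] := boolP (\int[mu1]_(s in `[0%R, t]) (v s ^+ 2)%:E < +oo)%E; last first.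
  rewrite -leNgt leye_eq => /eqP ->; rewrite gt0_muley ?leey// lte_fin//.
have sv : sqint mu1 `[0, t]%classic v by split=> //; exact: measurable_funTS.
have s1 : sqint mu1 `[0, t]%classic (fun=> 1).
  split=> //; under eq_integral do rewrite expr1n.
  by rewrite integral_cst// mul1e [X in (X < _)%E](itv0t_measure (ltW t0)) ltry.
have := cauchy_schwarz mI sv s1.
have -> : dot mu1 `[0, t]%classic v (fun=> 1) = \int[mu1]_(s in `[0, t]) v s.
  by apply: eq_Rintegral => s _; rewrite mulr1.
have -> : dot mu1 `[0, t]%classic (fun=> 1) (fun=> 1) = t.
  rewrite /dot; under eq_Rintegral do rewrite mulr1.
  by rewrite Rintegral_cst// mul1r [X in fine X](itv0t_measure (ltW t0)).
by move=> h; rewrite -dot_sqr// -EFinM lee_fin mulrC.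
Qed.

Definition line_integral w j t x : R := \int[mu1]_(s in `[0, t]) w (x - s *: e_ j).

Lemma measurable_line_fun w j : mf3 w ->
  measurable_fun (setT : set E1) (fun z : E1 => w ((z.1 : R3 R) - (z.2 : R) *: e_ j)).
Proof. by move=> mw; exact: (measurableT_comp mw (measurable_line j)). Qed.

(** The positive and negative parts have measurable integrals by Tonelli, and [fine] is measurable;
    integrability along every line is not assumed. *)
Lemma measurable_line_integral (v : R3 R * R -> R) t :
  measurable_fun (setT : set E1) (v : E1 -> R) ->
  mf3 (fun x => \int[mu1]_(s in `[0, t]) v (x, s)).
Proof.
move=> mv; apply: (@measurableT_comp _ _ _ _ _ _ fine).
  by move=> _ B mB; rewrite setTI -[X in measurable X]setTI; exact: fine_measurable.
have mp : measurable_fun (setT : set E1) (fun z : E1 => Num.max (v z) 0).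
  exact: measurable_maxr.
have mn : measurable_fun (setT : set E1) (fun z : E1 => Num.max (- v z) 0).
  by apply: measurable_maxr => //; exact: measurable_funN.
rewrite (_ : (fun x => _) = fun x : E R => (\int[mu1]_(s in `[0%R, t]) (Num.max (v (x, s)) 0)%:E
    - \int[mu1]_(s in `[0%R, t]) (Num.max (- v (x, s)) 0)%:E)%E).
  apply: emeasurable_funB; apply: (@measurable_tonelli_line (fun z => _) setT) => //.
  - by move=> z; rewrite le_max lexx orbT.
  - by move=> z; rewrite le_max lexx orbT.
apply/funext => x; rewrite integralE; congr (_ - _)%E.
- by apply: eq_integral => s _; rewrite funeposE -EFin_max.
- by apply: eq_integral => s _; rewrite funenegE -EFinN -EFin_max.
Qed.

Lemma line_integral_sqr (v : R3 R * R -> R) (D : set (R3 R)) t : 0 <= t ->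
  measurable (D : set (E R)) -> measurable_fun (setT : set E1) (v : E1 -> R) ->
  (\int[leb3]_(x in D) ((\int[mu1]_(s in `[0, t]) v (x, s))%R ^+ 2)%:E <=
   t%:E * \int[mu1]_(s in `[0%R, t]) \int[leb3]_(x in D) (v (x, s) ^+ 2)%:E)%E.
Proof.
move=> t0 mD mv.
have mv2 : measurable_fun (setT : set E1) (fun z : E1 => v z ^+ 2) by exact: measurable_funX.
have v20 (z : R3 R * R) : 0 <= v z ^+ 2 by rewrite sqr_ge0.
rewrite -(tonelli_line t mv2 v20 mD).
rewrite -ge0_integralZl//; first last.
- by move=> x _; apply: integral_ge0 => s _; rewrite lee_fin sqr_ge0.
- exact: (@measurable_tonelli_line (fun z => v z ^+ 2)).
apply: ge0_le_integral => //.
- by move=> x _; rewrite lee_fin sqr_ge0.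
- apply/measurable_EFinP; apply: measurable_funX; apply: measurable_funTS.
  exact: measurable_line_integral.
- by apply: measurable_funeM; exact: (@measurable_tonelli_line (fun z => v z ^+ 2)).
move=> x _; apply: (@jensen_itv (fun s => v (x, s))) => //.
exact: (measurableT_comp mv (pair1_measurable x)).
Qed.

End LineIntegrals.

(** * Increments as line integrals of the weak derivative *)

Section DifferenceFormula.
Context {R : realType}.
Implicit Types (x y a : R3 R) (f w p : R3 R -> R) (j : 'I_3) (t s r : R).

Notation mf3 f := (measurable_fun (setT : set (E R)) (f : E R -> R)).
Notation e_ j := (stdbasis j : R3 R).
Notation mu1 := (@lebesgue_measure R).
Notation E1 := (E R * measurableTypeR R)%type.

Lemma L1cube_line w j t r s : mf3 w -> 0 <= s <= t ->
  (L1cube r (fun x => w (x - s *: e_ j)%R) <= L1cube (r + t) w)%E.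
Proof.
move=> mw /andP[s0 st]; have c : cube t (- (s *: e_ j)).
  apply/cubeN; apply: sub_cube (cube_stdbasis j s).
  by rewrite ger0_norm.
exact: L1cube_translate.
Qed.

Lemma loc1_line_integral w j t : 0 <= t -> loc1 w -> loc1 (line_integral w j t).
Proof.
move=> t0 [mw lw]; have mv := measurable_line_fun j mw.
have mL : mf3 (line_integral w j t).
  exact: (@measurable_line_integral _ (fun z => w (z.1 - z.2 *: e_ j)) t).
split=> // r; have mc := @measurable_cube R r.
pose k (z : R3 R * R) := `|w (z.1 - z.2 *: e_ j)|.
have mk : measurable_fun (setT : set E1) (k : E1 -> R) by exact: measurableT_comp.
have k0 z : 0 <= k z by exact: normr_ge0.
apply: (@le_lt_trans _ _ (\int[leb3]_(x in cube r) \int[mu1]_(s in `[0%R, t]) (k (x, s))%:E)%E).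
  apply: ge0_le_integral => //.
  - exact: measurable_abs_cube.
  - exact: measurable_tonelli_line.
  move=> x _; set I := (\int[mu1]_(s in `[0%R, t]) (w (x - s *: e_ j))%:E)%E.
  have le1 : (`|line_integral w j t x|%:E <= `|I|)%E.
    by rewrite /line_integral /Rintegral -/I; case: I => [z| |] /=; rewrite ?normr0 ?leey.
  apply: (le_trans le1); apply: le_trans (le_abse_integral _ _ _) _ => //.
  apply/measurable_EFinP; apply: measurable_funTS.
  exact: (measurableT_comp mv (pair1_measurable x)).
rewrite tonelli_line//.
apply: (@le_lt_trans _ _ (\int[mu1]_(s in `[0%R, t]) (L1cube (r + t) w))%E); last first.
  have mI : measurable (`[0, t]%classic : set (measurableTypeR R)) by exact: measurable_itv.
  rewrite integral_cst// [X in (_ * X < _)%E](itv0t_measure t0).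
  rewrite muleC; apply: lte_mul_pinfty; rewrite ?lee_fin//; exact: lw.
apply: ge0_le_integral => //.
- by move=> s _; apply: integral_ge0 => x _; rewrite lee_fin.
- have H := measurable_funTS (D := `[0, t]%classic : set (measurableTypeR R))
    (measurable_tonelli_slice t mk k0 mc).
  apply: eq_measurable_fun H => s st; apply: eq_integral => x _.
  by rewrite indicE st mulr1.
- move=> s /=; rewrite in_itv/= => st.
  exact: (@L1cube_line w j t r s).
Qed.

Lemma line_fubini w p j t : 0 <= t -> loc1 w -> bounded_support p ->
  \int[leb3]_x (line_integral w j t x * p x) =
  \int[mu1]_(s in `[0, t]) \int[leb3]_x (w (x - s *: e_ j) * p x).
Proof.
move=> t0 lw bp; have [mw Lw] := lw; have [mp [r [M [pM pr]]]] := bp.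
have mv := measurable_line_fun j mw.
have mI : measurable (`[0, t]%classic : set (measurableTypeR R)) by exact: measurable_itv.
pose G0 (z : R3 R * R) : R := w (z.1 - z.2 *: e_ j) * p z.1.
pose G (z : R3 R * R) : \bar R := (G0 z * \1_(`[0, t]%classic : set R) z.2)%:E.
have mG0 : measurable_fun (setT : set E1) (G0 : E1 -> R).
  by apply: measurable_funM => //; exact: (measurableT_comp mp measurable_fst).
have mG : measurable_fun (setT : set E1) G.
  apply/measurable_EFinP; apply: measurable_funM => //.
  have m1 : measurable_fun (setT : set (measurableTypeR R))
    (\1_(`[0, t]%classic : set R) : measurableTypeR R -> R).
    exact: measurable_indic.
  exact: (measurableT_comp m1 measurable_snd).
have M0 : 0 <= M by apply: le_trans (pM 0).
have iG : (leb3_sf \x mu1)%E.-integrable setT G.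
  apply/(integrable21ltyP leb3_sf mu1 mG).
  apply: (@le_lt_trans _ _ (\int[mu1]_(s in `[0%R, t]) (M%:E * L1cube (r + t) w))%E); last first.
    rewrite integral_cst// [X in (_ * X < _)%E](itv0t_measure t0).
    rewrite muleC; apply: lte_mul_pinfty; rewrite ?lee_fin//.
    by apply: lte_mul_pinfty; rewrite ?lee_fin//; exact: Lw.
  rewrite [leRHS]integral_mkcond; apply: ge0_le_integral => //.
  - by move=> s _; exact: integral_ge0.
  - apply: (@measurable_fun_fubini_tonelli_G _ _ _ _ R leb3_sf (fun z => `|G z|%E)) => //.
    exact: measurableT_comp.
  - apply/(measurable_restrictT _ mI); exact: measurable_cst.
  move=> s _; rewrite /patch; case: ifPn => st; last first.
    by rewrite integral0_eq// => x _; rewrite /G indicE (negbTE st) mulr0 abse0.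
  have {st}st : 0 <= s <= t by move: st; rewrite inE/= in_itv.
  apply: le_trans (lee_wpmul2l _ (@L1cube_line w j t r s mw st)); last by rewrite lee_fin.
  rewrite /L1cube -ge0_integralZl//; first last.
  - apply: measurable_abs_cube; exact: measurable_comp_translate.
  - exact: measurable_cube.
  rewrite [leRHS]integral_mkcond; apply: ge0_le_integral => //.
  - apply: measurableT_comp => //; exact: (measurableT_comp mG (pair2_measurable s)).
  - apply/(measurable_restrictT _ (measurable_cube r)); apply: measurable_funeM.
    apply: measurable_abs_cube; exact: measurable_comp_translate.
  move=> x _; rewrite /patch /G /G0/=; case: ifPn => cx.
    rewrite -EFinM lee_fin indicE mem_set/= ?in_itv//= mulr1 normrM mulrC.
    by rewrite ler_wpM2r.
  by rewrite pr ?mulr0 ?mul0r ?normr0// => /mem_set; apply/negP.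
congr fine; transitivity (\int[leb3]_x \int[mu1]_s G (x, s))%E; last first.
  transitivity (\int[mu1]_s \int[leb3]_x G (x, s))%E; first exact: (Fubini iG).
  rewrite [RHS]integral_mkcond; apply: eq_integral => s _; rewrite /patch.
  case: ifPn => st; last first.
    by rewrite integral0_eq// => x _; rewrite /G/= indicE (negbTE st) mulr0.
  rewrite /Rintegral fineK.
    by apply: eq_integral => x _; rewrite /G/= indicE st mulr1.
  apply: integrable_fin_num => //; apply: integrable_loc1_bounded_support => //.
  exact: loc1_translate.
apply: ae_eq_integral => //.
- apply/measurable_EFinP; apply: measurable_funM => //.
  by have [] := loc1_line_integral j t0 lw.
- exact: (measurable_fubini_F iG).
have := ae_integrable1 iG; apply: ae3S => x ix _.
(* Where [p x] vanishes both sides are 0, whether or not [w] is integrable on the segment; elsewhere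
   integrability of [w] on the segment is recovered by dividing by [p x]. *)
rewrite /line_integral; have [px|px] := eqVneq (p x) 0.
  by rewrite px mulr0 integral0_eq// => s _; rewrite /G/G0/= px mulr0 mul0r.
have iw : mu1.-integrable `[0, t]%classic (EFin \o (fun s => w (x - s *: e_ j))).
  apply/(integrable_mkcond _ mI).
  have := integrableZl measurableT (p x)^-1 ix.
  apply: eq_integrable => // s _; rewrite /patch /G /G0/= -EFinM indicE.
  by case: ifPn => st; rewrite ?mulr1 ?mulr0// mulrC mulfK.
rewrite -RintegralZr// /Rintegral fineK; last first.
  apply: integrable_fin_num => //; have := integrableZr mI (p x) iw.
  by apply: eq_integrable.
rewrite integral_mkcond; apply: eq_integral => s _; rewrite /patch /G /G0/= indicE.
by case: ifPn => st; rewrite ?mulr1 ?mulr0.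
Qed.

Lemma integral_is_derive (F : R -> R) (F' : R -> R) t : 0 <= t ->
  (forall s, is_derive s (1 : R) F (F' s)) -> continuous F' ->
  \int[mu1]_(s in `[0, t]) F' s = F t - F 0.
Proof.
rewrite le_eqVlt => /predU1P[<-|t0] dF cF'.
  by rewrite set_itv1 Rintegral_set1 subrr.
have cF := is_derive_continuous dF.
have := @continuous_FTC2 R F' F 0 t t0; rewrite /Rintegral => -> //.
- exact: continuous_subspaceT.
- split.
  + by move=> s _; case: (dF s).
  + by apply: cvg_at_right_filter; exact: cF.
  + by apply: cvg_at_left_filter; exact: cF.
- by move=> s _; rewrite derive1E; case: (dF s).
Qed.

(** Against a test function [p], the function F(s), the integral of f(x) p(x + s e_j), has
    derivative minus the integral of w(x) p(x + s e_j), since [w] is the weak derivative. The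
    fundamental theorem of calculus on [0, t], with the shifts moved back onto [f] and [w], is the
    claim tested against [p], and [fundamental_lemma] removes [p]. *)
Lemma difference_line_integral f w j t : 0 <= t -> loc1 f -> loc1 w ->
  is_wderiv j f w ->
  {ae leb3, forall x : R3 R, f x - f (x - t *: e_ j) = line_integral w j t x}.
Proof.
move=> t0 lf lw wf; have lL := loc1_line_integral j t0 lw.
have lft := loc1_translate (- (t *: e_ j)) lf.
have : {ae leb3, forall x : R3 R, (f x - f (x - t *: e_ j)) - line_integral w j t x = 0}.
  apply: fundamental_lemma; first exact: (loc1B (loc1B lf lft) lL).
  move=> a e e0.
  suff H p : test_function p ->
      \int[leb3]_x ((f x - f (x - t *: e_ j) - line_integral w j t x) * p x) = 0.
    exact: (H _ (test_function_mollifier a e0)).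
  move=> tp.
  have bp := test_function_bounded tp; have [mp _] := bp.
  have [mf _] := lf; have [mw _] := lw.
  have ip u : loc1 u -> leb3.-integrable setT (EFin \o (fun x => u x * p x)).
    by move=> lu; exact: integrable_loc1_bounded_support.
  have i1 := ip _ (loc1B lf lft); have i2 := ip _ lL.
  have i3 := ip _ lf; have i4 := ip _ lft.
  transitivity (\int[leb3]_x ((f x - f (x - t *: e_ j)) * p x) -
                \int[leb3]_x (line_integral w j t x * p x)).
    by rewrite -RintegralB//; apply: eq_Rintegral => x _; rewrite mulrBl.
  transitivity (\int[leb3]_x (f x * p x) - \int[leb3]_x (f (x - t *: e_ j) * p x) -
                \int[leb3]_x (line_integral w j t x * p x)).
    by congr (_ - _); rewrite -RintegralB//; apply: eq_Rintegral => x _; rewrite mulrBl.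
  rewrite line_fubini//.
  pose F s := \int[leb3]_x (f x * p (x + s *: e_ j)).
  pose c s := \int[leb3]_x (w x * p (x + s *: e_ j)).
  have cE s : \int[leb3]_x (w (x - s *: e_ j) * p x) = c s.
    have m1 : mf3 (fun x => w (x - s *: e_ j) * p x).
      by apply: measurable_funM => //; exact: measurable_comp_translate.
    apply: etrans (esym (Rintegral_translate (s *: e_ j) m1)) _.
    by apply: eq_Rintegral => x _; rewrite addrK.
  have FE : \int[leb3]_x (f (x - t *: e_ j) * p x) = F t.
    have m1 : mf3 (fun x => f (x - t *: e_ j) * p x).
      by apply: measurable_funM => //; exact: measurable_comp_translate.
    apply: etrans (esym (Rintegral_translate (t *: e_ j) m1)) _.
    by apply: eq_Rintegral => x _; rewrite addrK.
  have dF s : is_derive s (1 : R) F (- c s).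
    apply: is_derive_eq (cvg_derivative_convolution j s lf tp) _.
    rewrite -wf; last exact: test_function_translate.
    by apply: eq_Rintegral => x _; rewrite derive_translate.
  have cc : continuous (fun s => - c s).
    move=> s; apply: cvgN.
    have cw := is_derive_continuous (fun s => cvg_derivative_convolution j s lw tp).
    exact: cw.
  have := integral_is_derive t0 dF cc.
  rewrite FE (_ : \int[leb3]_x (f x * p x) = F 0); last first.
    by apply: eq_Rintegral => x _; rewrite scale0r addr0.
  under [in X in _ -> X]eq_Rintegral do rewrite cE.
  have mI : measurable (`[0, t]%classic : set (measurableTypeR R)) by exact: measurable_itv.
  have ic : mu1.-integrable `[0, t]%classic (EFin \o c).
    apply: continuous_compact_integrable; first exact: segment_compact.
    apply: continuous_subspaceT.
    exact: (is_derive_continuous (fun s => cvg_derivative_convolution j s lw tp)).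
  have -> : \int[mu1]_(s in `[0, t]) - c s = - \int[mu1]_(s in `[0, t]) c s.
    by rewrite -mulN1r -RintegralZl//; apply: eq_Rintegral => s _; rewrite mulN1r.
  by move=> H; rewrite -(opprB (F t)) -H opprK subrr.
by apply: ae3S => x /eqP; rewrite subr_eq0 => /eqP.
Qed.

End DifferenceFormula.

(** * Periodic functions *)

Section Cell.
Context {R : realType}.
Variables (g : 'I_3 -> R3 R) (hg : lin_indep g).
Implicit Types (x y : R3 R) (i j : 'I_3).

Notation mf3 f := (measurable_fun (setT : set (E R)) (f : E R -> R)).

Let G : 'M[R]_3 := \matrix_i (posvec (g i))^T.

(** Coordinates in the basis [g]: the generators are the rows of [G], hence the product of a row
    vector with the inverse. *)
Definition scoord i x : R := ((posvec x)^T *m invmx G) 0 i.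

Let unitG : G \in unitmx. Proof. by rewrite -row_free_unit. Qed.

Lemma coord3D i x y : coord3 i (x + y) = coord3 i x + coord3 i y.
Proof. by rewrite /coord3 /posvec !mxE; case: i => -[|[|[|//]]]. Qed.

Lemma coord3Z i (a : R) x : coord3 i (a *: x) = a * coord3 i x.
Proof. by rewrite /coord3 /posvec !mxE; case: i => -[|[|[|//]]]. Qed.

Lemma coord3_0 i : coord3 i (0 : R3 R) = 0.
Proof. by rewrite /coord3 /posvec !mxE; case: i => -[|[|[|//]]]. Qed.

Lemma coord3_sum (I : Type) (r : seq I) (F : I -> R3 R) i :
  coord3 i (\sum_(k <- r) F k) = \sum_(k <- r) coord3 i (F k).
Proof.
by elim/big_rec2: _ => [|k u v _ <-]; rewrite ?coord3_0// coord3D.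
Qed.

Lemma coord3_inj x y : (forall i, coord3 i x = coord3 i y) -> x = y.
Proof.
move=> xy; have := xy 0; have := xy 1; have := xy (@Ordinal 3 2 isT).
rewrite /coord3 /posvec !mxE /=; case: x {xy} => -[a b] c; case: y => -[d e] f /=.
by move=> -> -> ->.
Qed.

Lemma scoordE i x : scoord i x = \sum_k coord3 k x * invmx G k i.
Proof. by rewrite /scoord mxE; apply: eq_bigr => k _; rewrite mxE. Qed.

Lemma scoordD i x y : scoord i (x + y) = scoord i x + scoord i y.
Proof. by rewrite !scoordE -big_split/=; apply: eq_bigr => k _; rewrite coord3D mulrDl. Qed.

Lemma scoordZ i (a : R) x : scoord i (a *: x) = a * scoord i x.
Proof. by rewrite !scoordE mulr_sumr; apply: eq_bigr => k _; rewrite coord3Z mulrA. Qed.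

Lemma scoordN i x : scoord i (- x) = - scoord i x.
Proof. by rewrite -scaleN1r scoordZ mulN1r. Qed.

Lemma scoord_gen i j : scoord i (g j) = (i == j)%:R.
Proof.
have GE : (G *m invmx G) j i = (i == j)%:R by rewrite mulmxV// mxE eq_sym.
rewrite scoordE -GE mxE; apply: eq_bigr => k _; congr (_ * _).
by rewrite /G mxE [RHS]mxE.
Qed.

Lemma scoord_sum i (s : 'I_3 -> R) : scoord i (\sum_j s j *: g j) = s i.
Proof.
have -> : scoord i (\sum_j s j *: g j) = \sum_j scoord i (s j *: g j).
  elim/big_rec2: _ => [|k u v _ <-]; last by rewrite scoordD.
  by rewrite -(scale0r (0 : R3 R)) scoordZ mul0r.
rewrite (bigD1 i)//= big1 ?addr0 => [|j ji].
  by rewrite scoordZ scoord_gen eqxx mulr1.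
by rewrite scoordZ scoord_gen eq_sym (negbTE ji) mulr0.
Qed.

Lemma scoordK x : \sum_i scoord i x *: g i = x.
Proof.
apply: coord3_inj => k; rewrite coord3_sum.
have -> : coord3 k x = ((posvec x)^T *m invmx G *m G) 0 k by rewrite mulmxKV// mxE.
rewrite mxE; apply: eq_bigr => i _; rewrite coord3Z; congr (_ * _).
by rewrite /G mxE [RHS]mxE.
Qed.

Lemma measurable_scoord i : mf3 (scoord i).
Proof.
rewrite (_ : scoord i = fun x => \sum_k coord3 k x * invmx G k i); last first.
  by apply/funext => x; rewrite scoordE.
apply: measurable_sum => k; apply: measurable_funM => //.
by apply: continuous_measurable3; exact: continuous_coord3.
Qed.

Lemma cellE x : cell g x <-> forall i, 0 <= scoord i x <= 1.
Proof.
split=> [[s s01 <-] i|x01]; first by rewrite scoord_sum.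
by exists (fun i => scoord i x) => //; exact: scoordK.
Qed.

(** Half-open so that each point lies in exactly one lattice translate, the one given by the integer
    parts of its coordinates; closed cells overlap along their faces. *)
Definition halfcell : set (E R) := [set x | forall i, 0 <= scoord i x < 1].

Lemma halfcell_sub : halfcell `<=` cell g.
Proof. by move=> x Hx; apply/cellE => i; have /andP[-> /ltW] := Hx i. Qed.

Lemma measurable_scoord_itv i (I : interval R) :
  measurable [set x : E R | scoord i x \in I].
Proof.
have := @measurable_scoord i measurableT [set` I] (measurable_itv I).
by rewrite setTI.
Qed.

Lemma measurable_forall_scoord (I : interval R) :
  measurable [set x : E R | forall i, scoord i x \in I].
Proof.
have -> : [set x : E R | forall i, scoord i x \in I] =
    \bigcap_(i in [set: 'I_3]) [set x | scoord i x \in I].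
  by apply/seteqP; split=> [x xI i _|x xI i]; exact: xI.
by apply: fin_bigcap_measurable => // i _; exact: measurable_scoord_itv.
Qed.

Lemma measurable_halfcell : measurable halfcell.
Proof.
by have := measurable_forall_scoord `[0, 1[; congr measurable.
Qed.

Lemma measurable_cell : measurable (cell g : set (E R)).
Proof.
have := measurable_forall_scoord `[0, 1]; congr measurable.
apply/seteqP; split=> [x xI|x /cellE xI i]; last by have := xI i; rewrite /= in_itv.
by apply/cellE => i; have := xI i; rewrite /= in_itv.
Qed.

(** Coefficients form a countable type, which allows the translates of the cell to be enumerated. *)
Definition latvec (z : {ffun 'I_3 -> int}) : R3 R := \sum_i g i *~ z i.

Lemma latvecE z : latvec z = \sum_i (z i)%:~R *: g i.
Proof. by apply: eq_bigr => i _; rewrite scaler_int. Qed.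

Lemma scoord_latvec i z : scoord i (latvec z) = (z i)%:~R.
Proof. by rewrite latvecE scoord_sum. Qed.

Lemma lattice_latvec z : lattice g (latvec z).
Proof. by exists z. Qed.

Definition floorvec x : {ffun 'I_3 -> int} := [ffun i => Num.floor (scoord i x)].

Lemma halfcell_floorvec x z : halfcell (x - latvec z) <-> z = floorvec x.
Proof.
split=> [H|-> i].
  apply/ffunP => i; rewrite ffunE; apply/esym/floor_def.
  have /andP[] := H i; rewrite scoordD scoordN scoord_latvec => h0 h1.
  by rewrite intrD; apply/andP; split; lra.
rewrite scoordD scoordN scoord_latvec ffunE.
have := floor_itv (scoord i x); rewrite intrD => /andP[? ?].
by apply/andP; split; lra.
Qed.

Lemma latvecN z : latvec (- z) = - latvec z.
Proof.
rewrite !latvecE -sumrN; apply: eq_bigr => i _.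
by rewrite ffunE rmorphN scaleNr.
Qed.

(** A crude bound for the coordinates of points of the cell; it becomes the length in the Poincaré
    inequality. *)
Definition cell_radius : R := \sum_i `|g i|.

Lemma coord3_le_norm i x : `|coord3 i x| <= `|x|.
Proof. by apply: coord3_bounded; exact: cube_normr. Qed.

Lemma cube_coord3 r x : (forall i, `|coord3 i x| <= r) -> cube r x.
Proof.
move=> xr; apply/cubeE; have := xr 0; have := xr 1; have := xr (@Ordinal 3 2 isT).
by rewrite /coord3 /posvec !mxE /=.
Qed.

Lemma cell_sub_cube : cell g `<=` cube cell_radius.
Proof.
move=> x /cellE x01; apply: cube_coord3 => k.
rewrite -{1}(scoordK x) coord3_sum; apply: le_trans (ler_norm_sum _ _ _) _.
apply: ler_sum => i _; rewrite coord3Z normrM; have /andP[s0 s1] := x01 i.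
by rewrite (ger0_norm s0) (le_trans _ (coord3_le_norm k (g i)))// ler_piMl.
Qed.

Lemma scoord_bounded r : exists M : R, forall x, cube r x -> forall i, `|scoord i x| <= M.
Proof.
exists (\sum_i \sum_k `|r| * `|invmx G k i|) => x cx i.
rewrite (bigD1 i)//= ler_wpDr//.
  by apply: sumr_ge0 => j _; apply: sumr_ge0 => k _; rewrite mulr_ge0.
rewrite scoordE; apply: le_trans (ler_norm_sum _ _ _) _.
apply: ler_sum => k _; rewrite normrM ler_wpM2r//.
by apply: le_trans (coord3_bounded k cx) (ler_norm _).
Qed.

End Cell.

(** * Tilings and integrals of periodic functions *)

Section PeriodicIntegral.
Context {R : realType}.
Variables (g : 'I_3 -> R3 R) (hg : lin_indep g).
Implicit Types (x y h : R3 R) (i j : 'I_3) (z : {ffun 'I_3 -> int}).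

Notation H := (halfcell g).
Notation lv := (latvec g).
Notation fv := (floorvec g).

Let Hf x z : H (x - lv z) <-> z = fv x. Proof. exact: halfcell_floorvec. Qed.
Let mH : measurable H. Proof. exact: measurable_halfcell. Qed.

Section tiling.
Variables (A : set (R3 R)) (c : R3 R -> {ffun 'I_3 -> int}).
Hypothesis mA : measurable (A : set (E R)).
Hypothesis mc : forall z, measurable ([set x | c x = z] : set (E R)).

(** [A] is cut according to the value of [c]. The pieces are indexed by natural numbers for the sake
    of countable additivity; a number that codes no vector gets the empty piece. *)
Definition tile n : set (E R) :=
  if pickle_inv n is Some z then A `&` [set x | c x = z] else set0.

Lemma measurable_tile n : measurable (tile n).
Proof. by rewrite /tile; case: pickle_inv => [z|//]; exact: measurableI. Qed.

Lemma bigcup_tile : \bigcup_n tile n = A.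
Proof.
apply/seteqP; split=> [x [n _]|x Ax]; first by rewrite /tile; case: pickle_inv => [z []|//].
by exists (pickle (c x)) => //; rewrite /tile pickleK_inv.
Qed.

Lemma trivIset_tile : trivIset setT tile.
Proof.
apply/trivIsetP => n m _ _; apply: contraNeq => /set0P[x].
rewrite /tile => -[].
have K := @pickle_invK {ffun 'I_3 -> int}; have := K n; have := K m.
case: (pickle_inv n) => [z|//]; case: (pickle_inv m) => [z'|//] /=.
by move=> <- <- [_ /= <-] [_ /= <-].
Qed.
End tiling.

Lemma measurable_floorvec h z : measurable ([set x | fv (x - h) = z] : set (E R)).
Proof.
have -> : [set x | fv (x - h) = z] = (fun x => x + (- h - lv z)) @^-1` (H : set (R3 R)).
  apply/seteqP; split => x /=.
    by move=> /esym/Hf; rewrite addrA.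
  by rewrite addrA => /Hf.
exact: measurable_preimage_translate.
Qed.

Lemma measurable_floorvecN h z : measurable ([set x | - fv (x - h) = z] : set (E R)).
Proof.
have -> : [set x | - fv (x - h) = z] = [set x | fv (x - h) = - z].
  by apply/seteqP; split => x /= e; [rewrite -e opprK|rewrite e opprK].
exact: measurable_floorvec.
Qed.

(** The shifted cell and the cell are cut into countably many pieces that correspond under lattice
    translations, and by periodicity [f] has the same integral on corresponding pieces. *)
Lemma periodic_integral_translate_ge0 (f : R3 R -> \bar R) h :
  measurable_fun (setT : set (E R)) f -> (forall x, 0 <= f x)%E -> lattice_periodic g f ->
  (\int[leb3]_(x in H) f (x + h)%R = \int[leb3]_(x in H) f x)%E.
Proof.
move=> mf f0 pf.
pose A : set (E R) := [set x | H (x - h)].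
have mA : measurable A by exact: measurable_preimage_translate.
have -> : (\int[leb3]_(x in H) f (x + h)%R = \int[leb3]_(x in A) f x)%E.
  rewrite -(integral_translate h mA); last exact: measurable_funTS.
  by congr (integral _ _ _); apply/seteqP; split => x; rewrite /A/= addrK.
have mB0 z : measurable ([set x | fv x = z] : set (E R)).
  have := measurable_floorvec 0 z; congr measurable.
  by apply/seteqP; split => x /=; rewrite subr0.
(* A point of [A] with lattice part z comes from its translate by -z in [H]; shifted by -h, the
   latter has lattice part -z, whence the sign in [C]. *)
pose B := tile A fv; pose C := tile H (fun x => - fv (x - h)).
have mB n : measurable (B n) by exact: measurable_tile.
have mC n : measurable (C n).
  by apply: measurable_tile => // z; exact: measurable_floorvecN.
rewrite -(bigcup_tile A fv) -[in RHS](bigcup_tile H (fun x => - fv (x - h))).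
have bc (F : nat -> set (E R)) : (forall n, measurable (F n)) -> trivIset setT F ->
    (\int[leb3]_(x in \bigcup_n F n) f x = \sum_(n <oo) \int[leb3]_(x in F n) f x)%E.
  by move=> mF tF; apply: ge0_integral_bigcup => //; exact: measurable_funTS.
rewrite (bc _ mB (@trivIset_tile _ _)) (bc _ mC (@trivIset_tile _ _)).
apply: eq_eseriesr => n _; have := mB n; have := mC n.
rewrite -/(B n) -/(C n); have : B n = B n by [].
have : C n = C n by [].
rewrite {2}/C {2}/B /tile; case: pickle_inv => [z|] CE BE mCn mBn; last first.
  by rewrite CE BE !integral_set0.
have CB : C n = (fun x => x + lv z) @^-1` B n.
  rewrite CE BE; apply/seteqP; split => x /= [].
  - move=> Hx zx; have hz : H (x + lv z - h).
      have /Hf : - z = fv (x - h) by rewrite -zx opprK.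
      by rewrite latvecN opprK addrAC.
    split=> //; apply/esym/Hf; by rewrite addrK.
  - move=> Hx /esym/Hf; rewrite addrK => Hxx; split=> //.
    have : H (x - h - lv (- z)) by rewrite latvecN opprK addrAC.
    by move=> /Hf <-; rewrite opprK.
rewrite -(integral_translate (lv z) mBn); last exact: measurable_funTS.
rewrite -CB; apply: ae_eq_integral => //.
- apply: measurable_funTS.
  exact: (measurableT_comp mf (measurable_translate (lv z))).
- exact: measurable_funTS.
- by apply: ae3S (pf _ (lattice_latvec g z)) => x ->.
Qed.

Lemma periodic_integral_translate (f : R3 R -> \bar R) h :
  measurable_fun (setT : set (E R)) f -> lattice_periodic g f ->
  (\int[leb3]_(x in H) f (x + h)%R = \int[leb3]_(x in H) f x)%E.
Proof.
move=> mf pf; rewrite [LHS]integralE [RHS]integralE.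
have pp : lattice_periodic g (f^\+)%E.
  by move=> k /pf; apply: ae3S => x; rewrite !funeposE => ->.
have pn : lattice_periodic g (f^\-)%E.
  by move=> k /pf; apply: ae3S => x; rewrite !funenegE => ->.
congr (_ - _)%E.
- rewrite -(@periodic_integral_translate_ge0 (f^\+)%E h)//; last exact: measurable_funepos.
  by apply: eq_integral => x _; rewrite !funeposE.
- rewrite -(@periodic_integral_translate_ge0 (f^\-)%E h)//; last exact: measurable_funeneg.
  by apply: eq_integral => x _; rewrite !funenegE.
Qed.

Lemma cube_sub_tiles r : exists s : seq {ffun 'I_3 -> int},
  forall x, cube r x -> fv x \in s.
Proof.
have [M sM] := scoord_bounded g r; pose N := (Num.trunc M).+1.
(* The vectors with entries between -N and N, coded by ordinals below 2N + 1. *)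
pose zk (k : {ffun 'I_3 -> 'I_(2 * N).+1}) : {ffun 'I_3 -> int} :=
  [ffun i => (k i : nat)%:Z - N%:Z].
exists [seq zk k | k <- enum {: {ffun 'I_3 -> 'I_(2 * N).+1}}] => x cx.
apply/mapP; exists [ffun i => inord (absz (Num.floor (scoord g i x) + N%:Z))].
  by rewrite mem_enum.
apply/ffunP => i; rewrite !ffunE.
have := sM x cx i; have := truncnS_gt M; rewrite -/N => MN /le_lt_trans /(_ MN).
rewrite ltr_norml => /andP[n1 n2].
have f1 : (- (N%:Z) <= Num.floor (scoord g i x))%R.
  by rewrite floor_ge_int rmorphN/= ltW.
have f2 : (Num.floor (scoord g i x) <= N%:Z)%R.
  by rewrite -(ler_int R) (le_trans (floor_le _))// ltW.
rewrite inordK; lia.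
Qed.

(** With subadditivity in place of additivity, a finite cover by tiles may contain repetitions. *)
Lemma ge0_integral_setU_le (f : R3 R -> \bar R) (A B : set (E R)) :
  measurable A -> measurable B -> measurable_fun (setT : set (E R)) f ->
  (forall x, 0 <= f x)%E ->
  (\int[leb3]_(x in A `|` B) f x <= \int[leb3]_(x in A) f x + \int[leb3]_(x in B) f x)%E.
Proof.
move=> mA mB mf f0.
have mBA : measurable (B `\` A) by exact: measurableD.
have -> : A `|` B = A `|` (B `\` A) by rewrite setUDr setDv setD0 // setUDl.
rewrite ge0_integral_setU//; last 2 first.
- exact: measurable_funTS.
- by apply/disj_setPS => x [Ax [_ /(_ Ax)]].
by apply: leeD2l; apply: ge0_subset_integral => //; exact: measurable_funTS.
Qed.

(** Finitely many translated cells cover the cube. [N] does not depend on [f], so convergence in L^2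
    of the cell implies convergence in L^2 of every cube. *)
Lemma periodic_cube_le r : exists N : nat, forall f : R3 R -> \bar R,
  measurable_fun (setT : set (E R)) f -> (forall x, 0 <= f x)%E -> lattice_periodic g f ->
  (\int[leb3]_(x in cube r) f x <= N%:R%:E * \int[leb3]_(x in H) f x)%E.
Proof.
have [s sP] := cube_sub_tiles r; exists (size s) => f mf f0 pf.
pose T z : set (E R) := (fun x => x - lv z) @^-1` (H : set (R3 R)).
have mT z : measurable (T z) by exact: measurable_preimage_translate.
have fT z : (\int[leb3]_(x in T z) f x = \int[leb3]_(x in H) f x)%E.
  rewrite -(periodic_integral_translate_ge0 (lv z))//.
  rewrite -(integral_translate (lv z) (mT z)); last exact: measurable_funTS.
  by congr (integral _ _ _); apply/seteqP; split => x; rewrite /T/= addrK.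
have [mU fU] : measurable (\big[setU/set0]_(z <- s) T z) /\
    (\int[leb3]_(x in \big[setU/set0]_(z <- s) T z) f x <=
     (size s)%:R%:E * \int[leb3]_(x in H) f x)%E.
  elim: s {sP} => [|z s [IH1 IH2]]; first by rewrite big_nil integral_set0 mul0e.
  rewrite big_cons; split; first exact: measurableU.
  apply: le_trans (ge0_integral_setU_le (mT z) IH1 mf f0) _.
  rewrite /= -natr1 EFinD ge0_muleDl ?lee_fin// mul1e addeC fT.
  exact: leeD2r.
apply: le_trans fU; apply: ge0_subset_integral => //.
- exact: measurable_cube.
- exact: measurable_funTS.
move=> x /sP xs; rewrite -bigcup_seq; exists (fv x) => //.
by rewrite /T/=; apply/Hf.
Qed.

Lemma periodic_cube_lty (f : R3 R -> \bar R) r :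
  measurable_fun (setT : set (E R)) f -> (forall x, 0 <= f x)%E -> lattice_periodic g f ->
  (\int[leb3]_(x in H) f x < +oo -> \int[leb3]_(x in cube r) f x < +oo)%E.
Proof.
move=> mf f0 pf fH; have [N NP] := periodic_cube_le r.
by apply: le_lt_trans (NP _ mf f0 pf) _; rewrite lte_mul_pinfty ?lee_fin.
Qed.

Lemma integral_tiles_lower (f : R3 R -> \bar R) (A : set (E R)) : measurable A ->
  measurable_fun (setT : set (E R)) f -> (forall x, 0 <= f x)%E -> lattice_periodic g f ->
  (\int[leb3]_(x in H) f x = 0 -> \int[leb3]_(x in A) f x = 0)%E.
Proof.
move=> mA mf f0 pf fH.
have mB0 z : measurable ([set x | fv x = z] : set (E R)).
  have := measurable_floorvec 0 z; congr measurable.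
  by apply/seteqP; split => x /=; rewrite subr0.
rewrite -(bigcup_tile A fv) ge0_integral_bigcup//; last 3 first.
- by move=> n; exact: measurable_tile.
- exact: measurable_funTS.
- exact: trivIset_tile.
apply: eseries0 => n _ _; rewrite /tile; case: pickle_inv => [z|]; last by rewrite integral_set0.
apply/eqP; rewrite eq_le integral_ge0// andbT -fH.
pose T : set (E R) := (fun x => x - lv z) @^-1` (H : set (R3 R)).
have mT : measurable T by exact: measurable_preimage_translate.
apply: (@le_trans _ _ (\int[leb3]_(x in T) f x)%E).
  apply: ge0_subset_integral => //; first exact: measurableI.
    exact: measurable_funTS.
  by move=> x [_ /= zx]; apply/Hf.
rewrite -(periodic_integral_translate_ge0 (lv z))//.
rewrite -(integral_translate (lv z) mT); last exact: measurable_funTS.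
rewrite le_eqVlt; apply/orP; left; apply/eqP; congr (integral _ _ _).
by apply/seteqP; split => x; rewrite /T/= addrK.
Qed.

Lemma leb3_halfcell_lty : (leb3 H < +oo)%E.
Proof.
apply: le_lt_trans (leb3_cube_lty (cell_radius g)).
apply: le_measure; rewrite ?inE//; first exact: measurable_cube.
by move=> x /(halfcell_sub hg)/(cell_sub_cube hg).
Qed.

(** No determinant is computed: if the cell were null, so would be every union of its translates,
    whereas the cube of radius 1 has volume 8. *)
Lemma leb3_halfcell_gt0 : (0 < leb3 H)%E.
Proof.
rewrite lt0e measure_ge0 andbT; apply/negP => /eqP H0.
have i1 (A : set (E R)) : measurable A -> (\int[leb3]_(x in A) (cst 1%E) x = leb3 A)%E.
  by move=> mA; rewrite integral_cst// mul1e.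
have := @integral_tiles_lower (cst 1%E) (cube 1) (measurable_cube 1).
rewrite !i1//; last exact: measurable_cube.
have p : lattice_periodic g (cst 1%E : R3 R -> \bar R).
  by move=> h _; exact: aeW.
move=> /(_ (measurable_cst _) (fun=> lee01) p H0).
have lt : - 1 < (1 : R) by lra.
rewrite leb3_box// !lebesgue_measure_itv/= lte_fin lt -!EFinB -!EFinM => -[] /eqP.
by rewrite gt_eqF//; lra.
Qed.

(* A face of the cell is null because its translates along the transverse generator
   are disjoint and stay in a bounded set. *)
Lemma null_of_disjoint_copies (A : nat -> set (E R)) (B : set (E R)) (a : \bar R) :
  (forall n, measurable (A n)) -> trivIset setT A -> measurable B ->
  (leb3 B < +oo)%E -> (forall n, A n `<=` B) -> (forall n, leb3 (A n) = a) -> a = 0%E.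
Proof.
move=> mA tA mB Boo AB Aa.
have a0 : (0 <= a)%E by rewrite -(Aa 0%N).
have le N : (\sum_(0 <= n < N) a <= leb3 B)%E.
  apply: (@le_trans _ _ (leb3 (\bigcup_n A n))).
    rewrite measure_bigcup//.
    rewrite (_ : (\sum_(0 <= n < N) a = \sum_(0 <= n < N) leb3 (A n))%E); last first.
      by apply: eq_bigr => n _; rewrite Aa.
    have -> : (\sum_(k <oo | k \in setT) leb3 (A k) = \sum_(k <oo) leb3 (A k))%E.
      by apply: eq_eseriesl => k; rewrite in_setT.
    by apply: nneseries_lim_ge => *; exact: measure_ge0.
  apply: le_measure; rewrite ?inE//; first exact: bigcup_measurable.
  by move=> x [n _ /AB].
have Bf : leb3 B \is a fin_num by rewrite ge0_fin_numE.
have af : a \is a fin_num.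
  rewrite ge0_fin_numE//; apply: le_lt_trans Boo; have := le 1%N.
  by rewrite big_nat1.
move: a0 le; rewrite -(fineK af) -(fineK Bf) lee_fin; move: (fine a) (fine (leb3 B)) => u b u0 le.
congr (_%:E); apply/eqP; rewrite eq_le u0 andbT leNgt; apply/negP => u0'.
have := le (Num.truncn (b / u)).+1; rewrite sumEFin lee_fin sumr_const_nat subn0.
rewrite leNgt => /negP; apply; rewrite -mulr_natl -ltr_pdivrMr//.
exact: truncnS_gt.
Qed.

Lemma leb3_face i : leb3 [set x : E R | cell g x /\ scoord g i x = 1] = 0%E.
Proof.
set P := [set x : E R | _].
have mcell := measurable_cell hg.
have mP : measurable P.
  have -> : P = (cell g : set (E R)) `&` [set x | scoord g i x \in `[1, 1]].
    apply/seteqP; split => x [cx].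
      by move=> sx; split=> //=; rewrite in_itv/= sx lexx.
    by rewrite /= in_itv/= => /le_anti.
  by apply: measurableI => //; exact: measurable_scoord_itv.
(* These shifts are distinct, which puts the copies on distinct levels of [scoord g i], and at most
   1, which keeps them in one cube. *)
pose tn n : R := n.+1%:R^-1.
pose A n : set (E R) := (fun x => x - tn n *: g i) @^-1` (P : set (R3 R)).
have mA n : measurable (A n) by exact: measurable_preimage_translate.
apply: (@null_of_disjoint_copies A (cube (cell_radius g + `|g i|)) (leb3 P) mA).
- apply/trivIsetP => n m _ _; apply: contraNeq => /set0P[x [[_ +] [_]]] /=.
  rewrite !scoordD !scoordN !scoordZ !scoord_gen// eqxx !mulr1 => e1 e2.
  have : tn n = tn m by lra.
  by move=> /invr_inj/eqP; rewrite eqr_nat eqSS.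
- exact: measurable_cube.
- exact: leb3_cube_lty.
- move=> n x [cx _]; rewrite -(subrK (tn n *: g i) x).
  apply: cubeD; first exact: (cell_sub_cube hg).
  apply: cube_coord3 => k; rewrite coord3Z normrM ger0_norm ?invr_ge0//.
  apply: le_trans (coord3_le_norm k (g i)).
  by rewrite ler_piMl// invf_le1// ler1n.
- by move=> n; apply: (@leb3_translate R (- (tn n *: g i)) P).
Qed.

Lemma cell_halfcell_null : leb3 ((cell g : set (E R)) `\` H) = 0%E.
Proof.
apply/eqP; rewrite eq_le measure_ge0 andbT.
pose F i : set (E R) := [set x : E R | cell g x /\ scoord g i x = 1].
have F0 i : leb3.-negligible (F i).
  exists (F i); split=> //; last exact: leb3_face.
  have -> : F i = (cell g : set (E R)) `&` [set x | scoord g i x \in `[1, 1]].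
    apply/seteqP; split => x [cx].
      by move=> sx; split=> //=; rewrite in_itv/= sx lexx.
    by rewrite /= in_itv/= => /le_anti.
  by apply: measurableI; [exact: measurable_cell|exact: measurable_scoord_itv].
have : leb3.-negligible (F 0 `|` (F 1 `|` F (@Ordinal 3 2 isT))).
  by apply: negligibleU => //; exact: negligibleU.
move=> [N [mN N0 FN]]; rewrite -N0; apply: le_measure; rewrite ?inE//.
  by apply: measurableD => //; exact: measurable_cell.
move=> x [/[dup] cx /(cellE hg) c01 nHx]; apply: FN; apply: contrapT => nF; apply: nHx => i.
have /andP[-> s1] := c01 i; rewrite lt_neqAle s1 andbT; apply/negP => /eqP si.
apply: nF; have : F i x by [].
case: i si {s1} => -[|[|[|//]]] ilt si Fi; [left|right; left|right; right];
  by move: Fi; congr (F _ _); exact: val_inj.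
Qed.

Lemma integral_cell_halfcell (f : R3 R -> \bar R) :
  measurable_fun (setT : set (E R)) f ->
  (\int[leb3]_(x in cell g) f x = \int[leb3]_(x in H) f x)%E.
Proof.
move=> mf; have mcell := measurable_cell hg.
have e (F : R3 R -> \bar R) : measurable_fun (setT : set (E R)) F -> (forall x, 0 <= F x)%E ->
    (\int[leb3]_(x in cell g) F x = \int[leb3]_(x in H) F x)%E.
  move=> mF F0; rewrite (@ge0_negligible_integral _ _ _ leb3 (cell g) (cell g `\` H))//.
  - by congr (integral _ _ _); rewrite setDD; apply/setIidr; exact: halfcell_sub.
  - exact: measurableD.
  - exact: measurable_funTS.
  - exact: cell_halfcell_null.
rewrite integralE [RHS]integralE; congr (_ - _)%E.
- by apply: e => //; exact: measurable_funepos.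
- by apply: e => //; exact: measurable_funeneg.
Qed.

End PeriodicIntegral.

(** * Periodic square-integrable functions *)

Section PeriodicL2.
Context {R : realType}.
Implicit Types (x y v : R3 R) (f h w : R3 R -> R).
Variables (g : 'I_3 -> R3 R) (hg : lin_indep g).

Notation mf3 f := (measurable_fun (setT : set (E R)) (f : E R -> R)).
Notation H := (halfcell g).
Notation "<< f , h >>" := (dot leb3 H f h).

Let mH : measurable H.
Proof. exact: measurable_halfcell. Qed.

Definition L2per f := [/\ mf3 f, lattice_periodic g f & sqint leb3 H f].

Lemma L2per_sqint f : L2per f -> sqint leb3 H f.
Proof. by case. Qed.

Lemma L2per_mf3 f : L2per f -> mf3 f.
Proof. by case. Qed.

Lemma measurable_sqrE f (D : set (E R)) : mf3 f -> measurable_fun D (fun x => (f x ^+ 2)%:E).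
Proof. by move=> mf; apply: measurable_funTS; apply/measurable_EFinP; exact: measurable_funX. Qed.

Lemma L2per_sqint_cube f : L2per f -> forall r, sqint leb3 (cube r) f.
Proof.
move=> [mf pf [_ fH]] r; split; first exact: measurable_funTS.
apply: (periodic_cube_lty hg _ _ _ _ fH); first exact: measurable_sqrE.
  by move=> x; rewrite lee_fin sqr_ge0.
by move=> k /pf; apply: ae3S => x ->.
Qed.

Lemma L2per_loc1 f : L2per f -> loc1 f.
Proof. by move=> lf; apply: sqint_loc1; [exact: L2per_mf3|exact: L2per_sqint_cube]. Qed.

Lemma sqint_cube_halfcell f : mf3 f -> (forall r, sqint leb3 (cube r) f) -> sqint leb3 H f.
Proof.
move=> mf fc; split; first exact: measurable_funTS.
apply: le_lt_trans (fc (cell_radius g)).2; apply: ge0_subset_integral => //.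
- exact: measurable_cube.
- exact: measurable_sqrE.
- by move=> x _; rewrite lee_fin sqr_ge0.
- by move=> x /(halfcell_sub hg)/(cell_sub_cube hg).
Qed.

Lemma L2per_cst c : L2per (fun=> c).
Proof.
split; [exact: measurable_cst|by move=> k _; apply: aeW|split].
  exact: measurable_cst.
rewrite integral_cst// lte_mul_pinfty ?lee_fin ?sqr_ge0//.
exact: leb3_halfcell_lty.
Qed.

Lemma L2perD f h : L2per f -> L2per h -> L2per (fun x => f x + h x).
Proof.
move=> [mf pf sf] [mh ph sh]; split.
- exact: measurable_funD.
- by move=> k lk; apply: ae3S2 (pf _ lk) (ph _ lk) => x -> ->.
- exact: sqintD.
Qed.

Lemma L2perZ c f : L2per f -> L2per (fun x => c * f x).
Proof.
move=> [mf pf sf]; split.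
- by apply: measurable_funM => //; exact: measurable_cst.
- by move=> k lk; apply: ae3S (pf _ lk) => x ->.
- exact: sqintZ.
Qed.

Lemma L2perB f h : L2per f -> L2per h -> L2per (fun x => f x - h x).
Proof.
move=> [mf pf sf] [mh ph sh]; split.
- exact: measurable_funB.
- by move=> k lk; apply: ae3S2 (pf _ lk) (ph _ lk) => x -> ->.
- exact: sqintB.
Qed.

Lemma lattice_periodic_translate f v : lattice_periodic g f ->
  lattice_periodic g (fun x => f (x + v)).
Proof.
move=> pf k /pf pk.
have := ae_preserving (measurable_translate v) (leb3_translate v) pk.
by apply: ae3S => x <-; rewrite addrAC.
Qed.

Lemma dot_translate f h v : L2per f -> L2per h ->
  << fun x => f (x + v), fun x => h (x + v) >> = << f, h >>.
Proof.
move=> [mf pf _] [mh ph _]; congr fine.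
apply: (periodic_integral_translate hg v (f := fun x => (f x * h x)%:E)).
  by apply/measurable_EFinP; exact: measurable_funM.
by move=> k lk; apply: ae3S2 (pf _ lk) (ph _ lk) => x -> ->.
Qed.

Lemma L2per_translate f v : L2per f -> L2per (fun x => f (x + v)).
Proof.
move=> [mf pf [_ fH]]; split; first exact: measurable_comp_translate.
  exact: lattice_periodic_translate.
split; first by apply: measurable_funTS; exact: measurable_comp_translate.
rewrite (periodic_integral_translate hg v (f := fun x => (f x ^+ 2)%:E))//.
  exact: measurable_sqrE.
by move=> k /pf; apply: ae3S => x ->.
Qed.

Lemma dot_translateE f h v : L2per f -> L2per h ->
  << f, fun x => h (x + v) >> = << fun x => f (x - v), h >>.
Proof.
move=> lf lh; rewrite -(dot_translate v (L2per_translate (- v) lf) lh).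
by congr dot; apply/funext => x; rewrite addrK.
Qed.

Lemma L2per_ae0 f : L2per f -> << f, f >> = 0 -> {ae leb3, forall x : R3 R, f x = 0}.
Proof.
move=> [mf pf sf] f0.
have fT : (\int[leb3]_x (f x ^+ 2)%:E = 0)%E.
  apply: (integral_tiles_lower hg) => //; first exact: measurable_sqrE.
  - by move=> x; rewrite lee_fin sqr_ge0.
  - by move=> k /pf; apply: ae3S => x ->.
  - by rewrite -dot_sqr// f0.
have sT : sqint leb3 setT f by split=> //; rewrite fT.
have : dot leb3 setT f f = 0.
  by apply: EFin_inj; rewrite dot_sqr.
by move=> /(dot_eq0 (@measurableT _ (E R)) sT); apply: ae3S => x; apply.
Qed.

End PeriodicL2.

(** * Difference quotients *)

Section DifferenceQuotient.
Context {R : realType}.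
Implicit Types (x y v : R3 R) (f h w : R3 R -> R) (j : 'I_3) (t s : R).
Variables (g : 'I_3 -> R3 R) (hg : lin_indep g).

Notation mf3 f := (measurable_fun (setT : set (E R)) (f : E R -> R)).
Notation e_ j := (stdbasis j : R3 R).
Notation mu1 := (@lebesgue_measure R).
Notation E1 := (E R * measurableTypeR R)%type.
Notation H := (halfcell g).
Notation "<< f >>" := (dot leb3 H f f).

Let mH : measurable H.
Proof. exact: measurable_halfcell. Qed.

(** Common source of the two estimates on difference quotients below. One factor t comes from
    Jensen's inequality on each line, the other from integrating the bound on the slices over
    [0, t]. *)
Lemma dot_line_le (f : R3 R -> R) (u : R3 R * R -> R) t (e : R) : 0 <= t -> sqint leb3 H f ->
  measurable_fun (setT : set E1) (u : E1 -> R) ->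
  (forall s, 0 <= s <= t -> (\int[leb3]_(x in H) (u (x, s) ^+ 2)%:E <= e%:E)%E) ->
  {ae leb3, forall x : R3 R, H x -> f x = \int[mu1]_(s in `[0, t]) u (x, s)} ->
  << f >> <= t ^+ 2 * e.
Proof.
move=> t0 sf mu ue fu; rewrite -lee_fin dot_sqr//.
have mU : mf3 (fun x => \int[mu1]_(s in `[0, t]) u (x, s)) by exact: measurable_line_integral.
have -> : (\int[leb3]_(x in H) (f x ^+ 2)%:E =
    \int[leb3]_(x in H) ((\int[mu1]_(s in `[0, t]) u (x, s))%R ^+ 2)%:E)%E.
  apply: ae_eq_integral => //.
  - by apply/measurable_EFinP; apply: measurable_funX; case: sf.
  - exact: measurable_sqrE.
  - by apply: ae3S fu => x + Hx => ->.
apply: (le_trans (line_integral_sqr t0 mH mu)).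
rewrite expr2 -mulrA EFinM lee_wpmul2l ?lee_fin//.
have mu2 : measurable_fun (setT : set E1) ((fun z : R3 R * R => u z ^+ 2) : E1 -> R).
  exact: measurable_funX.
apply: (@le_trans _ _ (\int[mu1]_(s in `[0%R, t]) e%:E)%E); last first.
  by rewrite integral_cst//= itv0t_measure// -EFinM mulrC.
have u0 z : 0 <= u z ^+ 2 by exact: sqr_ge0.
apply: ge0_le_integral => //.
- by move=> s _; apply: integral_ge0 => x _; rewrite lee_fin.
- apply: eq_measurable_fun (measurable_funTS (measurable_tonelli_slice t mu2 u0 mH)) => s.
  rewrite inE => st; apply: eq_integral => x _.
  by rewrite indicE mem_set// mulr1.
Qed.

Lemma sqint_Rintegral_subr (a : R -> R) (c t : R) : 0 <= t ->
  sqint mu1 `[0, t]%classic a ->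
  \int[mu1]_(s in `[0, t]) (a s - c) = \int[mu1]_(s in `[0, t]) a s - t * c.
Proof.
move=> t0 sa.
have sc d : sqint mu1 `[0, t]%classic (fun=> d : R).
  split; first exact: measurable_cst.
  by rewrite integral_cst//= itv0t_measure// -EFinM ltry.
have m0t : measurable (`[0, t]%classic : set (measurableTypeR R)) by exact: measurable_itv.
have := dotBl m0t sa (sc c) (sc 1); rewrite /dot.
under eq_Rintegral do rewrite mulr1.
under [in X in _ = X - _]eq_Rintegral do rewrite mulr1.
under [in X in _ = _ - X]eq_Rintegral do rewrite mulr1.
by rewrite /Rintegral integral_cst//= itv0t_measure// -EFinM/= mulrC.
Qed.

(** Needed to split the line integral of w(x - s e_j) - w(x), as the real-valued integral is
    additive on integrable functions only. Integrating over the cell and over [0, t] gives t times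
    the squared norm of [w], so almost every line has a finite integral. *)
Lemma sqint_line w j t : 0 <= t -> L2per g w ->
  {ae leb3, forall x : R3 R, H x -> sqint mu1 `[0, t]%classic (fun s => w (x - s *: e_ j))}.
Proof.
move=> t0 lw; have mw := L2per_mf3 lw.
pose k (z : R3 R * R) := w (z.1 - z.2 *: e_ j) ^+ 2.
have mk : measurable_fun (setT : set E1) (k : E1 -> R).
  by apply: measurable_funX; exact: measurable_line_fun.
have k0 z : 0 <= k z by exact: sqr_ge0.
pose F x := (\int[mu1]_(s in `[0%R, t]) (k (x, s))%:E)%E.
have mF : measurable_fun (H : set (E R)) F by exact: measurable_tonelli_line.
have F0 x : (0 <= F x)%E by apply: integral_ge0 => s _; rewrite lee_fin.
have iF : leb3.-integrable H F.
  apply/integrableP; split=> //.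
  under eq_integral do rewrite gee0_abs//.
  rewrite tonelli_line//.
  rewrite (_ : integral _ _ _ = (\int[mu1]_(s in `[0%R, t]) (<< w >>)%:E)%E).
    by rewrite integral_cst//= itv0t_measure// -EFinM ltry.
  apply: eq_integral => s _; have lwt := L2per_translate hg (- (s *: e_ j)) lw.
  by rewrite -(dot_translate hg (- (s *: e_ j)) lw lw) dot_sqr//; exact: L2per_sqint lwt.
have := integrable_ae mH iF; apply: ae3S => x Fx Hx; split.
  apply: measurable_funTS.
  exact: (measurableT_comp (measurable_line_fun j mw) (pair1_measurable x)).
by have := Fx Hx; rewrite ge0_fin_numE.
Qed.

Lemma difference_le f w j t : 0 <= t -> L2per g f -> L2per g w -> is_wderiv j f w ->
  << fun x => f x - f (x - t *: e_ j) >> <= t ^+ 2 * << w >>.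
Proof.
move=> t0 lf lw fw.
have lD := L2perB lf (L2per_translate hg (- (t *: e_ j)) lf).
apply: (@dot_line_le _ (fun z => w (z.1 - z.2 *: e_ j))) => //.
- exact: L2per_sqint lD.
- by apply: measurable_line_fun; exact: L2per_mf3 lw.
- move=> s _ /=; have lwt := L2per_translate hg (- (s *: e_ j)) lw.
  by rewrite -dot_sqr ?(dot_translate hg)//; exact: L2per_sqint lwt.
- have := difference_line_integral t0 (L2per_loc1 hg lf) (L2per_loc1 hg lw) fw.
  by apply: ae3S => x + _.
Qed.

Lemma translation_continuous_per w (e : R) : L2per g w -> 0 < e ->
  exists2 d, 0 < d & forall v, cube d v -> << fun x => w (x + v) - w x >> <= e.
Proof.
move=> lw e0.
have [d d0 dP] := translation_continuous_L2 (L2per_mf3 lw) (L2per_sqint_cube hg lw)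
  (cell_radius g) e0.
exists d => // v /dP; have lD := L2perB (L2per_translate hg v lw) lw.
rewrite -lee_fin dot_sqr//; last exact: L2per_sqint lD.
apply: le_trans; apply: ge0_subset_integral => //.
- exact: measurable_cube.
- by apply: measurable_sqrE; exact: L2per_mf3 lD.
- by move=> x _; rewrite lee_fin sqr_ge0.
- by move=> x /(halfcell_sub hg)/(cell_sub_cube hg).
Qed.

Lemma difference_quotient_le f w j (e : R) : L2per g f -> L2per g w -> is_wderiv j f w ->
  0 < e -> exists2 d, 0 < d & forall t, 0 < t <= d ->
    << fun x => t^-1 * (f x - f (x - t *: e_ j)) - w x >> <= e.
Proof.
move=> lf lw fw e0.
have [d d0 dP] := translation_continuous_per lw e0.
exists d => // t /andP[t0 td].
have lD := L2perB lf (L2per_translate hg (- (t *: e_ j)) lf).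
have lDw := L2perB lD (L2perZ t lw).
have -> : (fun x => t^-1 * (f x - f (x - t *: e_ j)) - w x) =
    (fun x => t^-1 * (f x - f (x - t *: e_ j) - t * w x)).
  by apply/funext => x; rewrite [RHS]mulrBr mulKf// gt_eqF.
have sDw := L2per_sqint lDw.
rewrite dotZl// ?dotZr//; last exact: sqintZ.
suff le : << fun x => f x - f (x - t *: e_ j) - t * w x >> <= t ^+ 2 * e.
  by rewrite mulrA -invfM -expr2 ler_pdivrMl ?exprn_gt0.
have t0' := ltW t0.
apply: (@dot_line_le _ (fun z => w (z.1 - z.2 *: e_ j) - w z.1)) => //.
- apply: measurable_funB; first by apply: measurable_line_fun; exact: L2per_mf3 lw.
  exact: measurableT_comp (L2per_mf3 lw) measurable_fst.
- move=> s /andP[s0 st] /=; have lwt := L2perB (L2per_translate hg (- (s *: e_ j)) lw) lw.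
  rewrite -dot_sqr//; last exact: L2per_sqint lwt.
  apply: dP; rewrite -scaleNr; apply: sub_cube (cube_stdbasis j (- s)).
  by rewrite normrN ger0_norm// (le_trans st).
- have := difference_line_integral t0' (L2per_loc1 hg lf) (L2per_loc1 hg lw) fw.
  apply: ae3S2 (sqint_line j t0' lw) => x /= sx -> Hx.
  by rewrite sqint_Rintegral_subr//; exact: sx.
Qed.

End DifferenceQuotient.

(** * The inequalities of Korn and Poincaré *)

Section L2Convergence.
Context d (T : measurableType d) (R : realType) (mu : {measure set T -> \bar R}).
Variables (D : set T) (mD : measurable D).
Implicit Types f h : T -> R.

Lemma dot_suml (I : Type) (r : seq I) (F : I -> T -> R) k :
  (forall i, sqint mu D (F i)) -> sqint mu D k ->
  dot mu D (fun x => \sum_(i <- r) F i x) k = \sum_(i <- r) dot mu D (F i) k.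
Proof.
move=> sF sk; elim: r => [|i r IH].
  rewrite big_nil /dot; under eq_Rintegral do rewrite big_nil mul0r.
  by rewrite /Rintegral integral0.
rewrite big_cons -IH -dotDl//; last exact: sqint_sum.
by congr dot; apply/funext => x; rewrite big_cons.
Qed.

Lemma norm_dot_le f h : sqint mu D f -> sqint mu D h ->
  `|dot mu D f h| <= Num.sqrt (dot mu D f f) * Num.sqrt (dot mu D h h).
Proof.
move=> sf sh; rewrite -sqrtr_sqr -sqrtrM ?dot_ge0//.
by rewrite ler_sqrt ?mulr_ge0 ?dot_ge0//; exact: cauchy_schwarz.
Qed.

Definition cvgL2 (F : nat -> T -> R) f :=
  dot mu D (fun x => F n x - f x) (fun x => F n x - f x) @[n --> \oo] --> (0 : R).

Lemma cvg_dot (F K : nat -> T -> R) f h :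
  (forall n, sqint mu D (F n)) -> (forall n, sqint mu D (K n)) ->
  sqint mu D f -> sqint mu D h -> cvgL2 F f -> cvgL2 K h ->
  dot mu D (F n) (K n) @[n --> \oo] --> dot mu D f h.
Proof.
move=> sF sK sf sh Ff Kh.
have sqrt0 (u : nat -> R) : u n @[n --> \oo] --> (0 : R) ->
    Num.sqrt (u n) @[n --> \oo] --> (0 : R).
  move=> u0; rewrite -(@sqrtr0 R); apply: continuous_cvg => //.
  exact: sqrt_continuous.
pose a n := Num.sqrt (dot mu D (fun x => F n x - f x) (fun x => F n x - f x)).
pose b n := Num.sqrt (dot mu D (fun x => K n x - h x) (fun x => K n x - h x)).
have a0 : a n @[n --> \oo] --> (0 : R) by exact: sqrt0.
have b0 : b n @[n --> \oo] --> (0 : R) by exact: sqrt0.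
apply/cvgrPdist_le => e e0.
have : a n * b n + a n * Num.sqrt (dot mu D h h) + Num.sqrt (dot mu D f f) * b n
    @[n --> \oo] --> (0 : R).
  rewrite -[X in _ --> X](_ : 0 * 0 + 0 * Num.sqrt (dot mu D h h) +
    Num.sqrt (dot mu D f f) * 0 = 0); last by rewrite !mul0r mulr0 !addr0.
  by apply: cvgD; [apply: cvgD; [exact: cvgM|exact: cvgMl]|exact: cvgMr].
move=> /cvgrPdist_le/(_ _ e0); apply: filterS => n.
rewrite sub0r normrN => /(le_trans (ler_norm _)); apply: le_trans.
have sFf := sqintB mD (sF n) sf; have sKh := sqintB mD (sK n) sh.
have -> : dot mu D f h - dot mu D (F n) (K n) =
    - (dot mu D (fun x => F n x - f x) (fun x => K n x - h x) +
       dot mu D (fun x => F n x - f x) h + dot mu D f (fun x => K n x - h x)).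
  by rewrite !dotBl// !dotBr//; ring.
rewrite normrN; apply: le_trans (ler_normD _ _) _.
apply: lerD; last exact: norm_dot_le.
by apply: le_trans (ler_normD _ _) _; apply: lerD; exact: norm_dot_le.
Qed.

End L2Convergence.

(** * Korn's inequality *)

Section Korn.
Context {R : realType}.
Implicit Types (x y v : R3 R) (f h w : R3 R -> R) (i j : 'I_3) (t s : R).
Variables (g : 'I_3 -> R3 R) (hg : lin_indep g).

Notation e_ j := (stdbasis j : R3 R).
Notation H := (halfcell g).
Notation "<< f , h >>" := (dot leb3 H f h).
Notation "<< f >>" := (dot leb3 H f f).

Let mH : measurable H.
Proof. exact: measurable_halfcell. Qed.

Definition bdiff f j t x := t^-1 * (f x - f (x - t *: e_ j)).
Definition fdiff f j t x := t^-1 * (f (x + t *: e_ j) - f x).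

Lemma L2per_bdiff f j t : L2per g f -> L2per g (bdiff f j t).
Proof. by move=> lf; apply: L2perZ; apply: L2perB => //; exact: L2per_translate. Qed.

Lemma L2per_fdiff f j t : L2per g f -> L2per g (fdiff f j t).
Proof. by move=> lf; apply: L2perZ; apply: L2perB => //; exact: L2per_translate. Qed.

Lemma cvg_bdiff f w j : L2per g f -> L2per g w -> is_wderiv j f w ->
  cvgL2 leb3 H (fun n => bdiff f j n.+1%:R^-1) w.
Proof.
move=> lf lw fw; apply/cvgrPdist_le => e e0.
have [d d0 dP] := difference_quotient_le hg lf lw fw e0.
near=> n.
rewrite sub0r normrN ger0_norm ?dot_ge0//; apply: dP.
rewrite invr_gt0 ltr0n/= ltW//; near: n; exact: near_infty_natSinv_lt (PosNum d0).
Unshelve. all: by end_near. Qed.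

(** A forward quotient is the backward quotient at the translated point. Its error splits into the
    translated backward error, of unchanged norm, and a translation difference of [w]. *)
Lemma cvg_fdiff f w j : L2per g f -> L2per g w -> is_wderiv j f w ->
  cvgL2 leb3 H (fun n => fdiff f j n.+1%:R^-1) w.
Proof.
move=> lf lw fw; apply/cvgrPdist_le => e e0.
have e4 : 0 < e / 4 by rewrite divr_gt0.
have [d1 d10 d1P] := difference_quotient_le hg lf lw fw e4.
have [d2 d20 d2P] := translation_continuous_per hg lw e4.
near=> n.
have nd1 : n.+1%:R^-1 <= d1.
  by rewrite ltW//; near: n; exact: near_infty_natSinv_lt (PosNum d10).
have nd2 : n.+1%:R^-1 <= d2.
  by rewrite ltW//; near: n; exact: near_infty_natSinv_lt (PosNum d20).
rewrite sub0r normrN ger0_norm ?dot_ge0//.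
set t : R := n.+1%:R^-1; have t0 : 0 < t by rewrite invr_gt0.
have lB := L2perB (L2per_translate hg (t *: e_ j) (L2per_bdiff j t lf))
  (L2per_translate hg (t *: e_ j) lw).
have lw' := L2perB (L2per_translate hg (t *: e_ j) lw) lw.
have -> : (fun x => fdiff f j t x - w x) = (fun x =>
    (bdiff f j t (x + t *: e_ j) - w (x + t *: e_ j)) + (w (x + t *: e_ j) - w x)).
  by apply/funext => x; rewrite /bdiff /fdiff addrK; ring.
apply: le_trans (dotDD_le mH (L2per_sqint lB) (L2per_sqint lw')) _.
rewrite (_ : e = 2 * (e / 4 + e / 4)); last by field.
rewrite ler_pM2l//; apply: lerD.
  rewrite (dot_translate hg (t *: e_ j) (f := fun x => bdiff f j t x - w x)
     (h := fun x => bdiff f j t x - w x)); last 2 first.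
  - by apply: L2perB => //; exact: L2per_bdiff.
  - by apply: L2perB => //; exact: L2per_bdiff.
  by apply: d1P; rewrite t0.
apply: d2P; apply: sub_cube (cube_stdbasis j t).
by rewrite gtr0_norm.
Unshelve. all: by end_near. Qed.

Lemma dot_bdiff_adjoint f k j t : L2per g f -> L2per g k ->
  << bdiff f j t, k >> = - << f, fdiff k j t >>.
Proof.
move=> lf lk.
have lf' := L2per_translate hg (- (t *: e_ j)) lf.
have lk' := L2per_translate hg (t *: e_ j) lk.
have [sf sk] := (L2per_sqint lf, L2per_sqint lk).
have [sf' sk'] := (L2per_sqint lf', L2per_sqint lk').
rewrite /bdiff /fdiff dotZl ?dotZr//; try exact: sqintB.
rewrite dotBl// dotBr// (dot_translateE hg _ lf lk).
ring.
Qed.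

(** Two summations by parts: backward and forward quotients are adjoint up to sign, and quotients in
    different directions commute. *)
Lemma dot_bdiff_fdiff f h i j t : L2per g f -> L2per g h ->
  << bdiff f j t, bdiff h i t >> = << fdiff f i t, fdiff h j t >>.
Proof.
move=> lf lh; rewrite (dot_bdiff_adjoint j t lf (L2per_bdiff i t lh)).
have -> : fdiff (bdiff h i t) j t = bdiff (fdiff h j t) i t.
  by apply/funext => x; rewrite /fdiff /bdiff [x - _ + _]addrAC; ring.
by rewrite dotC (dot_bdiff_adjoint i t (L2per_fdiff j t lh) lf) opprK dotC.
Qed.

Lemma dot_wderiv_swap f h i j fi fj hi hj :
  L2per g f -> L2per g h -> L2per g fi -> L2per g fj -> L2per g hi -> L2per g hj ->
  is_wderiv i f fi -> is_wderiv j f fj -> is_wderiv i h hi -> is_wderiv j h hj ->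
  << fj, hi >> = << fi, hj >>.
Proof.
move=> lf lh lfi lfj lhi lhj ffi ffj hhi hhj.
have cb := cvg_dot mH (fun n => L2per_sqint (L2per_bdiff j n.+1%:R^-1 lf))
  (fun n => L2per_sqint (L2per_bdiff i n.+1%:R^-1 lh)) (L2per_sqint lfj) (L2per_sqint lhi)
  (cvg_bdiff lf lfj ffj) (cvg_bdiff lh lhi hhi).
have cf := cvg_dot mH (fun n => L2per_sqint (L2per_fdiff i n.+1%:R^-1 lf))
  (fun n => L2per_sqint (L2per_fdiff j n.+1%:R^-1 lh)) (L2per_sqint lfi) (L2per_sqint lhj)
  (cvg_fdiff lf lfi ffi) (cvg_fdiff lh lhj hhj).
have e : (fun n => << bdiff f j n.+1%:R^-1, bdiff h i n.+1%:R^-1 >>) =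
         (fun n => << fdiff f i n.+1%:R^-1, fdiff h j n.+1%:R^-1 >>).
  by apply/funext => n; exact: dot_bdiff_fdiff.
rewrite e in cb; exact: (cvg_unique _ cb cf).
Qed.

(** The swap turns each cross term into the product of [w i i] and [w j j]. The squared norm of the
    strain is then half that of the gradient plus half that of the divergence, and the latter is
    dropped. *)
Lemma korn (u : 'I_3 -> R3 R -> R) (w : 'I_3 -> 'I_3 -> R3 R -> R) :
  (forall i, L2per g (u i)) -> (forall i j, L2per g (w i j)) ->
  (forall i j, is_wderiv j (u i) (w i j)) ->
  \sum_i \sum_j << w i j >> <=
  2 * \sum_i \sum_j << fun x => 2^-1 * (w i j x + w j i x) >>.
Proof.
move=> lu lw uw; have sw i j := L2per_sqint (lw i j).
have e i j : << fun x => 2^-1 * (w i j x + w j i x) >> =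
    4^-1 * << w i j >> + 4^-1 * << w j i >> + 2^-1 * << w i i, w j j >>.
  rewrite dotZl// ?dotZr//; try by [exact: sqintD|apply: sqintZ => //; exact: sqintD].
  rewrite dotDD// (dot_wderiv_swap (i := i) (j := j)
    (lu i) (lu j) (lw i i) (lw i j) (lw j i) (lw j j))//.
  by field.
have -> : \sum_i \sum_j << fun x => 2^-1 * (w i j x + w j i x) >> =
    \sum_i \sum_j (4^-1 * << w i j >> + 4^-1 * << w j i >> + 2^-1 * << w i i, w j j >>).
  by apply: eq_bigr => i _; apply: eq_bigr => j _.
have -> : \sum_i \sum_j (4^-1 * << w i j >> + 4^-1 * << w j i >> + 2^-1 * << w i i, w j j >>) =
    2^-1 * \sum_i \sum_j << w i j >> +
    2^-1 * << fun x => \sum_i w i i x >>.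
  have es : << fun x => \sum_i w i i x >> = \sum_i \sum_j << w i i, w j j >>.
    rewrite dot_suml//; last by apply: sqint_sum.
    by apply: eq_bigr => i _; rewrite dotC dot_suml//; apply: eq_bigr => j _; rewrite dotC.
  have ex : \sum_i \sum_j << w j i >> = \sum_i \sum_j << w i j >> by rewrite exchange_big.
  under eq_bigr do rewrite !big_split -!mulr_sumr/=.
  rewrite !big_split -!mulr_sumr/= ex es; by field.
rewrite mulrDr !mulrA divff// !mul1r lerDl; exact: dot_ge0.
Qed.

End Korn.

(** * The Poincaré inequality by averaging over shifts *)

Section TonelliSquare.
Context {R : realType}.
Variables (k : R3 R * R3 R -> R) (D : set (R3 R)).
Hypothesis mk : measurable_fun (setT : set (E R * E R)) (k : E R * E R -> R).
Hypothesis k0 : forall z, 0 <= k z.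
Hypothesis mD : measurable (D : set (E R)).

Let K (z : R3 R * R3 R) : \bar R := (k z * \1_D z.1 * \1_D z.2)%:E.

Let mK : measurable_fun (setT : set (E R * E R)) K.
Proof.
have m1 : measurable_fun (setT : set (E R)) (\1_D : R3 R -> R) by exact: measurable_indic.
apply/measurable_EFinP; apply: measurable_funM; first apply: measurable_funM => //.
- exact: (measurableT_comp m1 measurable_fst).
- exact: (measurableT_comp m1 measurable_snd).
Qed.

Let K0 z : (0 <= K z)%E.
Proof. by rewrite lee_fin !mulr_ge0. Qed.

Lemma tonelli_square :
  (\int[leb3]_(x in D) \int[leb3]_(y in D) (k (x, y))%:E =
   \int[leb3]_(y in D) \int[leb3]_(x in D) (k (x, y))%:E)%E.
Proof.
transitivity (\int[leb3]_x \int[leb3]_y K (x, y))%E.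
  rewrite integral_mkcond; apply: eq_integral => x _; rewrite /patch.
  case: ifPn => xD; last first.
    by rewrite integral0_eq// => y _; rewrite /K/= indicE (negbTE xD) mulr0 mul0r.
  rewrite integral_mkcond; apply: eq_integral => y _; rewrite /patch /K/= !indicE xD mulr1.
  by case: ifPn => _; rewrite ?mulr1 ?mulr0.
rewrite (leb3_fubini_tonelli mK K0).
rewrite [RHS]integral_mkcond; apply: eq_integral => y _; rewrite /patch.
case: ifPn => yD; last first.
  by rewrite integral0_eq// => x _; rewrite /K/= !indicE (negbTE yD) mulr0.
rewrite [RHS]integral_mkcond; apply: eq_integral => x _; rewrite /patch /K/= !indicE yD mulr1.
by case: ifPn => _; rewrite ?mulr1 ?mulr0.
Qed.

Lemma measurable_tonelli_square :
  measurable_fun (D : set (E R)) (fun y => \int[leb3]_(x in D) (k (x, y))%:E)%E.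
Proof.
have := measurable_funTS (D := D : set (E R)) (measurable_leb3_integral1 mK K0).
apply: eq_measurable_fun => y yD.
rewrite [RHS]integral_mkcond; apply: eq_integral => x _; rewrite /patch /K/= !indicE yD mulr1.
by case: ifPn => _; rewrite ?mulr1 ?mulr0.
Qed.

End TonelliSquare.

Section Poincare.
Context {R : realType}.
Implicit Types (x y v : R3 R) (f h : R3 R -> R) (i j : 'I_3) (t s : R).
Variables (g : 'I_3 -> R3 R) (hg : lin_indep g).

Notation e_ j := (stdbasis j : R3 R).
Notation H := (halfcell g).
Notation "<< f , h >>" := (dot leb3 H f h).
Notation "<< f >>" := (dot leb3 H f f).

Let mH : measurable H.
Proof. exact: measurable_halfcell. Qed.

Lemma dot_subC f h : << fun x => f x - h x >> = << fun x => h x - f x >>.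
Proof. by apply: eq_Rintegral => x _; rewrite -mulrNN !opprB. Qed.

Lemma shift_le f w j s : L2per g f -> L2per g w -> is_wderiv j f w ->
  << fun x => f (x + s *: e_ j) - f x >> <= s ^+ 2 * << w >>.
Proof.
move=> lf lw fw.
wlog s0 : s / 0 <= s => [wl|].
  have [|/ltW s0] := leP 0 s; first exact: wl.
  have := wl (- s); rewrite oppr_ge0 sqrrN => /(_ s0); apply: le_trans.
  have lD := L2perB (L2per_translate hg (s *: e_ j) lf) lf.
  rewrite -(dot_translate hg (- s *: e_ j) lD lD) dot_subC.
  rewrite le_eqVlt; apply/orP; left; apply/eqP; congr dot;
    by apply/funext => x; rewrite scaleNr subrK.
have lD := L2perB (L2per_translate hg (s *: e_ j) lf) lf.
rewrite -(dot_translate hg (- (s *: e_ j)) lD lD).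
have := difference_le hg s0 lf lw fw; congr (_ <= _).
by congr dot; apply/funext => x; rewrite subrK.
Qed.

Variables (f : R3 R -> R) (w : 'I_3 -> R3 R -> R).
Hypotheses (lf : L2per g f) (lw : forall j, L2per g (w j)).
Hypothesis fw : forall j, is_wderiv j f (w j).

(** The shift is split into three coordinate shifts; using |a + b|^2 <= 2 (|a|^2 + |b|^2) twice
    produces the factor 4. *)
Lemma translate_le v (r : R) : (forall j, `|coord3 j v| <= r) ->
  << fun x => f (x + v) - f x >> <= 4 * r ^+ 2 * \sum_j << w j >>.
Proof.
move=> vr.
have step y j : << fun x => f (x + y + coord3 j v *: e_ j) - f (x + y) >> <= r ^+ 2 * << w j >>.
  have lD := L2perB (L2per_translate hg (coord3 j v *: e_ j) lf) lf.
  have := dot_translate hg y lD lD => /= ->.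
  apply: le_trans (shift_le (coord3 j v) lf (lw j) (fw j)) _.
  apply: ler_wpM2r; first exact: dot_ge0.
  by rewrite -real_normK ?num_real// lerXn2r// ?nnegrE// (le_trans _ (vr j)).
pose c j := coord3 j v *: e_ j.
pose i0 : 'I_3 := 0; pose i1 : 'I_3 := 1; pose i2 : 'I_3 := @Ordinal 3 2 isT.
have vE : v = c i0 + c i1 + c i2.
  apply: coord3_inj => k; rewrite -[c i0]add0r /c !coord3_line coord3_0 add0r.
  have [->|k0] := eqVneq k i0; first by rewrite !mulr1 !mulr0 !addr0.
  have [->|k1] := eqVneq k i1; first by rewrite mulr1 !mulr0 add0r addr0.
  have -> : k = i2 by apply: val_inj; case: k k0 k1 => -[|[|[|//]]].
  by rewrite eqxx mulr1 !mulr0 !add0r.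
have sE : \sum_j << w j >> = << w i0 >> + << w i1 >> + << w i2 >>.
  rewrite !big_ord_recl big_ord0 addr0 addrA; do ![congr (_ + _)]; congr (<< w _ >>); exact: val_inj.
have lt y : L2per g (fun x => f (x + y)) by exact: L2per_translate.
have -> : (fun x => f (x + v) - f x) = (fun x =>
  ((f (x + (c i0 + c i1) + c i2) - f (x + (c i0 + c i1))) + (f (x + c i0 + c i1) - f (x + c i0)))
   + (f (x + 0 + c i0) - f (x + 0))).
  by apply/funext => x; rewrite vE !addrA !addr0; ring.
have l2 : L2per g (fun x => f (x + (c i0 + c i1) + c i2) - f (x + (c i0 + c i1))).
  by apply: L2perB => //; under eq_fun do rewrite -addrA; exact: lt.
have l1 : L2per g (fun x => f (x + c i0 + c i1) - f (x + c i0)).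
  by apply: L2perB => //; under eq_fun do rewrite -addrA; exact: lt.
have l0 : L2per g (fun x => f (x + 0 + c i0) - f (x + 0)).
  by apply: L2perB => //; under eq_fun do rewrite -addrA; exact: lt.
have := dotDD_le mH (L2per_sqint (L2perD l2 l1)) (L2per_sqint l0).
have := dotDD_le mH (L2per_sqint l2) (L2per_sqint l1).
have := step 0 i0; have := step (c i0) i1; have := step (c i0 + c i1) i2.
rewrite sE -!/(c _).
have := dot_ge0 leb3 H (w i0); have := dot_ge0 leb3 H (w i1); have := dot_ge0 leb3 H (w i2).
have := sqr_ge0 r.
move: (r ^+ 2) => q q0.
move: (<< w i0 >>) (<< w i1 >>) (<< w i2 >>) => a0 a1 a2 ? ? ?.
have qa0 : 0 <= q * a0 by exact: mulr_ge0.
rewrite !mulrDr -!mulrA.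
lra.
Qed.

Hypothesis f0 : << f, fun=> 1 >> = 0.

(* With k (x, h) = (f (x + h) - f x)^2 on H x H, integrating first in h gives
   |f|^2 + |H| (f x)^2, and integrating first in x gives the square of a translation
   difference, which the derivatives control. *)
Lemma poincare : << f >> <= 2 * cell_radius g ^+ 2 * \sum_j << w j >>.
Proof.
have [mf pf sf] := lf.
have Hoo := leb3_halfcell_lty hg; have H0 := leb3_halfcell_gt0 hg.
have fH : leb3 H \is a fin_num by rewrite ge0_fin_numE.
pose m := fine (leb3 H); have m0 : 0 < m by apply: fine_gt0; rewrite H0.
have mE : leb3 H = m%:E by rewrite fineK.
pose k (z : R3 R * R3 R) := (f (z.1 + z.2) - f z.1) ^+ 2.
have mk : measurable_fun (setT : set (E R * E R)) (k : E R * E R -> R).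
  apply: measurable_funX; apply: measurable_funB.
    exact: (measurableT_comp mf measurable_add3).
  exact: (measurableT_comp mf measurable_fst).
have k0 z : 0 <= k z by exact: sqr_ge0.
have inner x : (\int[leb3]_(y in H) (k (x, y))%:E)%E = (<< f >> + m * f x ^+ 2)%:E.
  have lc := L2perB lf (L2per_cst hg (f x)).
  rewrite /k/=.
  under eq_integral do rewrite [x + _]addrC.
  rewrite (periodic_integral_translate_ge0 hg x (f := fun y => ((f y - f x) ^+ 2)%:E)); last first.
  - by move=> h lh; apply: ae3S (pf _ lh) => y ->.
  - by move=> y; rewrite lee_fin sqr_ge0.
  - by apply: measurable_sqrE; case: lc.
  rewrite -dot_sqr//; last exact: L2per_sqint lc.
  have scc c : sqint leb3 H (fun=> c : R) by exact: L2per_sqint (L2per_cst hg c).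
  rewrite dotBB//.
  have c1 (h : R3 R -> R) : sqint leb3 H h -> << h, fun=> f x >> = f x * << h, fun=> 1 >>.
    move=> sh; rewrite -dotZr//; by congr dot; apply/funext => y; rewrite mulr1.
  rewrite c1// f0 !mulr0 subr0; congr (_ + _)%:E.
  rewrite c1// dotC c1// mulrA -expr2 mulrC; congr (_ * _).
  by rewrite /dot /Rintegral; under eq_integral do rewrite mulr1; rewrite integral_cst// mul1e.
have := tonelli_square mk k0 mH.
under eq_integral do rewrite inner EFinD EFinM.
rewrite ge0_integralD//; last 3 first.
- by move=> x _; rewrite lee_fin dot_ge0.
- by move=> x _; rewrite -EFinM lee_fin mulr_ge0 ?sqr_ge0// ltW.
- by under eq_fun do rewrite -EFinM; apply/measurable_EFinP; apply: measurable_funM => //;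
    apply: measurable_funX; exact: measurable_funTS.
rewrite integral_cst// ge0_integralZl//; last 3 first.
- exact: measurable_sqrE.
- by move=> x _; rewrite lee_fin sqr_ge0.
- by rewrite lee_fin ltW.
rewrite -dot_sqr// mE -!EFinM -EFinD => e.
pose c := 4 * cell_radius g ^+ 2 * \sum_j << w j >>.
(* The two orders of integration give 2 m |f|^2 <= m c; cancelling 2 m leaves half of the 4 in
   [c]. *)
have le : ((<< f >> * m + m * << f >>)%:E <= (c * m)%:E)%E.
  apply: (@le_trans _ _ (\int[leb3]_(y in H) c%:E)%E); last first.
    by rewrite integral_cst// mE -EFinM.
  rewrite e; apply: ge0_le_integral => //.
  - by move=> y _; apply: integral_ge0 => x _; rewrite lee_fin.
  - exact: measurable_tonelli_square.
  - move=> y Hy; have lD := L2perB (L2per_translate hg y lf) lf.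
    rewrite /k/= -dot_sqr//; last exact: L2per_sqint lD.
    rewrite lee_fin; apply: translate_le => j.
    by apply: coord3_bounded; apply: (cell_sub_cube hg); exact: (halfcell_sub hg).
rewrite lee_fin [m * _]mulrC -mulrDl ler_pM2r// in le.
by move: le; rewrite /c -!mulrA; lra.
Qed.

End Poincare.

(** * Limits of periodic fields *)

Section PeriodicLimits.
Context {R : realType}.
Implicit Types (x y v : R3 R) (f h w p : R3 R -> R) (i j : 'I_3).
Variables (g : 'I_3 -> R3 R) (hg : lin_indep g).

Notation mf3 f := (measurable_fun (setT : set (E R)) (f : E R -> R)).
Notation H := (halfcell g).
Notation "<< f >>" := (dot leb3 H f f).

Let mH : measurable H.
Proof. exact: measurable_halfcell. Qed.

Lemma L2per_complete (F : nat -> R3 R -> R) (c : R) : (forall n, L2per g (F n)) ->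
  (forall n, << fun x => F n.+1 x - F n x >> <= c * 4^-1 ^+ n) ->
  exists2 l, L2per g l & cvgL2 leb3 H F l.
Proof.
move=> lF Fc; have sF n := L2per_sqint (lF n).
(* An upper limit exists at every point, is measurable, and inherits periodicity directly; it is the
   limit wherever the sequence converges. *)
pose l x := fine (limn_esup (fun n => (F n x)%:E)).
have ml : mf3 l.
  apply: (@measurableT_comp _ _ _ _ _ _ fine); first exact: fine_measurable.
  by apply: measurable_fun_limn_esup => n; apply/measurable_EFinP; exact: L2per_mf3 (lF n).
have Fl : {ae leb3, forall x : R3 R, H x -> F n x @[n --> \oo] --> l x}.
  have := riesz_fischer_ae mH sF Fc; apply: ae3S => x + Hx => /(_ Hx) cF.
  have -> // : l x = limn (fun n => F n x).
  rewrite /l is_cvg_limn_esupE; last first.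
    by apply/cvg_ex; exists (limn (fun n => F n x))%:E; apply: cvg_EFin => //; exact: nearW.
  by rewrite EFin_lim.
have pl : lattice_periodic g l.
  move=> k lk.
  have : {ae leb3, forall x : R3 R, forall n, F n (x + k) = F n x}.
    by apply: ae3_foralln => n; case: (lF n) => _ + _; apply.
  by apply: ae3S => x e; rewrite /l; congr (fine (limn_esup _)); apply/funext => n; rewrite e.
have mlH : measurable_fun (H : set (E R)) l by exact: measurable_funTS.
have sl := riesz_fischer_sqint mH sF Fc mlH Fl.
exists l => //; have le := riesz_fischer_dot mH sF Fc mlH Fl.
apply: (@squeeze_cvgr _ _ _ _ (fun=> 0) (fun n => 4 * c * 2^-1 ^+ n)).
- by apply: nearW => n; rewrite dot_ge0 le.
- exact: cvg_cst.
- rewrite -(mulr0 (4 * c)); apply: cvgMr; apply: cvg_expr.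
  by rewrite ger0_norm// invf_lt1 ?ltr1n.
Qed.

(** The integrals are inner products on a cube containing the support of [p], where the squared norm
    is at most a fixed multiple of that on the cell. *)
Lemma cvg_integral_bounded_support (F : nat -> R3 R -> R) f p :
  (forall n, L2per g (F n)) -> L2per g f -> cvgL2 leb3 H F f -> bounded_support p ->
  \int[leb3]_x (F n x * p x) @[n --> \oo] --> \int[leb3]_x (f x * p x).
Proof.
move=> lF lf Ff bp; have [mp [r [M [pM pr]]]] := bp.
have mC : measurable (cube r : set (E R)) by exact: measurable_cube.
have E h : mf3 h -> \int[leb3]_x (h x * p x) = dot leb3 (cube r) h p.
  move=> mh; rewrite /dot /Rintegral [in RHS]integral_mkcond; congr fine.
  apply: eq_integral => x _; rewrite /patch; case: ifPn => // /negP xc.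
  by rewrite pr ?mulr0// => cx; apply: xc; rewrite inE.
have sp : sqint leb3 (cube r) p.
  split; first exact: measurable_funTS.
  apply: (@le_lt_trans _ _ (\int[leb3]_(x in cube r) (M ^+ 2)%:E)%E).
    apply: ge0_le_integral => //.
    - by move=> x _; rewrite lee_fin sqr_ge0.
    - exact: measurable_sqrE.
    - by move=> x _; rewrite lee_fin -real_normK ?num_real// lerXn2r// nnegrE// (le_trans _ (pM x)).
  rewrite integral_cst// lte_mul_pinfty ?lee_fin ?sqr_ge0//; exact: leb3_cube_lty.
under eq_fun do rewrite (E _ (L2per_mf3 (lF _))).
rewrite (E _ (L2per_mf3 lf)).
apply: (cvg_dot mC) => //.
- by move=> n; exact: (L2per_sqint_cube hg (lF n) r).
- exact: (L2per_sqint_cube hg lf r).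
- have [N NP] := periodic_cube_le hg r.
  apply: (@squeeze_cvgr _ _ _ _ (fun=> 0) (fun n => N%:R * << fun x => F n x - f x >>)).
  + apply: nearW => n; rewrite dot_ge0/=; have lD := L2perB (lF n) lf.
    rewrite -lee_fin dot_sqr//; last exact: (L2per_sqint_cube hg lD r).
    rewrite EFinM dot_sqr//; last exact: L2per_sqint lD.
    have [mD pD _] := lD.
    apply: (NP (fun x => ((F n x - f x) ^+ 2)%:E)).
    * exact: measurable_sqrE.
    * by move=> x; rewrite lee_fin sqr_ge0.
    * by move=> k /pD; apply: ae3S => x ->.
  + exact: cvg_cst.
  + by rewrite -(mulr0 N%:R); apply: cvgMr.
- rewrite /cvgL2; have -> : (fun x => p x - p x) = fun=> 0 by apply/funext => x; rewrite subrr.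
  suff -> : dot leb3 (cube r) (fun=> 0) (fun=> 0) = 0 :> R by exact: cvg_cst.
  by rewrite /dot; under eq_Rintegral do rewrite mulr0; rewrite /Rintegral integral0.
Qed.

Lemma is_wderiv_closed j (F W : nat -> R3 R -> R) f w :
  (forall n, L2per g (F n)) -> (forall n, L2per g (W n)) -> L2per g f -> L2per g w ->
  cvgL2 leb3 H F f -> cvgL2 leb3 H W w ->
  (forall n, is_wderiv j (F n) (W n)) -> is_wderiv j f w.
Proof.
move=> lF lW lf lw Ff Ww FW p tp.
have c1 := cvg_integral_bounded_support lF lf Ff (test_function_derive_bounded j tp).
have c2 := cvg_integral_bounded_support lW lw Ww (test_function_bounded tp).
have e : (fun n => \int[leb3]_x (F n x * 'D_(stdbasis j) p x)) =
    (fun n => - \int[leb3]_x (W n x * p x)).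
  by apply/funext => n; exact: FW.
rewrite e in c1; apply: (cvg_unique _ c1); first exact: Rhausdorff.
exact: cvgN.
Qed.

End PeriodicLimits.

(** * Periodic H^1 fields, affine fields and their strains *)

Section PeriodicFields.
Context {R : realType}.
Implicit Types (x y v : R3 R) (f h w : R3 R -> R) (i j k : 'I_3) (A : 'M[R]_3).
Implicit Types (u phi psi : R3 R -> 'cV[R]_3).
Variables (g : 'I_3 -> R3 R) (hg : lin_indep g).

Notation mf3 f := (measurable_fun (setT : set (E R)) (f : E R -> R)).
Notation H := (halfcell g).

Let mH : measurable H.
Proof. exact: measurable_halfcell. Qed.

Lemma ae3_forall (I : countType) (P : I -> R3 R -> Prop) :
  (forall a : I, {ae leb3, forall x : R3 R, P a x}) ->
  {ae leb3, forall x : R3 R, forall a : I, P a x}.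
Proof.
move=> HP; pose Q n x := forall a : I, unpickle n = Some a -> P a x.
have : {ae leb3, forall x : R3 R, forall n, Q n x}.
  apply: ae3_foralln => n; rewrite /Q; case: (unpickle n) => [i|].
    by apply: ae3S (HP i) => x Px k [<-].
  by apply: aeW => x.
by apply: ae3S => x Qx i; apply: (Qx (pickle i)); rewrite pickleK.
Qed.

Lemma L2loc_loc1 f : L2loc f -> loc1 f.
Proof. by move=> /L2locP[]; exact: sqint_loc1. Qed.

Lemma L2per_L2loc f : L2per g f -> L2loc f.
Proof. by move=> lf; apply/L2locP; split; [exact: L2per_mf3 lf|exact: (L2per_sqint_cube hg lf)]. Qed.

Lemma L2loc_per f : L2loc f -> lattice_periodic g f -> L2per g f.
Proof. by move=> /L2locP[mf sf] pf; split => //; exact: sqint_cube_halfcell. Qed.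

Lemma wderivP j f : (exists h, L2loc h /\ is_wderiv j f h) ->
  L2loc (wderiv j f) /\ is_wderiv j f (wderiv j f).
Proof. by move=> ex; exact: (xgetPex _ ex). Qed.

Lemma wderiv_ae j f h : L2loc h -> is_wderiv j f h ->
  {ae leb3, forall x : R3 R, wderiv j f x = h x}.
Proof.
move=> lh fh; have [lw fw] := wderivP (ex_intro _ h (conj lh fh)).
exact: is_wderiv_unique (L2loc_loc1 lw) (L2loc_loc1 lh) fw fh.
Qed.

(** The representative is chosen without regard to periodicity, but its lattice translates are weak
    derivatives of the same function, so uniqueness applies. *)
Lemma L2per_wderiv j f : L2per g f -> (exists h, L2loc h /\ is_wderiv j f h) ->
  L2per g (wderiv j f).
Proof.
move=> lf /wderivP[lw fw]; apply: L2loc_per => // k lk.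
have lw1 := L2loc_loc1 lw; have [mw _] := lw1.
have lwk := loc1_translate k lw1; have [mwk _] := lwk.
have [mf pf _] := lf; have mfk := measurable_comp_translate k mf.
apply: (is_wderiv_unique (j := j) (f := f)) => //.
apply: (is_wderiv_ae mfk mf mwk mwk (pf k lk)); first by apply: aeW.
exact: is_wderiv_translate.
Qed.

Lemma H1per_component phi i : H1per g phi -> L2per g (component phi i).
Proof.
move=> [H1 pp]; apply: L2loc_per; first by case: (H1 i).
by move=> k lk; apply: ae3S (pp k lk) => x; rewrite /component => ->.
Qed.

Lemma H1per_wderiv phi i j : H1per g phi ->
  L2per g (wderiv j (component phi i)) /\
  is_wderiv j (component phi i) (wderiv j (component phi i)).
Proof.
move=> hp; have lp := H1per_component i hp; have [H1 _] := hp.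
have ex := (H1 i).2 j; split; first exact: L2per_wderiv.
by have [] := wderivP ex.
Qed.

Lemma H1perI phi : (forall i, L2per g (component phi i)) ->
  (forall i j, exists2 h, L2per g h & is_wderiv j (component phi i) h) -> H1per g phi.
Proof.
move=> lp wp; split.
  move=> i; split; first exact: L2per_L2loc.
  by move=> j; have [h lh ph] := wp i j; exists h; split => //; exact: L2per_L2loc.
move=> k lk.
have : {ae leb3, forall x : R3 R, forall i, component phi i (x + k) = component phi i x}.
  by apply: ae3_forall => i; case: (lp i) => _ + _; apply.
by apply: ae3S => x e; apply/matrixP => i c; rewrite ord1; exact: e.
Qed.

Lemma componentD phi psi (c : R) i :
  component (fun y => phi y + c *: psi y) i =
  (fun y => component phi i y + c * component psi i y).
Proof. by apply/funext => y; rewrite /component !mxE. Qed.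

Lemma is_wderiv_lin j f h w (k : R3 R -> R) (c : R) : loc1 f -> loc1 h -> loc1 w -> loc1 k ->
  is_wderiv j f w -> is_wderiv j h k ->
  is_wderiv j (fun x => f x + c * h x) (fun x => w x + c * k x).
Proof.
by move=> lf lh lw lk fw hk; apply: is_wderivD => //; [exact: loc1Z|exact: loc1Z|exact: is_wderivZ].
Qed.

Lemma H1per_wderiv_lin phi psi (c : R) i j : H1per g phi -> H1per g psi ->
  is_wderiv j (component (fun y => phi y + c *: psi y) i)
    (fun x => wderiv j (component phi i) x + c * wderiv j (component psi i) x).
Proof.
move=> hp hq; rewrite componentD.
have [lw fw] := H1per_wderiv i j hp; have [lk hk] := H1per_wderiv i j hq.
by apply: is_wderiv_lin => //; apply: (L2per_loc1 hg) => //; exact: H1per_component.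
Qed.

Lemma H1per_lin phi psi (c : R) : H1per g phi -> H1per g psi ->
  H1per g (fun y => phi y + c *: psi y).
Proof.
move=> hp hq; apply: H1perI => [i|i j].
  by rewrite componentD; apply: L2perD; [|apply: L2perZ]; exact: H1per_component.
exists (fun x => wderiv j (component phi i) x + c * wderiv j (component psi i) x).
  by apply: L2perD; [|apply: L2perZ]; exact: (H1per_wderiv i j _).1.
exact: H1per_wderiv_lin.
Qed.

(** Strains are built from chosen representatives, so identities between them are obtained almost
    everywhere, entry by entry. *)
Lemma strain_ae u (G : R3 R -> 'M[R]_3) :
  (forall i j, {ae leb3, forall x : R3 R, wderiv j (component u i) x = G x i j}) ->
  {ae leb3, forall x : R3 R, strain u x = 2^-1 *: (G x + (G x)^T)}.
Proof.
move=> uG.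
have : {ae leb3, forall x : R3 R, forall ij : 'I_3 * 'I_3,
    wderiv ij.2 (component u ij.1) x = G x ij.1 ij.2}.
  by apply: ae3_forall => -[i j]; exact: uG.
apply: ae3S => x e; rewrite /strain; congr (_ *: (_ + _^T));
  by apply/matrixP => i j; rewrite mxE (e (i, j)).
Qed.

Lemma strain_lin phi psi (c : R) : H1per g phi -> H1per g psi ->
  {ae leb3, forall x : R3 R,
    strain (fun y => phi y + c *: psi y) x = strain phi x + c *: strain psi x}.
Proof.
move=> hp hq.
have : {ae leb3, forall x : R3 R, strain (fun y => phi y + c *: psi y) x =
    2^-1 *: ((grad phi x + c *: grad psi x) + (grad phi x + c *: grad psi x)^T)}.
  apply: strain_ae => i j.
  have lw : L2loc (fun x => wderiv j (component phi i) x + c * wderiv j (component psi i) x).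
    apply: L2per_L2loc.
    by apply: L2perD; [|apply: L2perZ]; exact: (H1per_wderiv i j _).1.
  have := wderiv_ae lw (H1per_wderiv_lin c i j hp hq).
  by apply: ae3S => x ->; rewrite !mxE.
apply: ae3S => x ->; rewrite /strain linearD/= linearZ/=.
move: (grad phi x) (grad psi x) => G K; apply/matrixP => i j; rewrite !mxE; ring.
Qed.

Definition affine A y : 'cV[R]_3 := A *m posvec y.

Lemma component_affine A i : component (affine A) i = fun y => \sum_k A i k * coord3 k y.
Proof. by apply/funext => y; rewrite /component /affine mxE. Qed.

Lemma continuous_affine A i : continuous (component (affine A) i).
Proof.
rewrite component_affine; elim: (index_enum _) => [|k r IH] x.
  by under eq_fun do rewrite big_nil; exact: cvg_cst.
under eq_fun do rewrite big_cons.
by apply: cvgD; [apply: cvgMr; exact: continuous_coord3|exact: IH].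
Qed.

Lemma L2loc_continuous f : continuous f -> L2loc f.
Proof.
move=> cf; have cf2 : continuous (fun x => f x * f x) by move=> x; apply: cvgM; exact: cf.
have [_ f2] := continuous_loc1 cf2; have mf := continuous_measurable3 cf.
apply/L2locP; split=> // r; split; first exact: measurable_funTS.
apply: le_lt_trans (f2 r); rewrite le_eqVlt; apply/orP; left; apply/eqP.
by apply: eq_integral => x _; rewrite -expr2 ger0_norm ?sqr_ge0.
Qed.

Lemma is_wderiv_sum (I : Type) (r : seq I) (F W : I -> R3 R -> R) j :
  (forall a, loc1 (F a)) -> (forall a, loc1 (W a)) -> (forall a, is_wderiv j (F a) (W a)) ->
  is_wderiv j (fun x => \sum_(a <- r) F a x) (fun x => \sum_(a <- r) W a x).
Proof.
move=> lF lW FW.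
have ls (K : I -> R3 R -> R) s : (forall a, loc1 (K a)) -> loc1 (fun x => \sum_(a <- s) K a x).
  move=> lK; elim: s => [|b s IH].
    by under eq_fun do rewrite big_nil; exact: loc1_cst.
  by under eq_fun do rewrite big_cons; exact: loc1D.
have n0 (K : I -> R3 R -> R) : (fun x => \sum_(a <- [::]) K a x) = fun=> 0.
  by apply/funext => x; rewrite big_nil.
have nS (K : I -> R3 R -> R) b s : (fun x => \sum_(a <- b :: s) K a x) =
    fun x => K b x + \sum_(a <- s) K a x.
  by apply/funext => x; rewrite big_cons.
elim: r => [|b r IH]; first by rewrite !n0; exact: is_wderiv_cst.
by rewrite !nS; apply: is_wderivD => //; exact: ls.
Qed.

Lemma is_wderiv_affine A i j : is_wderiv j (component (affine A) i) (fun=> A i j).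
Proof.
rewrite component_affine.
have -> : (fun=> A i j) = (fun _ : R3 R => \sum_k A i k * (k == j)%:R) :> (R3 R -> R).
  apply/funext => x; rewrite (bigD1 j)//= eqxx mulr1 big1 ?addr0// => k /negbTE ->.
  by rewrite mulr0.
have lc k := continuous_loc1 (@continuous_coord3 R k).
apply: is_wderiv_sum => k; [exact: loc1Z|exact: loc1_cst|].
by apply: is_wderivZ => //; [exact: loc1_cst|exact: is_wderiv_coord].
Qed.

(** The factor 1 gives the sum the shape treated by [is_wderiv_lin]. *)
Lemma component_LPof A u phi i : (forall y, u y = A *m posvec y + phi y) ->
  component u i = fun y => component (affine A) i y + 1 * component phi i y.
Proof. by move=> uE; apply/funext => y; rewrite /component uE mul1r mxE. Qed.

Lemma L2loc_affine A i : L2loc (component (affine A) i).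
Proof. by apply: L2loc_continuous; exact: continuous_affine. Qed.

Lemma is_wderiv_LPof A u phi i j : H1per g phi ->
  (forall y, u y = A *m posvec y + phi y) ->
  is_wderiv j (component u i) (fun x => A i j + 1 * wderiv j (component phi i) x).
Proof.
move=> hp uE; rewrite (component_LPof i uE).
have [lw fw] := H1per_wderiv i j hp.
apply: is_wderiv_lin => //.
- exact: L2loc_loc1 (L2loc_affine A i).
- exact: (L2per_loc1 hg (H1per_component i hp)).
- exact: loc1_cst.
- exact: (L2per_loc1 hg lw).
- exact: is_wderiv_affine.
Qed.

Lemma L2per_LPof_wderiv A phi i j : H1per g phi ->
  L2per g (fun x => A i j + 1 * wderiv j (component phi i) x).
Proof.
move=> hp; apply: L2perD; first exact: L2per_cst.
by apply: L2perZ; exact: (H1per_wderiv i j hp).1.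
Qed.

Lemma measurable_strain_LPof A u phi i j : H1per g phi ->
  (forall y, u y = A *m posvec y + phi y) -> mf3 (fun y => strain u y i j).
Proof.
move=> hp uE.
have m a b : mf3 (wderiv b (component u a)).
  have ex : exists h, L2loc h /\ is_wderiv b (component u a) h.
    exists (fun x => A a b + 1 * wderiv b (component phi a) x).
    by split; [exact: L2per_L2loc (L2per_LPof_wderiv A a b hp)|exact: is_wderiv_LPof].
  by have [/L2locP[]] := wderivP ex.
rewrite (_ : (fun y => _) = fun y =>
  2^-1 * (wderiv j (component u i) y + wderiv i (component u j) y)).
  by apply: measurable_funM => //; exact: measurable_funD.
by apply/funext => x; rewrite !mxE.
Qed.

Lemma strain_LPof A u phi : A^T = A -> H1per g phi ->
  (forall y, u y = A *m posvec y + phi y) ->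
  {ae leb3, forall x : R3 R, strain u x = A + strain phi x}.
Proof.
move=> hA hp uE.
have : {ae leb3, forall x : R3 R,
    strain u x = 2^-1 *: ((A + grad phi x) + (A + grad phi x)^T)}.
  apply: strain_ae => i j.
  have := wderiv_ae (L2per_L2loc (L2per_LPof_wderiv A i j hp)) (is_wderiv_LPof i j hp uE).
  by apply: ae3S => x ->; rewrite !mxE mul1r.
apply: ae3S => x ->; rewrite /strain [(A + _)^T]linearD/= hA.
move: (grad phi x) => G; apply/matrixP => i j; rewrite !mxE; by field.
Qed.

Lemma L2per_strain phi i j : H1per g phi -> L2per g (fun x => strain phi x i j).
Proof.
move=> hp; rewrite (_ : (fun x => strain phi x i j) = fun x =>
  2^-1 * (wderiv j (component phi i) x + wderiv i (component phi j) x)).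
  by apply: L2perZ; apply: L2perD; exact: (H1per_wderiv _ _ hp).1.
by apply/funext => x; rewrite !mxE.
Qed.

End PeriodicFields.

(** * The variational problem *)

Section BilinearForm.
Context {R : realType}.
Implicit Types (x y v : R3 R) (f h : R3 R -> R) (i j k l : 'I_3).
Implicit Types (E F K : R3 R -> 'M[R]_3).
Variable g : 'I_3 -> R3 R.

Notation mf3 f := (measurable_fun (setT : set (E R)) (f : E R -> R)).
Notation H := (halfcell g).
Notation "<< f , h >>" := (dot leb3 H f h).

Let mH : measurable H.
Proof. exact: measurable_halfcell. Qed.

Lemma Lfun_oo_bounded f : f \in Lfun leb3 +oo%E ->
  mf3 f /\ exists M : R, {ae leb3, forall x : R3 R, `|f x| <= M}.
Proof.
rewrite inE => /andP[/[!inE] mf fN]; split; first exact: mf.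
(* The norm is defined separately on a space of measure zero, where any bound holds almost
   everywhere. *)
move: fN; rewrite /finite_norm unlock /=; case: ifPn => [_ fN|T0 _]; last first.
  exists 0; exists setT; split => //.
  by apply/eqP; rewrite eq_le measure_ge0 andbT leNgt.
have [M fM] : exists M : R, (ess_sup leb3 (abse \o (EFin \o f)) <= M%:E)%E.
  by move: fN; set s := ess_sup leb3 _; case: s => [r _|//|_]; [exists r|exists 0; rewrite leNye].
by exists M; move/ess_supP : fM; apply: ae3S => x; rewrite /= lee_fin.
Qed.

Lemma sqint_mul_bounded f h : f \in Lfun leb3 +oo%E -> sqint leb3 H h ->
  sqint leb3 H (fun x => f x * h x).
Proof.
move=> /Lfun_oo_bounded[mf [M fM]] sh; have [mh _] := sh.
have mfh : measurable_fun (H : set (E R)) (fun x => f x * h x).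
  by apply: measurable_funM => //; exact: measurable_funTS.
split=> //; have [mMh] := sqintZ mH M sh; apply: le_lt_trans.
apply: ae_ge0_le_integral => //.
- by move=> x _; rewrite lee_fin sqr_ge0.
- by apply/measurable_EFinP; exact: measurable_funX.
- by move=> x _; rewrite lee_fin sqr_ge0.
- by apply/measurable_EFinP; exact: measurable_funX.
apply: ae3S fM => x fxM _; rewrite lee_fin !exprMn ler_wpM2r ?sqr_ge0//.
by rewrite -real_normK ?num_real// lerXn2r// nnegrE// (le_trans _ fxM).
Qed.

Lemma Rintegral_sum (I : Type) (r : seq I) (F : I -> R3 R -> R) :
  (forall a, leb3.-integrable H (EFin \o F a)) ->
  leb3.-integrable H (EFin \o (fun x => \sum_(a <- r) F a x)) /\
  \int[leb3]_(x in H) (\sum_(a <- r) F a x) = \sum_(a <- r) \int[leb3]_(x in H) F a x.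
Proof.
move=> iF; elim: r => [|b r [IH1 IH2]].
  split.
    rewrite (_ : EFin \o _ = cst 0%E); first exact: integrable0.
    by apply/funext => x /=; rewrite big_nil.
  rewrite big_nil; under eq_Rintegral do rewrite big_nil.
  by rewrite /Rintegral integral0.
split.
  rewrite (_ : EFin \o _ = (fun x => (F b x)%:E + (\sum_(a <- r) F a x)%:E)%E).
    exact: (integrableD mH (iF b) IH1).
  by apply/funext => x /=; rewrite big_cons EFinD.
rewrite big_cons -IH2 -RintegralD//.
by apply: eq_Rintegral => x _; rewrite big_cons.
Qed.

Lemma mxdotE (M N : 'M[R]_3) : mxdot M N = \sum_i \sum_j M i j * N i j.
Proof.
rewrite /mxdot /mxtrace exchange_big; apply: eq_bigr => j _.
by rewrite mxE; apply: eq_bigr => i _; rewrite mxE.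
Qed.

Lemma mxdotC (M N : 'M[R]_3) : mxdot M N = mxdot N M.
Proof.
by rewrite !mxdotE; apply: eq_bigr => i _; apply: eq_bigr => j _; rewrite mulrC.
Qed.

Lemma mxdot_linl (M N K : 'M[R]_3) c : mxdot (M + c *: N) K = mxdot M K + c * mxdot N K.
Proof.
by rewrite /mxdot [(M + _)^T]linearD/= [(c *: N)^T]linearZ/= mulmxDl -scalemxAl mxtraceD mxtraceZ.
Qed.

Lemma tensor_actD (T : tensor4 R) (M N : 'M[R]_3) :
  tensor_act T (M + N) = tensor_act T M + tensor_act T N.
Proof.
apply/matrixP => i j; rewrite !mxE -big_split; apply: eq_bigr => k _.
by rewrite -big_split; apply: eq_bigr => l _; rewrite mxE mulrDr.
Qed.

Lemma tensor_actZ (T : tensor4 R) c (M : 'M[R]_3) :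
  tensor_act T (c *: M) = c *: tensor_act T M.
Proof.
apply/matrixP => i j; rewrite !mxE mulr_sumr; apply: eq_bigr => k _.
by rewrite mulr_sumr; apply: eq_bigr => l _; rewrite mxE mulrCA.
Qed.

Definition sqmx E := forall i j, sqint leb3 H (fun y => E y i j).

Definition mdot E F : R := \int[leb3]_(y in H) mxdot (E y) (F y).

Lemma sqmx_lin E F c : sqmx E -> sqmx F -> sqmx (fun y => E y + c *: F y).
Proof.
move=> sE sF i j; rewrite (_ : (fun y => _) = fun y => E y i j + c * F y i j).
  by apply: sqintD => //; exact: sqintZ.
by apply/funext => y; rewrite !mxE.
Qed.

Lemma mdot_integrable E F : sqmx E -> sqmx F ->
  leb3.-integrable H (EFin \o (fun y => mxdot (E y) (F y))).
Proof.
move=> sE sF; under eq_fun do rewrite mxdotE.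
have iM i j : leb3.-integrable H (EFin \o (fun y => E y i j * F y i j)).
  exact: sqint_integrableM.
by apply: (Rintegral_sum _ _).1 => i; exact: (Rintegral_sum _ _).1.
Qed.

Lemma mdotE E F : sqmx E -> sqmx F ->
  mdot E F = \sum_i \sum_j << fun y => E y i j, fun y => F y i j >>.
Proof.
move=> sE sF; rewrite /mdot; under eq_Rintegral do rewrite mxdotE.
have iM i j : leb3.-integrable H (EFin \o (fun y => E y i j * F y i j)).
  exact: sqint_integrableM.
have iS i := Rintegral_sum (index_enum 'I_3) (iM i).
rewrite (Rintegral_sum _ (fun i => (iS i).1)).2.
by apply: eq_bigr => i _; exact: (iS i).2.
Qed.

Lemma mdotC E F : mdot E F = mdot F E.
Proof. by apply: eq_Rintegral => y _; rewrite mxdotC. Qed.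

Lemma mdot_linl E F K c : sqmx E -> sqmx F -> sqmx K ->
  mdot (fun y => E y + c *: F y) K = mdot E K + c * mdot F K.
Proof.
move=> sE sF sK; rewrite !mdotE//; last exact: sqmx_lin.
rewrite mulr_sumr -big_split; apply: eq_bigr => i _.
rewrite mulr_sumr -big_split; apply: eq_bigr => j _.
rewrite /= -(dotZl mH c (sF i j) (sK i j)) -(dotDl mH (sE i j) (sqintZ mH c (sF i j)) (sK i j)).
by congr dot; apply/funext => y; rewrite !mxE.
Qed.

Lemma mdot_ae E E' F F' : sqmx E -> sqmx E' -> sqmx F -> sqmx F' ->
  {ae leb3, forall x : R3 R, E x = E' x} -> {ae leb3, forall x : R3 R, F x = F' x} ->
  mdot E F = mdot E' F'.
Proof.
move=> sE sE' sF sF' EE FF; rewrite !mdotE//.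
apply: eq_bigr => i _; apply: eq_bigr => j _; apply: ae_eq_dot => //.
  by apply: ae3S EE => x ->.
by apply: ae3S FF => x ->.
Qed.

Lemma Rintegral_ae_ge0 f : leb3.-integrable H (EFin \o f) ->
  {ae leb3, forall x : R3 R, 0 <= f x} -> 0 <= \int[leb3]_(x in H) f x.
Proof.
move=> /integrableP[mf _] f0.
rewrite /Rintegral (_ : integral _ _ _ = \int[leb3]_(x in H) `|(f x)%:E|)%E.
  by rewrite fine_ge0// integral_ge0.
apply: ae_eq_integral => //; first exact: measurableT_comp.
by apply: ae3S f0 => x fx _ /=; rewrite ger0_norm.
Qed.

Variables (C : R3 R -> tensor4 R) (hC : rigidity g C).

Definition act E y : 'M[R]_3 := tensor_act (C y) (E y).

Lemma sqmx_act E : sqmx E -> sqmx (act E).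
Proof.
move=> sE i j; have [_ Coo _ _] := hC.
rewrite (_ : (fun y => _) = fun y => \sum_k \sum_l C y i j k l * E y k l).
  by apply: sqint_sum => // k; apply: sqint_sum => // l; exact: sqint_mul_bounded.
by apply/funext => y; rewrite /act mxE.
Qed.

Lemma act_lin E F c : act (fun y => E y + c *: F y) = (fun y => act E y + c *: act F y).
Proof. by apply/funext => y; rewrite /act tensor_actD tensor_actZ. Qed.

(** Carried along because [rigidity] constrains the action of [C] on symmetric matrices only. *)
Definition aesym E := {ae leb3, forall x : R3 R, (E x)^T = E x}.

Definition bform E F : R := mdot (act E) F.

Lemma bformC E F : sqmx E -> sqmx F -> aesym E -> aesym F -> bform E F = bform F E.
Proof.
move=> sE sF aE aF; rewrite /bform [RHS]mdotC.
have [_ _ Csym _] := hC.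
have [sCE sCF] := (sqmx_act sE, sqmx_act sF).
rewrite /mdot; congr fine; apply: ae_eq_integral => //.
- by case/integrableP: (mdot_integrable sCE sF).
- by case/integrableP: (mdot_integrable sE sCF).
have : {ae leb3, forall x : R3 R, (E x)^T = E x /\ (F x)^T = F x} by exact: ae3S2 aE aF.
by move=> aEF; apply: ae3S2 aEF Csym => x [e1 e2] Cx _; rewrite /act Cx.
Qed.

Lemma bform_linl E F K c : sqmx E -> sqmx F -> sqmx K ->
  bform (fun y => E y + c *: F y) K = bform E K + c * bform F K.
Proof.
by move=> sE sF sK; rewrite /bform act_lin mdot_linl//; exact: sqmx_act.
Qed.

Lemma bform_linr E F K c : sqmx E -> sqmx F -> sqmx K ->
  bform K (fun y => E y + c *: F y) = bform K E + c * bform K F.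
Proof.
move=> sE sF sK; rewrite /bform mdotC mdot_linl//; last exact: sqmx_act.
by rewrite ![mdot _ (act K)]mdotC.
Qed.

Lemma bform_sqr E F c : sqmx E -> sqmx F -> aesym E -> aesym F ->
  bform (fun y => E y + c *: F y) (fun y => E y + c *: F y) =
  bform E E + 2 * c * bform E F + c ^+ 2 * bform F F.
Proof.
move=> sE sF aE aF; rewrite bform_linl//; last exact: sqmx_lin.
rewrite !bform_linr// (bformC sF sE)//; ring.
Qed.

Lemma bform_ae E E' F F' : sqmx E -> sqmx E' -> sqmx F -> sqmx F' ->
  {ae leb3, forall x : R3 R, E x = E' x} -> {ae leb3, forall x : R3 R, F x = F' x} ->
  bform E F = bform E' F'.
Proof.
move=> sE sE' sF sF' EE FF; apply: mdot_ae => //; try exact: sqmx_act.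
by apply: ae3S EE => x e; rewrite /act e.
Qed.

Lemma bform_coercive : exists2 a : R, 0 < a & forall E, sqmx E -> aesym E ->
  a * mdot E E <= bform E E.
Proof.
have [_ _ _ [a a0 Ca]] := hC; exists a => // E sE aE.
have sCE := sqmx_act sE; rewrite -subr_ge0.
have -> : bform E E - a * mdot E E = mdot (fun y => act E y + (- a) *: E y) E.
  by rewrite mdot_linl// mulNr.
apply: Rintegral_ae_ge0; first by apply: mdot_integrable => //; exact: sqmx_lin.
apply: ae3S2 aE Ca => x e /(_ _ e); rewrite -subr_ge0 => le.
by rewrite mxdot_linl mulNr.
Qed.

End BilinearForm.

(** * Control of fields and gradients by strains *)

Section Ellipticity.
Context {R : realType}.
Implicit Types (x y : R3 R) (i j : 'I_3) (phi psi : R3 R -> 'cV[R]_3).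
Variables (g : 'I_3 -> R3 R) (hg : lin_indep g).

Notation H := (halfcell g).
Notation "<< f , h >>" := (dot leb3 H f h).
Notation "<< f >>" := (dot leb3 H f f).
Notation D_ phi i j := (wderiv j (component phi i)).

Let mH : measurable H.
Proof. exact: measurable_halfcell. Qed.

(* The mean is taken over the half-open cell and is not divided by its volume. *)
Definition mean_on phi (m : 'I_3 -> R) := forall i, << component phi i, fun=> 1 >> = m i.

Lemma le_sum1 (I : finType) (F : I -> R) a : (forall b, 0 <= F b) -> F a <= \sum_b F b.
Proof. by move=> F0; rewrite (bigD1 a)//= lerDl sumr_ge0. Qed.

Lemma sqmx_strain phi : H1per g phi -> sqmx g (strain phi).
Proof. by move=> hp i j; exact: L2per_sqint (L2per_strain hg i j hp). Qed.

Lemma aesym_strain phi : aesym (strain phi).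
Proof.
apply: aeW => x; rewrite /strain; move: (grad phi x) => G.
by apply/matrixP => i j; rewrite !mxE addrC.
Qed.

Lemma mdot_strainE phi : H1per g phi -> mdot g (strain phi) (strain phi) =
  \sum_i \sum_j << fun x => 2^-1 * (D_ phi i j x + D_ phi j i x) >>.
Proof.
move=> hp; have ss := sqmx_strain hp; rewrite mdotE//.
apply: eq_bigr => i _; apply: eq_bigr => j _.
by congr dot; apply/funext => x; rewrite !mxE.
Qed.

Lemma H1_strain_le : exists2 K : R, 0 < K & forall phi, H1per g phi ->
  mean_on phi (fun=> 0) ->
  (forall i, << component phi i >> <= K * mdot g (strain phi) (strain phi)) /\
  (forall i j, << D_ phi i j >> <= K * mdot g (strain phi) (strain phi)).
Proof.
pose q : R := 2 * cell_radius g ^+ 2.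
have q0 : 0 <= q by rewrite mulr_ge0// sqr_ge0.
(* One constant for both bounds: Korn gives 2 for the gradient, Poincaré multiplies it by [q] for
   the field. *)
exists (2 * (q + 1)) => [|phi hp mp]; first by rewrite mulr_gt0// ltr_wpDl.
have lc i := H1per_component hg i hp.
have lw i j : L2per g (D_ phi i j) := (H1per_wderiv hg i j hp).1.
have dw i j : is_wderiv j (component phi i) (D_ phi i j) := (H1per_wderiv hg i j hp).2.
have S0 i : 0 <= \sum_j << D_ phi i j >> by apply: sumr_ge0 => j _; exact: dot_ge0.
have le i : \sum_j << D_ phi i j >> <= 2 * mdot g (strain phi) (strain phi).
  rewrite mdot_strainE//; apply: le_trans (korn hg lc lw dw).
  exact: (le_sum1 (F := fun i => \sum_j << D_ phi i j >>)).
have M0 : 0 <= 2 * mdot g (strain phi) (strain phi) by exact: le_trans (le ord0).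
rewrite [2 * _]mulrC -mulrA; move: (2 * mdot _ _ _) le M0 => M le M0.
split=> [i|i j].
  apply: le_trans (poincare hg (lc i) (lw i) (dw i) (mp i)) _.
  rewrite -/q; apply: (@le_trans _ _ (q * M)); first exact: ler_wpM2l.
  by rewrite mulrDl mul1r lerDl.
apply: (@le_trans _ _ M); last by rewrite mulrDl mul1r lerDr mulr_ge0.
apply: le_trans (le i); apply: (le_sum1 (F := fun j => << D_ phi i j >>)) => k.
exact: dot_ge0.
Qed.

Lemma dot_half_sum_le (a b : R3 R -> R) : sqint leb3 H a -> sqint leb3 H b ->
  << fun x => 2^-1 * (a x + b x) >> <= 2^-1 * << a >> + 2^-1 * << b >>.
Proof.
move=> sa sb; have sab := sqintD mH sa sb.
rewrite dotZl// ?dotZr//; last exact: sqintZ.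
have := dotDD_le mH sa sb.
lra.
Qed.

(** The easy converse of Korn's inequality, used to deduce convergence of strains from that of
    gradients. *)
Lemma mdot_strain_le phi : H1per g phi ->
  mdot g (strain phi) (strain phi) <= \sum_i \sum_j << D_ phi i j >>.
Proof.
move=> hp; rewrite mdot_strainE//.
have sw i j : sqint leb3 H (D_ phi i j) := L2per_sqint (H1per_wderiv hg i j hp).1.
apply: (@le_trans _ _ (\sum_i \sum_j (2^-1 * << D_ phi i j >> + 2^-1 * << D_ phi j i >>))).
  apply: ler_sum => i _; apply: ler_sum => j _.
  exact: dot_half_sum_le.
rewrite le_eqVlt; apply/orP; left; apply/eqP.
under eq_bigr do rewrite big_split.
rewrite big_split/= [X in _ + X]exchange_big/= -big_split/=.
apply: eq_bigr => i _; rewrite -big_split/=; apply: eq_bigr => j _.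
by rewrite -mulrDl -[X in X * _]mulr2n -[2^-1 *+ 2]mulr_natl divff// mul1r.
Qed.

End Ellipticity.

(** * Stationarity and uniqueness *)

Section Variational.
Context {R : realType}.
Implicit Types (x y : R3 R) (i j : 'I_3) (phi psi zeta : R3 R -> 'cV[R]_3).
Variables (g : 'I_3 -> R3 R) (hg : lin_indep g).
Variables (C : R3 R -> tensor4 R) (hC : rigidity g C).
Variables (A : 'M[R]_3) (hA : A^T = A) (m : 'I_3 -> R).

Notation H := (halfcell g).
Notation B := (bform g C).

Let mH : measurable H.
Proof. exact: measurable_halfcell. Qed.

(** The integrals [m] will be chosen to cancel those of A y over the cell, so that A y + phi has
    mean zero. *)
Definition admissible phi := H1per g phi /\ mean_on g phi m.
Definition admissible0 phi := H1per g phi /\ mean_on g phi (fun=> 0).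
Definition total_strain phi y := A + strain phi y.
Definition twice_energy phi := B (total_strain phi) (total_strain phi).

Let sqmx_A : sqmx g (fun=> A).
Proof. by move=> i j; exact: L2per_sqint (L2per_cst hg _). Qed.

Lemma sqmx_total_strain phi : H1per g phi -> sqmx g (total_strain phi).
Proof.
move=> hp; have := sqmx_lin 1 sqmx_A (sqmx_strain hg hp).
by congr sqmx; apply/funext => y; rewrite scale1r.
Qed.

Lemma aesym_total_strain phi : aesym (total_strain phi).
Proof.
by apply: ae3S (aesym_strain phi) => x e; rewrite linearD/= e hA.
Qed.

Lemma total_strain_lin phi psi c : H1per g phi -> H1per g psi ->
  {ae leb3, forall x : R3 R,
     total_strain (fun y => phi y + c *: psi y) x = total_strain phi x + c *: strain psi x}.
Proof.
by move=> hp hq; apply: ae3S (strain_lin hg c hp hq) => x e; rewrite /total_strain e addrA.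
Qed.

Lemma total_strain_linE phi psi zeta c : H1per g psi -> H1per g zeta ->
  (forall y, phi y = psi y + c *: zeta y) ->
  {ae leb3, forall x : R3 R, total_strain phi x = total_strain psi x + c *: strain zeta x}.
Proof. by move=> hp hq /funext ->; exact: total_strain_lin. Qed.

Lemma mean_lin phi psi (m1 m2 : 'I_3 -> R) c : H1per g phi -> H1per g psi ->
  mean_on g phi m1 -> mean_on g psi m2 ->
  mean_on g (fun y => phi y + c *: psi y) (fun i => m1 i + c * m2 i).
Proof.
move=> hp hq e1 e2 i; rewrite componentD.
have s1 := L2per_sqint (H1per_component hg i hp).
have s2 := L2per_sqint (H1per_component hg i hq).
have s3 : sqint leb3 H (fun=> 1 : R) := L2per_sqint (L2per_cst hg 1).
by rewrite dotDl// ?dotZl//; [rewrite e1 e2|exact: sqintZ].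
Qed.

Lemma admissible_lin phi zeta c : admissible phi -> admissible0 zeta ->
  admissible (fun y => phi y + c *: zeta y).
Proof.
move=> [hp mp] [hz mz]; split; first exact: H1per_lin.
by move=> i; have := mean_lin c hp hz mp mz i; rewrite mulr0 addr0.
Qed.

Lemma admissibleB phi psi : admissible phi -> admissible psi ->
  admissible0 (fun y => psi y + (-1) *: phi y).
Proof.
move=> [hp mp] [hz mz]; split; first exact: H1per_lin.
by move=> i; have := mean_lin (-1) hz hp mz mp i; rewrite mulN1r subrr.
Qed.

Lemma twice_energy_lin phi psi c : H1per g phi -> H1per g psi ->
  twice_energy (fun y => phi y + c *: psi y) =
  twice_energy phi + 2 * c * B (total_strain phi) (strain psi) + c ^+ 2 * B (strain psi) (strain psi).
Proof.
move=> hp hq; have sl := sqmx_lin c (sqmx_total_strain hp) (sqmx_strain hg hq).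
have st := sqmx_total_strain (H1per_lin hg c hp hq).
apply: etrans (bform_ae hC st sl st sl (total_strain_lin c hp hq) (total_strain_lin c hp hq)) _.
apply: (bform_sqr hC) (sqmx_total_strain hp) (sqmx_strain hg hq) _ _.
- exact: aesym_total_strain.
- exact: aesym_strain.
Qed.

Lemma B_strain_ge0 psi : H1per g psi -> 0 <= B (strain psi) (strain psi).
Proof.
move=> hq; have [a a0 aP] := bform_coercive hC.
have ss := sqmx_strain hg hq.
apply: le_trans (aP _ ss (aesym_strain psi)).
apply: mulr_ge0; first exact: ltW.
rewrite mdotE//; apply: sumr_ge0 => i _; apply: sumr_ge0 => j _; exact: dot_ge0.
Qed.

Definition weakly_stationary phi :=
  forall zeta, admissible0 zeta -> B (total_strain phi) (strain zeta) = 0.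

Lemma weakly_stationary_unique phi psi : admissible phi -> admissible psi ->
  weakly_stationary phi -> weakly_stationary psi ->
  {ae leb3, forall x : R3 R, phi x = psi x}.
Proof.
move=> ap aq wp wq.
have [d dE az] : exists2 d, (forall y, d y = phi y + (-1) *: psi y) & admissible0 d.
  by eexists; [|exact: (admissibleB aq ap)].
have [hz mz] := az.
have [[hp _] [hq _]] := (ap, aq).
have e : B (strain d) (strain d) = 0.
  have := wp _ az; have [sp sd] := (sqmx_total_strain hp, sqmx_strain hg hz).
  have sl := sqmx_lin 1 (sqmx_total_strain hq) sd.
  have te : {ae leb3, forall x : R3 R, total_strain phi x = total_strain psi x + 1 *: strain d x}.
    apply: total_strain_linE => // y.
    by rewrite dE scale1r scaleN1r addrC subrK.
  have dd : {ae leb3, forall x : R3 R, strain d x = strain d x} by apply: aeW.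
  have := etrans (bform_ae hC sp sl sd sd te dd) (bform_linl hC 1 (sqmx_total_strain hq) sd sd).
  by move=> ->; rewrite (wq _ az) mul1r add0r.
have [a a0 aP] := bform_coercive hC.
have [K K0 KP] := H1_strain_le hg.
have m0 : mdot g (strain d) (strain d) <= 0.
  by have := aP _ (sqmx_strain hg hz) (aesym_strain d); rewrite e pmulr_rle0.
have d0 i : {ae leb3, forall x : R3 R, component d i x = 0}.
  apply: (L2per_ae0 hg); first exact: H1per_component.
  apply/eqP; rewrite eq_le dot_ge0 andbT.
  by apply: le_trans ((KP d hz mz).1 i) _; rewrite pmulr_rle0.
apply: ae3S (ae3_forall d0) => x dx; apply/matrixP => i c; rewrite ord1.
by have := dx i; rewrite /component dE !mxE mulN1r => /eqP; rewrite subr_eq0 => /eqP.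
Qed.

Lemma quadratic_ge0 (b d : R) : 0 <= d ->
  (forall t, 0 <= 2 * t * b + t ^+ 2 * d) -> b = 0.
Proof.
move=> d0 le; have d1 : 0 < d + 1 by rewrite ltr_wpDl.
(* The minimizer would be -b/d, but [d] may vanish; at this [t] the value is -b^2 (d+2)/(d+1)^2. *)
have := le (- b / (d + 1)).
rewrite (_ : _ + _ = - (b ^+ 2 * ((d + 2) / (d + 1) ^+ 2))); last first.
  by field; rewrite gt_eqF.
rewrite oppr_ge0 pmulr_lle0; last by rewrite divr_gt0 ?exprn_gt0// ltr_wpDl.
by move=> b0; apply/eqP; rewrite -sqrf_eq0 eq_le b0 sqr_ge0.
Qed.

Lemma minimizer_weakly_stationary phi : admissible phi ->
  (forall psi, admissible psi -> twice_energy phi <= twice_energy psi) ->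
  weakly_stationary phi.
Proof.
move=> ap mp zeta az; have [[hp _] [hz _]] := (ap, az).
apply: (quadratic_ge0 (B_strain_ge0 hz)) => t.
by have := mp _ (admissible_lin t ap az); rewrite (twice_energy_lin t hp hz) -addrA lerDl.
Qed.

End Variational.

(** * Minimizing sequences and their limits *)

Section Existence.
Context {R : realType}.
Implicit Types (x y : R3 R) (i j : 'I_3) (phi psi d : R3 R -> 'cV[R]_3).
Variables (g : 'I_3 -> R3 R) (hg : lin_indep g).
Variables (C : R3 R -> tensor4 R) (hC : rigidity g C).
Variables (A : 'M[R]_3) (hA : A^T = A) (m : 'I_3 -> R).

Notation H := (halfcell g).
Notation "<< f , h >>" := (dot leb3 H f h).
Notation "<< f >>" := (dot leb3 H f f).
Notation D_ phi i j := (wderiv j (component phi i)).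
Notation B := (bform g C).
Notation admissible := (admissible g m).
Notation admissible0 := (admissible0 g).
Notation twice_energy := (twice_energy g C A).
Notation total_strain := (total_strain A).

Let mH : measurable H.
Proof. exact: measurable_halfcell. Qed.

(** A constant field with the prescribed integrals; the volume of the cell is nonzero. *)
Lemma admissible_nonempty : exists phi, admissible phi.
Proof.
have Hoo := leb3_halfcell_lty hg; have H0 := leb3_halfcell_gt0 hg.
pose v : R := fine (leb3 H); have v0 : v != 0 by rewrite gt_eqF// fine_gt0// H0.
exists (fun=> \col_i (m i / v)).
have ce i : component (fun=> \col_i (m i / v)) i = fun=> m i / v.
  by apply/funext => x; rewrite /component mxE.
split.
  apply: H1perI => [//|i|i j]; rewrite ce; first exact: L2per_cst.
  by exists (fun=> 0); [exact: L2per_cst|exact: is_wderiv_cst].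
move=> i; rewrite ce /dot /Rintegral.
under eq_integral do rewrite mulr1.
rewrite integral_cst//= -[leb3 H]fineK ?ge0_fin_numE// -EFinM/= -/v.
by rewrite divfK.
Qed.

Lemma twice_energy_ge0 phi : H1per g phi -> 0 <= twice_energy phi.
Proof.
move=> hp; have [a a0 aP] := bform_coercive hC.
have st := sqmx_total_strain hg A hp.
apply: le_trans (aP _ st (aesym_total_strain hA phi)).
apply: mulr_ge0; first exact: ltW.
rewrite mdotE//; apply: sumr_ge0 => i _; apply: sumr_ge0 => j _; exact: dot_ge0.
Qed.

Lemma twice_energy_linE phi psi d c : H1per g phi -> H1per g d ->
  (forall y, psi y = phi y + c *: d y) ->
  twice_energy psi =
  twice_energy phi + 2 * c * B (total_strain phi) (strain d) + c ^+ 2 * B (strain d) (strain d).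
Proof. by move=> hp hd /funext ->; exact: twice_energy_lin. Qed.

Lemma admissible_diff phi psi : admissible phi -> admissible psi ->
  exists2 d, (forall y, d y = psi y - phi y) & admissible0 d.
Proof.
move=> ap aq; exists (fun y => psi y + (-1) *: phi y); last exact: (admissibleB hg ap aq).
by move=> y; rewrite scaleN1r.
Qed.

(* Parallelogram identity: the midpoint of two almost minimizers is admissible. *)
Lemma almost_minimizers_close (I e e' : R) phi psi d :
  (forall zeta, admissible zeta -> I <= twice_energy zeta) ->
  admissible phi -> admissible psi -> admissible0 d ->
  (forall y, d y = psi y - phi y) -> twice_energy phi <= I + e -> twice_energy psi <= I + e' ->
  B (strain d) (strain d) <= 2 * (e + e').
Proof.
move=> Il ap aq ad dE pe qe; have [[hp _] [hd _]] := (ap, ad).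
have e1 : twice_energy psi =
    twice_energy phi + 2 * 1 * B (total_strain phi) (strain d) + 1 ^+ 2 * B (strain d) (strain d).
  by apply: twice_energy_linE => // y; rewrite dE scale1r addrC subrK.
have e2 := twice_energy_lin hg hC hA 2^-1 hp hd.
(* Twice the value at the midpoint is the sum of the values at the ends minus half of B (strain d,
   strain d). *)
have := Il _ (admissible_lin hg 2^-1 ap ad); rewrite e2.
move: e1 pe qe {e2};
move: (twice_energy phi) (twice_energy psi) (B (total_strain phi) (strain d)) (B (strain d) (strain d)).
move=> q q' b D; lra.
Qed.

Lemma component_diff phi psi d i : (forall y, d y = psi y - phi y) ->
  component d i = fun x => component psi i x - component phi i x.
Proof. by move=> dE; apply/funext => x; rewrite /component dE !mxE. Qed.

Lemma wderiv_diff phi psi d i j : H1per g phi -> H1per g psi ->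
  (forall y, d y = psi y - phi y) ->
  {ae leb3, forall x : R3 R, D_ d i j x = D_ psi i j x - D_ phi i j x}.
Proof.
move=> hp hq dE.
have [lw fw] := H1per_wderiv hg i j hp; have [lk fk] := H1per_wderiv hg i j hq.
apply: wderiv_ae; first by apply: (L2per_L2loc hg); exact: L2perB.
rewrite (component_diff i dE).
by apply: is_wderivB => //; apply: (L2per_loc1 hg) => //; exact: H1per_component.
Qed.

Lemma diff_le : exists2 K : R, 0 < K &
  forall phi psi d, admissible phi -> admissible psi -> admissible0 d ->
  (forall y, d y = psi y - phi y) ->
  (forall i, << fun x => component psi i x - component phi i x >> <=
     K * B (strain d) (strain d)) /\
  (forall i j, << fun x => D_ psi i j x - D_ phi i j x >> <= K * B (strain d) (strain d)).
Proof.
have [a a0 aP] := bform_coercive hC; have [K K0 KP] := H1_strain_le hg.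
exists (K / a) => [|phi psi d ap aq ad dE]; first exact: divr_gt0.
have [[hp _] [hq _]] := (ap, aq); have [hd md] := ad.
have le : K * mdot g (strain d) (strain d) <= K / a * B (strain d) (strain d).
  rewrite -mulrA ler_pM2l// ler_pdivlMl//.
  by apply: aP; [exact: sqmx_strain|exact: aesym_strain].
have [k1 k2] := KP d hd md.
split=> [i|i j]; first by rewrite -(component_diff i dE); exact: le_trans (k1 i) le.
apply: le_trans le; apply: le_trans (k2 i j).
have ld := (H1per_wderiv hg i j hd).1.
have lD := L2perB (H1per_wderiv hg i j hq).1 (H1per_wderiv hg i j hp).1.
have ae := wderiv_diff i j hp hq dE.
rewrite le_eqVlt; apply/orP; left; apply/eqP.
apply: ae_eq_dot (L2per_sqint lD) (L2per_sqint ld) (L2per_sqint lD) (L2per_sqint ld) _ _ => //;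
  by apply: ae3S ae => x -> _.
Qed.

Lemma cvg_bigsum (I : finType) (F : I -> nat -> R) (L : I -> R) :
  (forall a, F a n @[n --> \oo] --> L a) -> \sum_a F a n @[n --> \oo] --> \sum_a L a.
Proof.
move=> FL; elim: (index_enum _) => [|a r IH].
  by under eq_fun do rewrite big_nil; rewrite big_nil; exact: cvg_cst.
by under eq_fun do rewrite big_cons; rewrite big_cons; exact: cvgD.
Qed.

(** Components and derivatives converge separately. By closedness of weak derivatives the limits of
    the latter are weak derivatives of the limit field, hence agree almost everywhere with its
    chosen ones. *)
Lemma exists_limit (Phi : nat -> R3 R -> 'cV[R]_3) (c : R) : (forall n, admissible (Phi n)) ->
  (forall n d, admissible0 d -> (forall y, d y = Phi n.+1 y - Phi n y) ->
     B (strain d) (strain d) <= c * 4^-1 ^+ n) ->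
  exists2 phi, admissible phi & forall i j, cvgL2 leb3 H (fun n => D_ (Phi n) i j) (D_ phi i j).
Proof.
move=> aPhi Bc; have [K K0 KP] := diff_le.
have hPhi n : H1per g (Phi n) := (aPhi n).1.
have step n : (forall i, << fun x => component (Phi n.+1) i x - component (Phi n) i x >> <=
     K * c * 4^-1 ^+ n) /\
  (forall i j, << fun x => D_ (Phi n.+1) i j x - D_ (Phi n) i j x >> <= K * c * 4^-1 ^+ n).
  have [d dE ad] := admissible_diff (aPhi n) (aPhi n.+1).
  have [k1 k2] := KP _ _ _ (aPhi n) (aPhi n.+1) ad dE.
  have le : K * B (strain d) (strain d) <= K * c * 4^-1 ^+ n.
    by rewrite -mulrA ler_pM2l//; exact: Bc.
  by split=> [i|i j]; [exact: le_trans (k1 i) le|exact: le_trans (k2 i j) le].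
have lc n i := H1per_component hg i (hPhi n).
have lw n i j := (H1per_wderiv hg i j (hPhi n)).1.
have [l lP] : exists l : 'I_3 -> R3 R -> R, forall i,
    L2per g (l i) /\ cvgL2 leb3 H (fun n => component (Phi n) i) (l i).
  suff [l lP] : {l : 'I_3 -> R3 R -> R & forall i,
      L2per g (l i) /\ cvgL2 leb3 H (fun n => component (Phi n) i) (l i)} by exists l.
  apply: (@choice _ _ (fun i (l : R3 R -> R) =>
    L2per g l /\ cvgL2 leb3 H (fun n => component (Phi n) i) l)) => i.
  by have [l] := L2per_complete (fun n => lc n i) (fun n => (step n).1 i); exists l.
have [w wP] : exists w : 'I_3 * 'I_3 -> R3 R -> R, forall ij,
    L2per g (w ij) /\ cvgL2 leb3 H (fun n => D_ (Phi n) ij.1 ij.2) (w ij).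
  suff [w wP] : {w : 'I_3 * 'I_3 -> R3 R -> R & forall ij,
      L2per g (w ij) /\ cvgL2 leb3 H (fun n => D_ (Phi n) ij.1 ij.2) (w ij)} by exists w.
  apply: (@choice _ _ (fun ij (w : R3 R -> R) =>
    L2per g w /\ cvgL2 leb3 H (fun n => D_ (Phi n) ij.1 ij.2) w)) => -[i j].
  by have [w] := L2per_complete (fun n => lw n i j) (fun n => (step n).2 i j); exists w.
pose phi x : 'cV[R]_3 := \col_i l i x.
have ce i : component phi i = l i by apply/funext => x; rewrite /component mxE.
have wd i j : is_wderiv j (l i) (w (i, j)).
  apply: (is_wderiv_closed hg (fun n => lc n i) (fun n => lw n i j) (lP i).1 (wP (i, j)).1
    (lP i).2 (wP (i, j)).2) => n.
  exact: (H1per_wderiv hg i j (hPhi n)).2.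
have hphi : H1per g phi.
  apply: (H1perI hg) => [i|i j]; rewrite ce; first exact: (lP i).1.
  by exists (w (i, j)); [exact: (wP (i, j)).1|].
exists phi.
  split=> // i; rewrite ce.
  have s1 : sqint leb3 H (fun=> 1 : R) := L2per_sqint (L2per_cst hg 1).
  have z1 : cvgL2 leb3 H (fun=> fun=> 1 : R) (fun=> 1).
    rewrite /cvgL2 (_ : (fun=> _) = fun=> 0 : R); first exact: cvg_cst.
    apply/funext => n; rewrite /dot; under eq_Rintegral do rewrite subrr mulr0.
    by rewrite /Rintegral integral0.
  have := cvg_dot mH (fun n => L2per_sqint (lc n i)) (fun=> s1) (L2per_sqint (lP i).1) s1
    (lP i).2 z1.
  have -> : (fun n => << component (Phi n) i, fun=> 1 >>) = fun=> m i.
    by apply/funext => n; exact: (aPhi n).2.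
  move=> c1; apply: (cvg_unique _ c1); first exact: Rhausdorff.
  exact: cvg_cst.
move=> i j; have lD := (H1per_wderiv hg i j hphi).1.
have ae := wderiv_ae (L2per_L2loc hg (wP (i, j)).1) (wd i j).
have := (wP (i, j)).2; rewrite /cvgL2/=.
have -> // : (fun n => << fun x => D_ (Phi n) i j x - w (i, j) x >>) =
   (fun n => << fun x => D_ (Phi n) i j x - D_ phi i j x >>).
apply/funext => n.
have l1 := L2per_sqint (L2perB (lw n i j) (wP (i, j)).1).
have l2 := L2per_sqint (L2perB (lw n i j) lD).
by apply: (ae_eq_dot mH l1 l2 l1 l2); rewrite ce; apply: ae3S ae => x -> _.
Qed.

End Existence.

(** * Lower semicontinuity and existence of a minimizer *)

Section DirectMethod.
Context {R : realType}.
Implicit Types (x y : R3 R) (i j : 'I_3) (phi psi d : R3 R -> 'cV[R]_3).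
Variables (g : 'I_3 -> R3 R) (hg : lin_indep g).
Variables (C : R3 R -> tensor4 R) (hC : rigidity g C).
Variables (A : 'M[R]_3) (hA : A^T = A) (m : 'I_3 -> R).

Notation H := (halfcell g).
Notation "<< f >>" := (dot leb3 H f f).
Notation D_ phi i j := (wderiv j (component phi i)).
Notation B := (bform g C).
Notation admissible := (admissible g m).
Notation admissible0 := (admissible0 g).
Notation twice_energy := (twice_energy g C A).
Notation total_strain := (total_strain A).

Let mH : measurable H.
Proof. exact: measurable_halfcell. Qed.

Lemma mdot_small (E F : R3 R -> 'M[R]_3) (e : R) : sqmx g E -> sqmx g F -> 0 < e ->
  `|mdot g E F| <= e * mdot g E E + e^-1 * mdot g F F.
Proof.
move=> sE sF e0; rewrite !mdotE// !mulr_sumr -big_split/=.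
apply: le_trans (ler_norm_sum _ _ _) _; apply: ler_sum => i _.
rewrite !mulr_sumr -big_split/=.
apply: le_trans (ler_norm_sum _ _ _) _; apply: ler_sum => j _.
exact: dot_small.
Qed.

Lemma cvg_strain_sum (Phi : nat -> R3 R -> 'cV[R]_3) phi :
  (forall i j, cvgL2 leb3 H (fun n => D_ (Phi n) i j) (D_ phi i j)) ->
  \sum_i \sum_j << fun x => D_ (Phi n) i j x - D_ phi i j x >> @[n --> \oo] --> (0 : R).
Proof.
move=> cD.
have c1 i : \sum_j << fun x => D_ (Phi n) i j x - D_ phi i j x >> @[n --> \oo] -->
    \sum_(j < 3) (0 : R).
  apply: (cvg_bigsum (F := fun j n =>
    << fun x => D_ (Phi n) i j x - D_ phi i j x >>) (L := fun=> 0)) => j.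
  exact: cD.
have := cvg_bigsum c1; rewrite big1// => i _; exact: big1.
Qed.

(* B (E, E) <= B (En, En) - 2 B (E, En - E) by positivity of B (En - E, En - E), and
   the cross term tends to 0. *)
Lemma twice_energy_lsc (Phi : nat -> R3 R -> 'cV[R]_3) phi (I : R) :
  admissible phi -> (forall n, admissible (Phi n)) ->
  (forall n, twice_energy (Phi n) <= I + 4^-1 ^+ n) ->
  (forall i j, cvgL2 leb3 H (fun n => D_ (Phi n) i j) (D_ phi i j)) -> twice_energy phi <= I.
Proof.
move=> aphi aPhi QI cD; have cs := cvg_strain_sum cD.
set s := (fun n => _) in cs.
have lower_bound (q b b' p s' k : R) : 0 <= b' -> - b <= p + s' ->
    q + 2 * 1 * b + 1 ^+ 2 * b' <= I + k -> q <= I + k + 2 * p + 2 * s'.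
  by clear; lra.
have [hp _] := aphi; have st := sqmx_total_strain hg A hp; have sa := sqmx_act hC st.
pose P := mdot g (act C (total_strain phi)) (act C (total_strain phi)).
have P0 : 0 <= P.
  by rewrite /P mdotE//; apply: sumr_ge0 => i _; apply: sumr_ge0 => j _; exact: dot_ge0.
have le e n : 0 < e -> twice_energy phi <= I + 4^-1 ^+ n + 2 * e * P + 2 * e^-1 * s n.
  move=> e0; have [d dE ad] := admissible_diff hg aphi (aPhi n).
  have [hd _] := ad.
  have sd := sqmx_strain hg hd.
  have e1 : twice_energy (Phi n) = twice_energy phi + 2 * 1 * B (total_strain phi) (strain d) +
      1 ^+ 2 * B (strain d) (strain d).
    by apply: (twice_energy_linE hg hC hA) => // y; rewrite dE scale1r addrC subrK.
  have b1 := mdot_small sa sd e0.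
  have b2 : mdot g (strain d) (strain d) <= s n.
    apply: le_trans (mdot_strain_le hg hd) _; rewrite /s.
    apply: ler_sum => i _; apply: ler_sum => j _.
    have ld := (H1per_wderiv hg i j hd).1.
    have lD := L2perB (H1per_wderiv hg i j (aPhi n).1).1 (H1per_wderiv hg i j hp).1.
    have ae := wderiv_diff hg i j hp (aPhi n).1 dE.
    rewrite le_eqVlt; apply/orP; left; apply/eqP.
    apply: (ae_eq_dot mH (L2per_sqint ld) (L2per_sqint lD) (L2per_sqint ld) (L2per_sqint lD));
      by apply: ae3S ae => x ->.
  have b3 := B_strain_ge0 hg hC hd.
  have b4 : e^-1 * mdot g (strain d) (strain d) <= e^-1 * s n.
    by rewrite ler_pM2l// invr_gt0.
  have b5 : - B (total_strain phi) (strain d) <= e * P + e^-1 * s n.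
    rewrite -normrN in b1; apply: le_trans (ler_norm _) _.
    by apply: le_trans b1 _; rewrite lerD2l.
  have := QI n; rewrite e1 -[2 * e * P]mulrA -[2 * e^-1 * s n]mulrA.
  exact: (lower_bound _ _ _ _ _ _ b3 b5).
(* First n tends to infinity with the weight [e] fixed; only afterwards does [e] tend to 0. *)
have le' e : 0 < e -> twice_energy phi <= I + 2 * e * P.
  move=> e0.
  have c4 : (4^-1 ^+ n : R) @[n --> \oo] --> (0 : R).
    by apply: cvg_expr; rewrite ger0_norm// invf_lt1// ltr1n.
  have c : I + 4^-1 ^+ n + 2 * e * P + 2 * e^-1 * s n @[n --> \oo] -->
      I + 0 + 2 * e * P + 2 * e^-1 * 0.
    by apply: cvgD; [apply: cvgD; [apply: cvgD => //; exact: cvg_cst|exact: cvg_cst]|exact: cvgMr].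
  rewrite mulr0 !addr0 in c.
  apply: (ler_cvg_to (cvg_cst (twice_energy phi)) c).
  by apply: nearW => n; exact: le.
apply/ler_addgt0Pr => e e0.
(* With this weight the excess 2 e P becomes e P/(P+1), at most [e] even when [P] vanishes. *)
have e'0 : 0 < e / (2 * (P + 1)) by rewrite divr_gt0// mulr_gt0// ltr_wpDl.
apply: le_trans (le' _ e'0) _; rewrite lerD2l.
have P1 : 0 < P + 1 by rewrite ltr_wpDl.
rewrite (_ : 2 * _ * P = e * (P / (P + 1))); last by field; rewrite gt_eqF.
by rewrite ler_piMr ?ltW// ltr_pdivrMr// mul1r ltrDl.
Qed.

Lemma exists_minimizer : exists2 phi, admissible phi &
  forall psi, admissible psi -> twice_energy phi <= twice_energy psi.
Proof.
pose S := [set twice_energy phi | phi in [set phi | admissible phi]].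
have S0 : S !=set0.
  by have [phi ap] := admissible_nonempty hg m; exists (twice_energy phi), phi.
have Sl : has_lbound S.
  by exists 0 => _ [phi [hp _] <-]; exact: twice_energy_ge0.
have Il psi : admissible psi -> inf S <= twice_energy psi by move=> ap; apply: ge_inf => //; exists psi.
(* The precision 4^-n is the rate of increments demanded by the completeness lemma. *)
have [Phi PhiP] : {Phi : nat -> R3 R -> 'cV[R]_3 & forall n,
    admissible (Phi n) /\ twice_energy (Phi n) <= inf S + 4^-1 ^+ n}.
  apply: (@choice _ _ (fun n phi => admissible phi /\ twice_energy phi <= inf S + 4^-1 ^+ n)) => n.
  have e0 : (0 : R) < 4^-1 ^+ n by rewrite exprn_gt0.
  have [_ [phi ap <-] le] := inf_adherent e0 (conj S0 Sl).
  by exists phi; split=> //; exact: ltW.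
have [phi ap cD] : exists2 phi, admissible phi &
    forall i j, cvgL2 leb3 H (fun n => D_ (Phi n) i j) (D_ phi i j).
  (* Two consecutive almost minimizers are within 2 (4^-n + 4^-(n+1)), which is at most 4 times
     4^-n. *)
  apply: (exists_limit hg hC (c := 4) (fun n => (PhiP n).1)) => n d ad dE.
  apply: le_trans (almost_minimizers_close hg hC hA Il (PhiP n).1 (PhiP n.+1).1 ad dE
    (PhiP n).2 (PhiP n.+1).2) _.
  have : (0 : R) <= 4^-1 ^+ n by rewrite exprn_ge0.
  by rewrite exprS; move: (4^-1 ^+ n) => k; lra.
have aP n : admissible (Phi n) := (PhiP n).1.
have QP n : twice_energy (Phi n) <= inf S + 4^-1 ^+ n := (PhiP n).2.
have le := twice_energy_lsc ap aP QP cD.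
by exists phi; [exact: ap|move=> psi /Il; exact: le_trans le].
Qed.

End DirectMethod.

(** * From fields in LP to their periodic parts *)

Section Fields.
Context {R : realType}.
Implicit Types (x y : R3 R) (i j : 'I_3) (u v phi psi : R3 R -> 'cV[R]_3).
Variables (g : 'I_3 -> R3 R) (hg : lin_indep g).
Variables (C : R3 R -> tensor4 R) (hC : rigidity g C).
Variables (A : 'M[R]_3) (hA : A^T = A).

Notation mf3 f := (measurable_fun (setT : set (E R)) (f : E R -> R)).
Notation H := (halfcell g).
Notation "<< f , h >>" := (dot leb3 H f h).

Let mH : measurable H.
Proof. exact: measurable_halfcell. Qed.

Let sqint1 : sqint leb3 H (fun=> 1 : R).
Proof. exact: L2per_sqint (L2per_cst hg 1). Qed.

(** In general nonzero, the cell not being centred at the origin; hence the prescribed mean of the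
    periodic part. *)
Definition affine_mean i : R := << component (affine A) i, fun=> 1 >>.

(** The two notions of mean differ by division by a positive volume and by a null set of faces,
    neither of which affects vanishing. *)
Lemma cell_mean_eq0 u : (forall i, mf3 (component u i)) ->
  cell_mean g u = 0 <-> mean_on g u (fun=> 0).
Proof.
move=> mu.
have e (f : R3 R -> R) : mf3 f -> \int[leb3]_(y in cell g) f y = << f, fun=> 1 >>.
  move=> mf; rewrite /dot; under [RHS]eq_Rintegral do rewrite mulr1.
  by congr fine; apply: (integral_cell_halfcell hg); exact/measurable_EFinP.
have c0 : (fine (leb3 (cell g)))^-1 != 0.
  have := integral_cell_halfcell hg (f := cst 1%E) (measurable_cst _).
  rewrite !integral_cst//; last exact: measurable_cell.
  rewrite !mul1e => ->; rewrite invr_eq0 gt_eqF// fine_gt0//.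
  by rewrite leb3_halfcell_gt0//= leb3_halfcell_lty.
split=> [/matrixP u0 i|u0].
  have := u0 i 0; rewrite !mxE => /eqP; rewrite mulf_eq0 (negbTE c0)/= => /eqP.
  by rewrite (e (component u i)).
apply/matrixP => i c; rewrite !mxE.
by rewrite (e (component u i))// u0 mulr0.
Qed.

Lemma mean_LPof phi u : H1per g phi -> (forall y, u y = A *m posvec y + phi y) ->
  mean_on g u (fun=> 0) <-> mean_on g phi (fun i => - affine_mean i).
Proof.
move=> hp uE.
have e i : << component u i, fun=> 1 >> = affine_mean i + << component phi i, fun=> 1 >>.
  rewrite (component_LPof i uE).
  under [X in dot _ _ X _]eq_fun do rewrite mul1r.
  rewrite dotDl//; last exact: L2per_sqint (H1per_component hg i hp).
  by have /L2locP[ma sa] := L2loc_affine A i; exact: sqint_cube_halfcell.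
split=> mu i; first by apply/eqP; rewrite -subr_eq0 opprK addrC -e mu.
by rewrite e mu subrr.
Qed.

Lemma measurable_LPof phi u i : H1per g phi -> (forall y, u y = A *m posvec y + phi y) ->
  mf3 (component u i).
Proof.
move=> hp uE; rewrite (component_LPof i uE); apply: measurable_funD.
  by have /L2locP[] := L2loc_affine A i.
apply: measurable_funM; first exact: measurable_cst.
exact: L2per_mf3 (H1per_component hg i hp).
Qed.

Notation V := (LP0 g `&` LPof g A).
Notation admissible := (admissible g (fun i => - affine_mean i)).

Lemma LP_admissible u : V u -> exists2 phi, admissible phi & forall y, u y = A *m posvec y + phi y.
Proof.
move=> [[_ u0] [phi hp uE]]; exists phi => //; split=> //.
apply/(mean_LPof hp uE)/cell_mean_eq0 => // i.
exact: measurable_LPof hp uE.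
Qed.

Lemma admissible_LP phi u : admissible phi -> (forall y, u y = A *m posvec y + phi y) -> V u.
Proof.
move=> [hp mp] uE.
have uA : LPof g A u by exists phi.
split=> //; split; first by exists A.
apply/cell_mean_eq0; last by apply/(mean_LPof hp uE).
by move=> i; exact: measurable_LPof hp uE.
Qed.

Lemma admissible0E v : H1per0 g v <-> admissible0 g v.
Proof.
have mv : H1per g v -> forall i, mf3 (component v i).
  by move=> hv i; exact: L2per_mf3 (H1per_component hg i hv).
by split=> -[hv v0]; split=> //; apply/cell_mean_eq0 => //; exact: mv.
Qed.

Lemma cell_bform (E F : R3 R -> 'M[R]_3) : (forall i j, mf3 (fun y => E y i j)) ->
  (forall i j, mf3 (fun y => F y i j)) ->
  \int[leb3]_(y in cell g) mxdot (tensor_act (C y) (E y)) (F y) = bform g C E F.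
Proof.
move=> mE mF; congr fine; apply: (integral_cell_halfcell hg); apply/measurable_EFinP.
have [_ Coo _ _] := hC.
have ms (I : Type) (r : seq I) (K : I -> R3 R -> R) : (forall a, mf3 (K a)) ->
    mf3 (fun y => \sum_(a <- r) K a y).
  by move=> mK; apply: measurable_sum.
under eq_fun do rewrite mxdotE.
apply: (ms) => i; apply: (ms) => j; apply: measurable_funM => //.
under eq_fun do rewrite mxE.
apply: (ms) => k; apply: (ms) => l; apply: measurable_funM => //.
by have [] := Lfun_oo_bounded (Coo i j k l).
Qed.

Lemma sqmx_strain_LPof phi u : H1per g phi -> (forall y, u y = A *m posvec y + phi y) ->
  sqmx g (strain u).
Proof.
move=> hp uE i j; apply: ae_eq_sqint (sqmx_total_strain hg A hp i j) => //.
  by apply: measurable_funTS; exact: (measurable_strain_LPof hg i j hp uE).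
by apply: ae3S (strain_LPof hg hA hp uE) => x ->.
Qed.

Lemma cell_bform_LPof phi u v : H1per g phi -> H1per g v ->
  (forall y, u y = A *m posvec y + phi y) ->
  \int[leb3]_(y in cell g) mxdot (tensor_act (C y) (strain u y)) (strain v y) =
  bform g C (total_strain A phi) (strain v).
Proof.
move=> hp hv uE; rewrite cell_bform; last 2 first.
- by move=> i j; exact: (measurable_strain_LPof hg i j hp uE).
- by move=> i j; exact: L2per_mf3 (L2per_strain hg i j hv).
have su := sqmx_strain_LPof hp uE; have sv := sqmx_strain hg hv.
apply: (bform_ae hC su (sqmx_total_strain hg A hp) sv sv); last by apply: aeW.
exact: (strain_LPof hg hA hp uE).
Qed.

Lemma energyE phi u : H1per g phi -> (forall y, u y = A *m posvec y + phi y) ->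
  energy g C u = 2^-1 * twice_energy g C A phi.
Proof.
move=> hp uE; rewrite /energy; congr (_ * _).
have mu i j := measurable_strain_LPof hg i j hp uE.
rewrite (cell_bform mu mu).
have su := sqmx_strain_LPof hp uE; have st := sqmx_total_strain hg A hp.
have ae := strain_LPof hg hA hp uE.
exact: (bform_ae hC su st su st ae ae).
Qed.

End Fields.

Theorem theorem21 (R : realType) (g : 'I_3 -> R3 R) (C : R3 R -> tensor4 R)
    (A : 'M[R]_3) (hg : lin_indep g) (hC : rigidity g C) (hA : A^T = A) :
  let V := LP0 g `&` LPof g A in
  let minimizer u := V u /\
    (energy g C u)%:E = ereal_inf [set (energy g C w)%:E | w in V] in
  let weak_solution u := V u /\
    forall v, H1per0 g v ->
      \int[leb3]_(y in cell g)
         mxdot (tensor_act (C y) (strain u y)) (strain v y) = 0 in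
  exists uA : R3 R -> 'cV[R]_3,
    [/\ minimizer uA,
        forall u, minimizer u -> {ae leb3, forall y : R3 R, u y = uA y},
        weak_solution uA &
        forall u, weak_solution u -> {ae leb3, forall y : R3 R, u y = uA y}].
Proof.
move=> V minimizer weak_solution.
have half_gt0 : (0 : R) < 2^-1 by rewrite invr_gt0.
pose m i : R := - affine_mean g A i.
have [phi ap mp] := exists_minimizer hg hC hA m.
pose uA y : 'cV[R]_3 := A *m posvec y + phi y.
have uAE y : uA y = A *m posvec y + phi y by [].
have wp := minimizer_weakly_stationary hg hC hA ap mp.
have VA : V uA := admissible_LP hg hA ap uAE.
have unique u psi : admissible g m psi -> (forall y, u y = A *m posvec y + psi y) ->
    weakly_stationary g C A psi -> {ae leb3, forall y : R3 R, u y = uA y}.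
  move=> aq uE wq; have := weakly_stationary_unique hg hC aq ap wq wp.
  by apply: ae3S => y e; rewrite uE uAE e.
exists uA; split.
- split=> //; apply/eqP; rewrite eq_le; apply/andP; split.
    apply: le_ereal_inf_tmp => _ [w /(LP_admissible hg)[psi aq wE] <-].
    rewrite lee_fin (energyE hg hC hA ap.1 uAE) (energyE hg hC hA aq.1 wE).
    rewrite (ler_pM2l half_gt0); exact: (mp _ aq).
  by apply: ereal_inf_lbound; exists uA; [exact: VA|].
- move=> u [Vu ue]; have [psi aq uE] := LP_admissible hg Vu.
  (* Uniqueness of minimizers is reduced to that of weak solutions: the periodic part of any
     minimizer minimizes [twice_energy], hence is weakly stationary. *)
  apply: (unique u psi aq uE); apply: (minimizer_weakly_stationary hg hC hA aq) => chi ac.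
  pose w y : 'cV[R]_3 := A *m posvec y + chi y.
  have wE y : w y = A *m posvec y + chi y by [].
  have : (ereal_inf [set (energy g C w)%:E | w in V] <= (energy g C w)%:E)%E.
    by apply: ereal_inf_lbound; exists w; [exact: (admissible_LP hg hA ac wE)|].
  rewrite -ue lee_fin (energyE hg hC hA aq.1 uE) (energyE hg hC hA ac.1 wE).
  by move=> le; rewrite -(ler_pM2l half_gt0).
- split=> // v /(admissible0E hg) av.
  by rewrite (cell_bform_LPof hg hC hA ap.1 av.1 uAE); exact: wp.
- move=> u [Vu uw]; have [psi aq uE] := LP_admissible hg Vu.
  apply: (unique u psi aq uE) => v av.
  rewrite -(cell_bform_LPof hg hC hA aq.1 av.1 uE); apply: uw.
  exact/(admissible0E hg).
Qed.
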